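(* Let $\alpha$ be a partition with all parts $\ge 2$ and let $R_\alpha$ be the connected ribbon with rows of lengths $\alpha_1,\dots,\alpha_{\ell(\alpha)}$. If $\alpha$ has full equivalence class, then $R_\alpha$ has full Schur support, i.e. $[R_\alpha]=[\alpha,(|\alpha|-\ell(\alpha)+1,\ell(\alpha)-1)]$. When $\ell(\alpha)\le 4$, $\alpha$ has full equivalence class if and only if $R_\alpha$ has full Schur support.
   Context: A ribbon is a skew Young diagram (English convention) containing no $2\times2$ square. For a composition $\beta$, the connected ribbon $R_\beta$ has rows, from top to bottom, of lengths $\beta_1,\dots,\beta_{\ell(\beta)}$, each pair of consecutive rows sharing exactly one column. For a skew shape $A$, $s_A=\sum_\nu c_A^\nu s_\nu$ and the Schur support is $[A]=\{\nu:c_A^\nu>0\}$. For $\alpha$ a partition with parts $\ge2$, $[R_\alpha]\subseteq[\alpha,(|\alpha|-\ell(\alpha)+1,\ell(\alpha)-1)]$ where $[\lambda,\mu]$ is an interval in dominance order; full Schur support means equality. A partition $\alpha$ with parts $\ge2$ (and $\ell(\alpha)\ge3$ in the paper's definition) has full equivalence class if $[R_\alpha]=[R_\beta]$ for every rearrangement $\beta$ of the entries of $\alpha$. *)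

(* Defs.v *)
From HB Require Import structures.
From mathcomp Require Import all_boot all_order all_algebra.
From mathcomp Require Import finmap.
From mathcomp Require Import mpoly.

Set Implicit Arguments.
Unset Strict Implicit.
Unset Printing Implicit Defensive.

Import GRing.Theory Num.Theory.

Local Open Scope nat_scope.

Definition is_partition (nu : seq nat) : bool := sorted geq nu && (0 \notin nu).

(* Cells are pairs (row, column), numbered from 0, rows going downwards
   (English convention). *)
Definition diagram := seq (nat * nat).

(* The diagram la / mu: row i consists of the columns mu_i <= j < la_i. *)
Definition skew_diagram (la mu : seq nat) : diagram :=
  [seq (i, j) | i <- iota 0 (size la),
                j <- iota (nth 0 mu i) (nth 0 la i - nth 0 mu i)].

(* The connected ribbon with row lengths b_0, b_1, ... from top to bottom is
   outer / inner: its last row starts in column 0, and row i starts in the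
   last column of row i+1, so inner_i is the sum of (b_k - 1) over k > i. *)
Fixpoint ribbon_inner (b : seq nat) : seq nat :=
  if b is _ :: b' then sumn (map predn b') :: ribbon_inner b' else [::].

Fixpoint ribbon_outer (b : seq nat) : seq nat :=
  if b is r :: b' then (sumn (map predn b') + r) :: ribbon_outer b' else [::].

Definition ribbon (b : seq nat) : diagram :=
  skew_diagram (ribbon_outer b) (ribbon_inner b).

Lemma ribbon_row_length (b : seq nat) (i : nat) :
  nth 0 (ribbon_outer b) i = nth 0 (ribbon_inner b) i + nth 0 b i.
Proof. by elim: b i => [|r b IHb] [|i] //=. Qed.

Lemma ribbon_overlap (b : seq nat) (i : nat) : 0 \notin b -> i.+1 < size b ->
  nth 0 (ribbon_outer b) i.+1 = (nth 0 (ribbon_inner b) i).+1.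
Proof.
elim: b i => [|r b IHb] // i; rewrite inE negb_or => /andP[_ b_gt0].
case: i => [|i] /=; last exact: IHb.
case: b b_gt0 {IHb} => [|s b] //=; rewrite inE negb_or => /andP[s_gt0 _] _.
by rewrite addnC -addSn prednK // lt0n eq_sym.
Qed.

Definition is_ssyt (N : nat) (D : diagram) (T : {ffun seq_sub D -> 'I_N}) : bool :=
  [forall c : seq_sub D, forall d : seq_sub D,
     (((val c).1 == (val d).1) && ((val c).2 <= (val d).2) ==> (T c <= T d)) &&
     (((val c).2 == (val d).2) && ((val c).1 < (val d).1) ==> (T c < T d))].

(* The (skew) Schur function s_D in the N variables 'X_0, ..., 'X_(N-1). *)
Definition schur_diagram (N : nat) (D : diagram) : {mpoly int[N]} :=
  (\sum_(T : {ffun seq_sub D -> 'I_N} | is_ssyt T) \prod_(c : seq_sub D) 'X_(T c))%R.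

Definition schur (N : nat) (nu : seq nat) : {mpoly int[N]} :=
  schur_diagram N (skew_diagram nu [::]).

(* s_D = \sum_nu c_nu s_nu.  An identity between symmetric functions is an
   identity between polynomials in N variables for every N.  Such a c is
   unique, since the Schur functions are linearly independent. *)
Definition schur_expansion (D : diagram) (c : {fsfun seq nat -> int with 0%R}) : Prop :=
  (forall nu : seq nat, nu \in finsupp c -> is_partition nu) /\
  (forall N : nat,
     schur_diagram N D = (\sum_(nu <- finsupp c) c nu *: schur N nu)%R).

Definition schur_support (D : diagram) (nu : seq nat) : Prop :=
  exists c : {fsfun seq nat -> int with 0%R},
    schur_expansion D c /\ (0 < c nu)%R.

Definition dominated (la mu : seq nat) : Prop :=
  sumn la = sumn mu /\ forall k : nat, sumn (take k la) <= sumn (take k mu).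

Definition dominance_interval (la mu nu : seq nat) : Prop :=
  [/\ is_partition nu, dominated la nu & dominated nu mu].

(* The upper bound may end with a zero part (when al has one part), which is
   irrelevant to the dominance order. *)
Definition full_schur_support (al : seq nat) : Prop :=
  forall nu : seq nat,
    schur_support (ribbon al) nu <->
    dominance_interval al [:: sumn al - size al + 1; size al - 1] nu.

Definition full_equivalence_class (al : seq nat) : Prop :=
  forall be : seq nat, perm_eq be al ->
  forall nu : seq nat, schur_support (ribbon al) nu <-> schur_support (ribbon be) nu.

(* Main.v *)
Require Import Defs.
From mathcomp Require Import all_boot all_order all_algebra.
From mathcomp Require Import zify ring.
From mathcomp Require Import finmap mpoly.

(* The coefficient of s_nu in the ribbon Schur function with row lengths
   b_1, ..., b_l counts the fillings of nu by l horizontal strips ("blocks")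
   of sizes b_1, ..., b_l in which every block has a cell strictly below some
   cell of the preceding block.  This follows by inverting the multiplication
   by complete symmetric functions, the Pieri rule being proved by induction on
   the number of variables.

   If a is a partition with parts at least 2, then nu is in the support of R_a
   exactly when nu dominates a and every row satisfies
     nu_k <= a_k + sum_(i > k) (a_i - 1).                                    (1)
   Necessity: among two consecutive blocks from the k-th on, the former has a
   cell above row k or the latter has one below.  Sufficiency: split the shape
   where a dominance inequality is an equality, and elsewhere remove the
   smallest block, from the bottom rows except in the at most one row where
   (1) would be lost.  If some nu of the interval violates (1) at row k,
   then exchanging a_(k-1) and a_k gives a rearrangement whose support
   contains a shape that violates (1) at row k, so a has no full equivalence
   class.  With at most four rows, full support amounts to a few inequalities
   between the parts, and explicit fillings exist for every rearrangement. *)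

Set Implicit Arguments.
Unset Strict Implicit.
Unset Printing Implicit Defensive.

Import GRing.Theory Num.Theory.

Local Open Scope nat_scope.

(** * Chains of horizontal strips *)

(** Appending a block depends on the past only through the highest row met by the preceding block,
    so [rchain] carries a bound [i] on that row and nothing else. The difficulty in the sufficiency
    proof is that removing a block must leave a shape whose own last block reaches above some
    removed cell. The induction therefore carries a second claim: under a bound stricter by one in
    the last row, the last block can be made to reach above that row. Splitting at equalities
    secures strict dominance, which greedy removal preserves because the removed part is the
    smallest; parts at least 2 make the row at risk unique. The exchange breaks (1) for the
    following reason. In decreasing order every block after the k-th costs row k one cell. If the
    larger part a_(k-1) comes second, its surplus a_(k-1) - a_k lies above row k while row k still
    gets a_k cells. One later block may then lie in row k entirely, and this is the extra cell. *)

Fixpoint psum (f : nat -> nat) (m : nat) : nat :=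
  if m is m'.+1 then psum f m' + f m' else 0.

Definition noninc (f : nat -> nat) : Prop := forall j, f j.+1 <= f j.

Definition hstrip (nu mu : nat -> nat) : Prop :=
  forall j, mu j <= nu j /\ nu j.+1 <= mu j.

(* [be] lists the block sizes with the last block first; [rchain be nu i] says that [nu]
   has a filling in which the last block has a cell in a row of index less than [i]. *)
Fixpoint rchain (be : seq nat) (nu : nat -> nat) (i : nat) : Prop :=
  if be is a :: be' then
    exists mu i', [/\ rchain be' mu i', hstrip nu mu,
      exists R, nu R = 0 /\ psum nu R = psum mu R + a,
      exists j, i' <= j /\ mu j < nu j
    & exists j, j < i /\ mu j < nu j]
  else forall j, nu j = 0.

Fixpoint blocks (al : nat -> nat) (l : nat) : seq nat :=
  if l is l'.+1 then al l' :: blocks al l' else [::].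

Lemma noninc_le f i j : noninc f -> i <= j -> f j <= f i.
Proof.
move=> f_noninc /subnK <-; elim: (j - i) => // d IHd.
by rewrite addSn (leq_trans (f_noninc _)).
Qed.

Lemma noninc_eq0 f i j : noninc f -> f i = 0 -> i <= j -> f j = 0.
Proof. by move=> f_noninc fi0 /(noninc_le f_noninc); lia. Qed.

Lemma eq_psum f g m : (forall j, j < m -> f j = g j) -> psum f m = psum g m.
Proof.
elim: m => //= m IHm eq_fg; rewrite eq_fg // IHm // => j ltjm.
by apply: eq_fg; lia.
Qed.

Lemma psum_addn f m n : psum f (m + n) = psum f m + psum (fun j => f (m + j)) n.
Proof. by elim: n => [|n IHn] /=; rewrite ?addn0 // addnS /= IHn; lia. Qed.

Lemma psumS f m : psum f m.+1 = psum f m + f m.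
Proof. by []. Qed.

Lemma leq_psum f m n : m <= n -> psum f m <= psum f n.
Proof. by move/subnKC <-; rewrite psum_addn; lia. Qed.

Lemma psum_ge_const f a m n : m <= n -> (forall j, m <= j < n -> a <= f j) ->
  psum f m + (n - m) * a <= psum f n.
Proof.
move=> lemn; have -> : n = m + (n - m) by lia.
move: (n - m) => d; have -> : m + d - m = d by lia.
elim: d => [|d IHd] le_af; first by rewrite addn0; lia.
rewrite addnS /=; have := le_af (m + d); have : forall j, m <= j < m + d -> a <= f j.
  by move=> j ltj; apply: le_af; lia.
by move/IHd; lia.
Qed.

Lemma psum_const0 f R n : noninc f -> f R = 0 -> R <= n -> psum f n = psum f R.
Proof.
move=> f_noninc fR0 /subnKC <-; elim: (n - R) => [|d IHd]; rewrite ?addn0 //.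
by rewrite addnS /= IHd (noninc_eq0 f_noninc fR0) //; lia.
Qed.

Lemma noninc_last f n : noninc f -> 0 < f 0 -> f n = 0 ->
  exists L, 0 < f L /\ f L.+1 = 0.
Proof.
move=> f_noninc f0; elim: n => [|n IHn] fn0; first by lia.
by case: (posnP (f n)) => [/IHn //|fn_gt0]; exists n.
Qed.

(** The cells of the last block lie in nonempty rows of [nu], so any bound on its highest row may be
    replaced by [m]. *)
Lemma rchain_row be nu m : be <> [::] ->
  (forall j, m <= j -> nu j = 0) -> (exists i, rchain be nu i) -> rchain be nu m.
Proof.
case: be => // a be _ nu0 [i [mu [i' [ch_mu st wt cell1 [j [_ ltj]]]]]].
exists mu, i'; split=> //; exists j; split=> //.
by rewrite ltnNge; apply/negP => /nu0; lia.
Qed.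

Lemma rchain_ext be nu nu' i : nu =1 nu' -> rchain be nu i -> rchain be nu' i.
Proof.
move=> eq_nu; case: be => [|a be] /=; first by move=> nu0 j; rewrite -eq_nu.
move=> [mu [i' [ch_mu st [R [R0 wt]] [j [lej ltj]] [j' [lej' ltj']]]]].
exists mu, i'; split=> //; first by move=> k; rewrite -!eq_nu.
- by exists R; rewrite -eq_nu -(eq_psum (f := nu)).
- by exists j; rewrite -eq_nu.
by exists j'; rewrite -eq_nu.
Qed.

Lemma rchain_noninc be nu i : rchain be nu i -> noninc nu.
Proof.
case: be => [|a be] /=; first by move=> nu0 j; rewrite !nu0.
by move=> [mu [i' [_ st _ _ _]]] j; have := st j; lia.
Qed.

(* Removing [a] cells greedily from the bottom: rows below [p] are shifted up by one. *)
Definition greedy (nu : nat -> nat) (p a j : nat) : nat :=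
  if j < p then nu j else if j == p then nu p + nu p.+1 - a else nu j.+1.

Section Greedy.
Variables (nu : nat -> nat) (p a : nat).
Hypotheses (nu_noninc : noninc nu) (a_bounds : nu p.+1 <= a <= nu p).

Lemma greedy_strip : hstrip nu (greedy nu p a).
Proof.
move=> j; rewrite /greedy; have := nu_noninc j; have := nu_noninc p.
by case: ltngtP => [||->]; lia.
Qed.

Lemma greedy_psum_le m : m <= p -> psum (greedy nu p a) m = psum nu m.
Proof. by move=> lemp; apply: eq_psum => j ltjm; rewrite /greedy ifT //; lia. Qed.

Lemma greedy_psum_gt m : p < m -> psum (greedy nu p a) m + a = psum nu m.+1.
Proof.
move/subnKC <-; elim: (m - p.+1) => [|d IHd].
  rewrite addn0 /= greedy_psum_le // /greedy ltnn eqxx; lia.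
rewrite addnS [psum (greedy _ _ _) _]/= addnAC IHd [in RHS]/= /greedy.
by rewrite ifF ?ifF //; lia.
Qed.

End Greedy.

Lemma hstrip_noninc nu mu : hstrip nu mu -> noninc mu.
Proof. by move=> st j; have := st j; have := st j.+1; lia. Qed.

(** * Shapes strictly above the row lengths *)

(** Here x = k' - k, y = l - k' and z is the smallest part, for two binding rows k < k'. The
    condition at k' forces nk' > y(z - 1) + 1, the one at k forces x nk' < x + y + z - 1; these
    clash since y(z - 1) >= y + z - 2. *)
Lemma binding_arith x y z Ak Ak' A Pk nk nk' : 0 < x -> 0 < y -> 2 <= z ->
  Ak <= Pk -> Ak' + y.+1 * z <= A -> Pk + nk + x * nk' <= A ->
  A < nk + (x + y) + Ak + z.-1 -> A < nk' + y + Ak' + z.-1 -> False.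
Proof.
case: x y z => [//|x] [//|y] [//|[//|z]] _ _ _ /=.
move=> le1 le2 le3 le4 le5.
have le6 : y.+1 * z.+1 + 2 <= nk' by lia.
have := leq_mul (leqnn x.+1) le6; nia.
Qed.

(** [us_row] is (1) with the subtracted ones moved to the left. Dominance is strict at every inner
    index: the case that remains when no splitting is possible. *)
Record unsplit_shape (al : nat -> nat) (l : nat) (nu : nat -> nat) : Prop :=
  UnsplitShape {
    us_noninc : noninc nu;
    us_zero : nu l = 0;
    us_total : psum nu l = psum al l;
    us_dom : forall m, 0 < m < l -> psum al m < psum nu m;
    us_row : forall k, k < l -> nu k + (l - k.+1) + psum al k <= psum al l }.

Section Unsplit.
Variables (al : nat -> nat) (l : nat) (nu : nat -> nat) (L : nat).
Hypothesis al_noninc : forall i j, i <= j -> j <= l -> al j <= al i.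
Hypothesis al_ge2 : 2 <= al l.
Hypothesis l_gt0 : 0 < l.
Hypothesis nuP : unsplit_shape al l.+1 nu.
Hypotheses (nuL : 0 < nu L) (nuL1 : nu L.+1 = 0).
Let a := al l.
Let a_ge2 : 2 <= a := al_ge2.

(* Removing a block of size [a] outside of row [k] would violate [us_row] at [k]. *)
Definition binding (k : nat) : bool :=
  (k < l) && (psum al l.+1 < nu k + (l - k) + psum al k + a.-1).

Lemma last_row_le : L <= l.
Proof.
rewrite leqNgt; apply/negP => ltlL.
by have := noninc_eq0 (us_noninc nuP) (us_zero nuP) ltlL; lia.
Qed.

Lemma last_row_gt0 : 0 < L.
Proof.
rewrite lt0n; apply/eqP => L0; have := us_total nuP; have := us_row nuP (ltn0Sn l).
have nu1 : nu 1 = 0 by rewrite -[in LHS]L0.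
by have := psum_const0 (us_noninc nuP) nu1 (ltn0Sn l) => /=; lia.
Qed.

Lemma psum_al_ge m : m <= l.+1 -> psum al m + (l.+1 - m) * a <= psum al l.+1.
Proof. by move=> lem; apply: psum_ge_const => // j ltj; apply: al_noninc; lia. Qed.

Lemma psum_al_ge' m : m <= l -> psum al m + (l - m) * a <= psum al l.
Proof. by move=> lem; apply: psum_ge_const => // j ltj; apply: al_noninc; lia. Qed.

Lemma psum_nu_ge m : m <= l.+1 -> psum al m <= psum nu m.
Proof.
move=> lem; case: (posnP m) => [->//|m_gt0].
case: (ltngtP m l.+1) lem => // [lt_m|->] _; last by rewrite (us_total nuP).
by have := us_dom nuP (m := m); lia.
Qed.

Lemma al_le_nu0 : a <= nu 0.
Proof.
have := psum_nu_ge (ltn0Sn l); have := al_noninc (leq0n l) (leqnn l) => /=.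
by rewrite /a; lia.
Qed.

(* Two binding rows would need more cells below the upper one than there are. *)
Lemma binding_uniq k k' : binding k -> binding k' -> k = k'.
Proof.
wlog ltkk' : k k' / k < k' => [hwlog|].
  by case: (ltngtP k k') => // ltk bk bk'; [exact: hwlog|apply/esym; exact: hwlog].
move=> /andP[ltkl bk] /andP[ltkl' bk']; exfalso.
have lek : k < l.+1 by lia.
have := psum_nu_ge (ltnW lek).
have lek' : k' <= l.+1 by lia.
have := psum_al_ge lek'.
have : psum nu k.+1 + (k'.+1 - k.+1) * nu k' <= psum nu k'.+1.
  apply: psum_ge_const; first by lia.
  by move=> j ltj; apply: noninc_le (us_noninc nuP) _; lia.
have le3 : k'.+1 <= l.+1 by lia.
have := leq_psum nu le3; rewrite (us_total nuP) => le4 le5 le6 le7.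
apply: (@binding_arith (k' - k) (l - k') a (psum al k) (psum al k') (psum al l.+1)
  (psum nu k) (nu k) (nu k')) => //; try by [lia|exact: al_ge2].
by move: le4 le5 => /=; rewrite subSS; lia.
Qed.

Lemma exists_last_ge w k : 0 < w -> w <= nu k -> exists p, [/\ k <= p, w <= nu p & nu p.+1 < w].
Proof.
move=> w_gt0 le_w; pose n := l.+1 - k.
have : nu (k + n) < w.
  by rewrite (noninc_eq0 (us_noninc nuP) (us_zero nuP)) /n; lia.
elim: n => [|n IHn]; first by rewrite addn0; lia.
case: (leqP w (nu (k + n))) => [le_wn|/IHn //].
by rewrite addnS => ltn; exists (k + n); split=> //; lia.
Qed.

(** The removed block must meet the last row [L], and the block before it must reach above [L]. The
    latter is automatic if row [L] disappears; otherwise the last clause, stricter by one than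
    [us_row], lets the induction provide it. *)
Definition good_removal (mu : nat -> nat) : Prop :=
  [/\ hstrip nu mu, unsplit_shape al l mu, mu L < nu L
    & 0 < mu L -> mu L + (l - L) + psum al L <= psum al l].

Lemma us_of_removal mu : hstrip nu mu -> mu l = 0 -> psum mu l + a = psum nu l.+1 ->
  (forall m, 0 < m < l -> psum al m < psum mu m) ->
  (forall k, k < l -> mu k + (l - k) + psum al k + a.-1 <= psum al l.+1) ->
  unsplit_shape al l mu.
Proof.
move=> st mul0 tot dom row; split => //.
- exact: hstrip_noninc st.
- by move: tot; rewrite (us_total nuP) /= -/a; lia.
- by move=> k ltkl; have := row k ltkl; have := al_ge2; rewrite /= -/a; lia.
Qed.

Lemma nonbinding_row mu k : hstrip nu mu -> k < l -> ~~ binding k ->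
  mu k + (l - k) + psum al k + a.-1 <= psum al l.+1.
Proof. by move=> st ltkl; rewrite /binding ltkl /= -leqNgt; have := st k; lia. Qed.

(** Under the hypothesis a binding row can only be [p], the last row of length at least [a]. There
    the greedy removal leaves [nu p + nu p.+1 - a] cells, and the hypothesis says that this respects
    (1). *)
Lemma good_greedy : (forall k, binding k -> nu k + nu k.+1 + (l - k) + psum al k <= (psum al l.+1).+1) ->
  exists p, [/\ good_removal (greedy nu p a), p <= L, a <= nu p & nu p.+1 < a].
Proof.
move=> bindP; have a_gt0 : 0 < a by have := al_ge2; rewrite /a; lia.
have [p [_ le_ap lt_pa]] := exists_last_ge a_gt0 al_le_nu0.
exists p; have lepL : p <= L.
  rewrite leqNgt; apply/negP => ltLp.
  by have := noninc_le (us_noninc nuP) ltLp; lia.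
have pP : nu p.+1 <= a <= nu p by lia.
have ni := us_noninc nuP.
have st := greedy_strip ni pP.
(* With [p = l] the last row would hold at least [a = al l] cells, against strict dominance at
   [l]. *)
have ltpl : p < l.
  rewrite ltnNge; apply/negP => lelp; have {}lelp : p = l by have := last_row_le; lia.
  have := us_dom nuP (m := l); have := us_total nuP; rewrite lelp /= -/a in le_ap *; lia.
split=> //; split => //.
- apply: us_of_removal => //.
  + by rewrite /greedy ifF ?ifF ?(us_zero nuP) //; lia.
  + exact: greedy_psum_gt.
  + move=> m ltm; case: (leqP m p) => [lemp|ltpm].
      by rewrite greedy_psum_le //; apply: (us_dom nuP); lia.
    (* Since [a <= al m], strict dominance of [nu] at [m.+1] gives strict dominance of the new shape
       at [m]. *)
    have := greedy_psum_gt pP ltpm; have := us_dom nuP (m := m.+1) => /=.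
    by have := al_noninc (i := m) (j := l); rewrite -/a; lia.
  + move=> k ltkl; case: (boolP (binding k)) => [bk|]; last exact: nonbinding_row.
    have := bindP k bk; move: bk => /andP[_ bk].
    have := psum_al_ge (m := k); rewrite /greedy.
    have ge_ak : a <= nu k.
      move: (bk); have lek : k <= l.+1 by lia.
      have := psum_al_ge lek; rewrite -(subnKC (ltnW ltkl)).
      have -> : (k + (l - k)).+1 - k = (l - k).+1 by lia.
      have : 0 < l - k by lia.
      rewrite addKn; move: (l - k) => y; move: al_ge2; rewrite -/a => {}a_gt0 *; nia.
    have lekp : k <= p.
      by rewrite leqNgt; apply/negP => /(noninc_le ni); lia.
    by case: ltngtP lekp => // [ltkp|eqkp] _; [have := noninc_le ni ltkp; lia|subst p; lia].
- rewrite /greedy; case: (ltngtP L p) lepL => // [_ _|eqpL _]; first by lia.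
  by subst p; lia.
- rewrite /greedy; case: (ltngtP L p) lepL => // [_ _|eqpL _]; first by lia.
  subst p; have := us_row nuP (k := L); have /= := al_ge2; rewrite -/a; lia.
Qed.

(** Row [k] loses the [a - w] cells that (1) forces it to lose, the bottom rows lose the other [w].
    Then at most [l - k - 1] cells remain below row [k], which settles dominance there and the
    vanishing of row [l]. *)
Lemma good_capped k : binding k ->
  (psum al l.+1).+1 < nu k + nu k.+1 + (l - k) + psum al k ->
  exists mu, [/\ good_removal mu, k < L & mu k < nu k].
Proof.
move=> bk; have /andP[ltkl bk'] := bk => w_lt.
have ni := us_noninc nuP.
have rowk := us_row nuP (ltnW (ltkl : k < l)).
rewrite subSS in rowk.
(* The largest number of cells that may be taken outside row [k] if (1) is to hold at [k]
   afterwards. *)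
pose w := (psum al l.+1 - (nu k + (l - k) + psum al k)).+1.
have wE : w + (nu k + (l - k) + psum al k) = (psum al l.+1).+1 by rewrite /w; lia.
have w_gt0 : 0 < w by [].
have lt_wa : w < a by have := a_ge2; lia.
have le_w : w <= nu k.+1 by lia.
have [p [ltkp le_wp lt_pw]] := exists_last_ge w_gt0 le_w.
have pP : nu p.+1 <= w <= nu p by lia.
have lepL : p <= L.
  rewrite leqNgt; apply/negP => ltLp.
  by have := noninc_le ni ltLp; lia.
have tail_le : psum nu k.+1 + (l - k) + w.-1 >= psum al l.+1.
  by have := @psum_nu_ge k; rewrite /=; lia.
have al_tail : psum al k + (l - k).+1 * a <= psum al l.+1.
  by have := @psum_al_ge k; rewrite subSn ?(ltnW ltkl) //; apply; lia.
have nuk1_le : psum nu k.+1 + nu k.+1 <= psum al l.+1.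
  by rewrite -(us_total nuP); apply: (@leq_psum nu k.+2); lia.
(* A binding row has at least [(l - k) * a.-1 + 2 >= l - k + a] cells, which leaves room for row
   [k.+1] under what remains. *)
have strip_k : nu k.+1 + (a - w) <= nu k.
  have : (l - k) + a <= (l - k) * a.-1 + 2.
    have := a_ge2; have : 0 < l - k by lia.
    by move: (l - k) (a) => y z; nia.
  by rewrite mulSn in al_tail; have := a_ge2; nia.
pose mu j := greedy nu p w j - (if j == k then a - w else 0).
have gk : greedy nu p w k = nu k by rewrite /greedy ltkp.
have st : hstrip nu mu.
  move=> j; rewrite /mu; have := greedy_strip ni pP j.
  by case: eqP => [->|_]; rewrite ?gk; lia.
have psum_le m : m <= k -> psum mu m = psum nu m.
  move=> lemk; rewrite -(greedy_psum_le pP (leq_trans lemk (ltnW ltkp))).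
  by apply: eq_psum => j ltjm; rewrite /mu ifF; lia.
have psum_gt m : k < m -> psum mu m + (a - w) = psum (greedy nu p w) m.
  move/subnKC <-; elim: (m - k.+1) => [|d IHd].
    by rewrite addn0 /= psum_le // greedy_psum_le ?(ltnW ltkp) // /mu eqxx gk; lia.
  have muE : mu (k.+1 + d) = greedy nu p w (k.+1 + d) by rewrite /mu ifF; lia.
  by rewrite addnS (psumS mu (k.+1 + d)) (psumS _ (k.+1 + d)) muE -IHd; lia.
have psum_mid m : k < m -> m <= p -> psum mu m + (a - w) = psum nu m.
  by move=> ltkm lemp; rewrite psum_gt // greedy_psum_le.
have psum_high m : p < m -> psum mu m + a = psum nu m.+1.
  move=> ltpm; have := psum_gt m; have := greedy_psum_gt pP ltpm; lia.
have mu_ni := hstrip_noninc st.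
have lepl : p <= l by have := last_row_le; lia.
(* Each nonempty row below row [k] uses up one of the few cells left there. *)
have mu_pos m : k < m -> 0 < mu m -> psum mu k.+1 + (m - k) <= psum mu m.+1.
  move=> ltkm mum; have := @psum_ge_const mu 1 k.+1 m.+1; rewrite muln1 subSS; apply.
    by lia.
  by move=> j ltj; have := noninc_le mu_ni (i := j) (j := m); lia.
have mu_k1 : psum mu k.+1 + (a - w) = psum nu k.+1 by apply: psum_mid.
have [mul0 tot] : mu l = 0 /\ psum mu l + a = psum nu l.+1.
  case: (ltngtP p l) lepl => // [ltpl|eqpl] _.
    split; last exact: psum_high.
    by rewrite /mu /greedy ifF ?ifF ?(us_zero nuP) //; lia.
  have psl : psum mu l + (a - w) = psum nu l by apply: psum_mid; lia.
  have mulE : mu l = nu l - w.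
    by rewrite /mu eqpl /greedy ltnn eqxx (us_zero nuP) ifF; lia.
  have totnu : psum nu l + nu l = psum al l.+1 := us_total nuP.
  rewrite (us_total nuP); rewrite eqpl in le_wp.
  case: (posnP (mu l)) => [mul0|/(mu_pos _ ltkl)]; first by lia.
  by rewrite (psumS mu l); lia.
have tail_mu : psum mu k.+1 + (l - k).-1 + a >= psum al l.+1 by lia.
have tot' : psum mu l + a = psum al l.+1 by rewrite tot (us_total nuP).
exists mu; split=> //; last by rewrite /mu eqxx gk; lia.
  split=> //.
  - apply: us_of_removal => // [m ltm|j ltjl].
      case: (leqP m k) => [lemk|ltkm].
        by rewrite psum_le //; apply: (us_dom nuP); lia.
      (* If row [m.-1] is nonempty, at most [l - m] cells of [mu] lie in the rows from [m] on,
         whereas the parts from [m] to [l.-1] sum to at least [2 * (l - m)]. If it is empty, the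
         first [m] rows contain everything. *)
      have := psum_al_ge' (ltnW (proj2 (andP ltm))).
      have : (l - m) * 2 <= (l - m) * a by rewrite leq_mul2l a_ge2 orbT.
      have alE : psum al l.+1 = psum al l + a by [].
      case: (posnP (mu m.-1)) => [mum0|].
        have := psum_const0 mu_ni mum0 (n := l); have := psum_const0 mu_ni mum0 (n := m); lia.
      case: (ltngtP k m.-1) => [ltkm1||eqk]; last 1 first.
      - by have eqm : m = k.+1 by [lia]; rewrite eqm in ltm *; lia.
      - by move/(mu_pos _ ltkm1); rewrite prednK; lia.
      by lia.
    case: (eqVneq j k) => [->|neqjk].
      by rewrite /mu eqxx gk; lia.
    apply: nonbinding_row => //; apply/negP => bj.
    by rewrite (binding_uniq bj bk) eqxx in neqjk.
  - have := noninc_le ni lepL; rewrite /mu /greedy.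
    case: (ltngtP L p) lepL => // [_ _|eqpL _]; first by lia.
    by subst p; lia.
  - have ltkL : k < L by lia.
    move/(mu_pos _ ltkL) => le1.
    have leLl := last_row_le.
    case: (ltngtP L l) leLl => // [ltLl|eqL] _.
      have := psum_al_ge' (ltnW ltLl); have : (l - L) * 2 <= (l - L) * a by rewrite leq_mul2l a_ge2 orbT.
      have le2 := leq_psum mu (ltLl : L.+1 <= l); rewrite (psumS mu L) in le1 le2.
      have alE : psum al l.+1 = psum al l + a by [].
      case: (ltngtP k.+1 L) ltkL => // [ltk1|eqk1] _; last by rewrite -eqk1 in le1 le2 *; lia.
      have ltk1' : k < L.-1 by lia.
      case: (posnP (mu L.-1)) => [|/(mu_pos _ ltk1')]; last by rewrite prednK; lia.
      by have := st L.-1; rewrite prednK; lia.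
    by rewrite eqL (psumS mu l) mul0 in le1; lia.
by lia.
Qed.

(** Needed when the greedy removal takes the whole block from row [L]: replacing one of its cells by
    a cell of row [L.-1] makes the block reach above [L]. *)
Lemma good_shift : 0 < L -> nu L < nu L.-1 -> a <= nu L ->
  nu L + (l.+1 - L) + psum al L <= psum al l.+1 ->
  (forall k, binding k -> k = L) ->
  exists mu, good_removal mu /\ mu L.-1 < nu L.-1.
Proof.
move=> L_gt0 ltnuL lea rowL bindP.
have ni := us_noninc nuP.
have ltLl : L < l.
  case: (ltngtP L l) last_row_le => // eqL _.
  have := us_dom nuP (m := l); have := us_total nuP; rewrite eqL /= -/a in lea *; lia.
pose mu j := if j == L then nu L - a.-1 else if j == L.-1 then (nu j).-1 else nu j.
have st : hstrip nu mu.
  move=> j; rewrite /mu; have := ni j; have := ni L; have := a_ge2.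
  case: (eqVneq j L) => [->|neqj]; first by lia.
  case: (eqVneq j L.-1) => [->|neqj']; last by lia.
  by rewrite prednK; lia.
have psum_lt m : m < L -> psum mu m = psum nu m.
  by move=> ltm; apply: eq_psum => j ltj; rewrite /mu !ifF //; lia.
have psum_L : (psum mu L).+1 = psum nu L.
  rewrite -(prednK L_gt0) /= psum_lt; last by lia.
  by rewrite /mu ifF ?eqxx; lia.
have psum_gt m : L < m -> psum mu m + a = psum nu m.
  move/subnKC <-; elim: (m - L.+1) => [|d IHd].
    by rewrite addn0 /= /mu eqxx -/mu -psum_L; have := a_ge2; lia.
  have muE : mu (L.+1 + d) = nu (L.+1 + d) by rewrite /mu !ifF; lia.
  by rewrite addnS (psumS mu (L.+1 + d)) (psumS _ (L.+1 + d)) muE -IHd; lia.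
have nul0 : nu l = 0 by apply: noninc_eq0 nuL1 _.
exists mu; split; last by rewrite /mu ifF ?eqxx; lia.
split=> //.
- apply: us_of_removal => //.
  + by have := st l; lia.
  + by rewrite psum_gt //= nul0; lia.
  + move=> m ltm; case: (ltngtP m L) => [ltmL|ltLm|eqm].
    * by rewrite psum_lt //; apply: (us_dom nuP); lia.
    * have := psum_gt m ltLm; have := psum_const0 ni nuL1 ltLm; have := psum_const0 ni nuL1 (n := l.+1).
      have := us_total nuP; have := psum_al_ge' (ltnW (proj2 (andP ltm))); have := a_ge2.
      have : (l - m) * 2 <= (l - m) * a by rewrite leq_mul2l a_ge2 orbT.
      by rewrite /= -/a; lia.
    * rewrite eqm; have := us_total nuP; have /= := psum_const0 ni nuL1 (n := l.+1).
      by move: rowL; rewrite /= -/a; lia.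
  + move=> k ltkl; case: (boolP (binding k)) => [/bindP ->|]; last exact: nonbinding_row.
    by rewrite /mu eqxx; have := a_ge2; have := us_row nuP (k := L); lia.
- by rewrite /mu eqxx; have := a_ge2; lia.
- by rewrite /mu eqxx; have := a_ge2; move: rowL; rewrite /= -/a; lia.
Qed.

End Unsplit.

Lemma rchain_step al l nu mu i i' j j' : nu l.+1 = 0 -> mu l = 0 ->
  psum mu l + al l = psum nu l.+1 -> hstrip nu mu -> rchain (blocks al l) mu i' ->
  i' <= j -> mu j < nu j -> j' < i -> mu j' < nu j' -> rchain (blocks al l.+1) nu i.
Proof.
move=> nu0 mu0 tot st ch_mu leij ltj ltij ltj'; exists mu, i'; split=> //.
- by exists l.+1; split=> //; rewrite -tot (psumS mu l) mu0; lia.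
- by exists j.
- by exists j'.
Qed.

(** The second claim is used when row [L] survives the removal of a block. Its bound cannot be
    weakened: it is the one that [rchain_row_bound] imposes, through the term [i <= k], on a last
    block reaching above row [L]. *)
Lemma unsplit_rchain al l nu L : (forall i j, i <= j -> j < l -> al j <= al i) ->
  (forall j, j < l -> 2 <= al j) -> 0 < l -> unsplit_shape al l nu ->
  0 < nu L -> nu L.+1 = 0 ->
  (exists i, rchain (blocks al l) nu i) /\
  (0 < L -> nu L < nu L.-1 -> nu L + (l - L) + psum al L <= psum al l ->
   rchain (blocks al l) nu L).
Proof.
elim: l nu L => // l IHl nu L al_ni al_ge2 _ nuP nuL nuL1.
have [l0|l_gt0] := posnP l.
  subst l; have nu1 := us_zero nuP; have L0 : L = 0.
    by apply/eqP; rewrite -leqn0 leqNgt; apply/negP => /(noninc_eq0 (us_noninc nuP) nu1); lia.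
  split; last by rewrite L0.
  exists 1, (fun=> 0), 0; split=> //.
  - by move=> j; have := noninc_eq0 (us_noninc nuP) nu1 (ltn0Sn j); lia.
  - by exists 1; split=> //; have := us_total nuP => /=; lia.
  - by exists L.
  - by exists L; rewrite L0 in nuL *.
have al_ni' i j : i <= j -> j <= l -> al j <= al i by move=> *; apply: al_ni.
have a_ge2 : 2 <= al l by apply: al_ge2.
(* Every good removal completes the induction step: the last block of [mu] can be made to reach
   above row [L], and the new block meets row [L]. *)
have removal mu : good_removal al l nu L mu -> rchain (blocks al l) mu L /\
    rchain (blocks al l.+1) nu L.+1 /\ (forall j, j < L -> mu j < nu j -> rchain (blocks al l.+1) nu L).
  move=> [st muP ltL rowL]; have L_gt0 := last_row_gt0 a_ge2 l_gt0 nuP nuL nuL1.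
  have muL1 : mu L.+1 = 0 by have := st L.+1; lia.
  have mu0 : 0 < mu 0 by have := st 0; have := noninc_le (us_noninc nuP) L_gt0; lia.
  have [L' [muL' muL1']] := noninc_last (us_noninc muP) mu0 muL1.
  have al_ni2 i j : i <= j -> j < l -> al j <= al i by move=> *; apply: al_ni; lia.
  have al_ge2' j : j < l -> 2 <= al j by move=> ltj; apply: al_ge2; lia.
  have ch_mu : rchain (blocks al l) mu L.
    case: (posnP (mu L)) => [muL0|muL_gt0].
      apply: rchain_row; first by case: (l) l_gt0.
        by move=> j; apply: noninc_eq0 (us_noninc muP) muL0.
      exact: (IHl mu L' al_ni2 al_ge2' l_gt0 muP muL' muL1').1.
    apply: (IHl mu L al_ni2 al_ge2' l_gt0 muP muL_gt0 muL1).2 => //; last exact: rowL.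
    by have := st L.-1; rewrite prednK //; lia.
  have tot : psum mu l + al l = psum nu l.+1 by rewrite (us_total nuP) (us_total muP).
  have nul := us_zero nuP; have mul := us_zero muP.
  split=> //; split=> [|j ltjL ltj].
    by apply: (@rchain_step _ _ _ mu _ L L L).
  by apply: (@rchain_step _ _ _ mu _ L L j).
have [bindP|[k [bk ltk]]] : (forall k, binding al l nu k ->
      nu k + nu k.+1 + (l - k) + psum al k <= (psum al l.+1).+1) \/
    exists k, binding al l nu k /\ (psum al l.+1).+1 < nu k + nu k.+1 + (l - k) + psum al k.
- case: (boolP [exists k : 'I_l, binding al l nu k &&
      ((psum al l.+1).+1 < nu k + nu k.+1 + (l - k) + psum al k)]) => [/existsP[k /andP[bk ltk]]|].
    by right; exists k.
  rewrite negb_exists => /forallP nob; left=> k bk; have /andP[ltk _] := bk.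
  by have := nob (Ordinal ltk); rewrite bk /= -leqNgt.
- have [p [gr lepL lea ltp]] := good_greedy al_ni' a_ge2 l_gt0 nuP nuL nuL1 bindP.
  have [_ [chE chG]] := removal _ gr; split; first by exists L.+1.
  move=> L_gt0 ltnu rowL.
  case: (ltngtP p L) lepL => // [ltpL _|eqpL _].
    by apply: chG ltpL _; rewrite /greedy ltnn eqxx; lia.
  (* Here the greedy block lies in row [L] alone, so one of its cells is moved up. A binding row
     above [L] is excluded by [bindP], its successor having at least [a] cells. *)
  rewrite eqpL in lea.
  have bindL k : binding al l nu k -> k = L.
    move=> bk; apply/eqP; rewrite eqn_leq; have := bindP k bk; have /andP[ltkl bk'] := bk.
    have ni := us_noninc nuP; move=> bk2; apply/andP; split.
      rewrite leqNgt; apply/negP => /(noninc_le ni) lek.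
      have lek1 : k <= l.+1 by lia.
      have := psum_al_ge al_ni' a_ge2 l_gt0 nuL nuL1 lek1.
      rewrite subSn ?(ltnW ltkl) // mulSn.
      have : (l - k) * 2 <= (l - k) * al l by rewrite leq_mul2l a_ge2 orbT.
      by lia.
    rewrite leqNgt; apply/negP => ltkL.
    by have := noninc_le ni ltkL; lia.
  have [mu [gr' ltmu]] := good_shift al_ni' a_ge2 l_gt0 nuP nuL nuL1 L_gt0 ltnu lea rowL bindL.
  have [_ [_ chG']] := removal _ gr'; apply: chG' ltmu; by lia.
have [mu [gr ltkL ltmu]] := good_capped al_ni' a_ge2 l_gt0 nuP nuL nuL1 bk ltk.
have [_ [chE chG]] := removal _ gr; split; first by exists L.+1.
by move=> _ _ _; apply: chG ltkL ltmu.
Qed.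

(** Since [be] is nonempty, its last block has a cell in the first [m] rows, and all cells of the
    blocks of [be'] are below these rows; the junction thus satisfies the condition on consecutive
    blocks. *)
Lemma rchain_cat be be' m nu nu' i i' : be <> [::] ->
  rchain be nu i -> (forall j, m <= j -> nu j = 0) ->
  rchain be' nu' i' -> (forall j, nu' j <= nu m.-1) -> 0 < m ->
  rchain (be' ++ be) (fun j => if j < m then nu j else nu' (j - m)) (i' + m).
Proof.
move=> be_nil ch_nu nu0 ch_nu' le_nu' m_gt0.
elim: be' nu' i' ch_nu' le_nu' => [|a be' IHbe] nu' i' /=.
  move=> nu'0 _; apply: (@rchain_ext _ nu) => [j|].
    by case: ltnP => // /nu0 ->; rewrite nu'0.
  apply: rchain_row be_nil _ (ex_intro _ i ch_nu) => j lej; apply: nu0; lia.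
move=> [mu' [i0 [ch_mu' st [R [R0 wt]] [j [lej ltj]] [j' [ltj' lt']]]]] le_nu'.
exists (fun j => if j < m then nu j else mu' (j - m)), (i0 + m); split.
- by apply: IHbe => // k; have := st k; have := le_nu' k; lia.
- move=> k; have nuk := rchain_noninc ch_nu k; have stk := st (k - m).
  case: (ltngtP k m.-1) => [ltk|ltk|->].
  + by have -> : k < m by [lia]; have -> : k.+1 < m by [lia].
  + have -> : (k < m) = false by lia.
    by have -> : (k.+1 < m) = false by [lia]; rewrite subSn //; lia.
  + by rewrite prednK // ltnn leqnn subnn; have := le_nu' 0; lia.
- exists (m + R); split; first by rewrite ifF; [rewrite addKn|lia].
  rewrite !psum_addn; set f := psum _ m; set g := psum (fun j => _) m.
  have -> : f = g by apply: eq_psum => k ltk; rewrite !ltk.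
  rewrite -addnA; congr (_ + _); rewrite (eq_psum (g := nu')) ?wt ?(eq_psum (g := mu')) // => k _;
    by rewrite ifF; [rewrite addKn|lia].
- by exists (j + m); rewrite !ifF ?addnK; lia.
by exists (j' + m); rewrite !ifF ?addnK; lia.
Qed.

Lemma blocks_shift al m n :
  blocks al (m + n) = blocks (fun j => al (m + j)) n ++ blocks al m.
Proof. by elim: n => [|n IHn] /=; rewrite ?addn0 // addnS /= IHn. Qed.

Theorem rchain_sufficient al l nu : (forall i j, i <= j -> j < l -> al j <= al i) ->
  (forall j, j < l -> 2 <= al j) -> 0 < l ->
  noninc nu -> nu l = 0 -> psum nu l = psum al l ->
  (forall m, m <= l -> psum al m <= psum nu m) ->
  (forall k, k < l -> nu k + (l - k.+1) + psum al k <= psum al l) ->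
  exists i, rchain (blocks al l) nu i.
Proof.
elim/ltn_ind: l al nu => l IHl al nu al_ni al_ge2 l_gt0 nu_ni nul tot dom row.
have al_pos m : m < l -> psum al m < psum al l.
  by move=> ltm; have := leq_psum al ltm => /=; have := al_ge2 m ltm; lia.
have [/existsP[[m ltml] /andP[/= m_gt0 /eqP tight]]|] :=
    boolP [exists m : 'I_l, (0 < m) && (psum nu m == psum al m)].
  have nu_m : 0 < nu m.
    rewrite lt0n; apply/eqP => num0; have := al_pos m ltml.
    by have := psum_const0 nu_ni num0 (ltnW ltml); lia.
  have pos j : j <= m -> 0 < nu j by move/(noninc_le nu_ni); lia.
  have [|||||||i ch_t] := IHl m ltml al (fun j => if j < m then nu j else 0) _ _ m_gt0.
  - by move=> i j leij ltj; apply: al_ni; lia.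
  - by move=> j ltj; apply: al_ge2; lia.
  - by move=> j; have := nu_ni j; case: ifP; case: ifP; lia.
  - by rewrite ltnn.
  - by rewrite -tight; apply: eq_psum => j ->.
  - move=> q leq_qm; have := dom q (leq_trans leq_qm (ltnW ltml)).
    rewrite (eq_psum (f := fun j => if _ then _ else _) (g := nu)) // => j ltj.
    by rewrite ifT //; lia.
  (* For the upper piece (1) follows from dominance: the rows before [k] contain at least
     [psum al k] cells, and each row between [k] and [m] at least one. *)
  - move=> k ltkm; rewrite ltkm -tight; have := dom k (ltnW (ltn_trans ltkm ltml)).
    have := @psum_ge_const nu 1 k.+1 m ltkm; rewrite muln1 /=.
    have : forall j, k < j < m -> 0 < nu j by move=> j ltj; apply: pos; lia.
    by move=> h /(_ h); lia.
  have lem : m <= l by lia.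
  have El : l = m + (l - m) by lia.
  have shiftE f q : psum (fun j => f (m + j)) q + psum f m = psum f (m + q).
    by rewrite psum_addn; lia.
  have [|||||||||i' ch_b] := IHl (l - m) _ (fun j => al (m + j)) (fun j => nu (m + j)).
  - by lia.
  - by move=> i0 j leij ltj; apply: al_ni; lia.
  - by move=> j ltj; apply: al_ge2; lia.
  - by lia.
  - by move=> j; rewrite addnS.
  - by rewrite -El.
  - have := shiftE nu (l - m); have := shiftE al (l - m); rewrite -El; lia.
  - move=> q leq; have := shiftE nu q; have := shiftE al q; have := dom (m + q); lia.
  - move=> k ltk; have := shiftE al k; have := shiftE al (l - m); rewrite -El.
    by have := row (m + k); lia.
  have := rchain_cat (m := m) _ ch_t _ ch_b _ m_gt0.
  rewrite -blocks_shift -El => /(_ _ _ _) ch; exists (i' + m).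
  apply: (rchain_ext _ (ch _ _ _)).
  - by move=> j /=; case: ltnP => // lej; rewrite subnKC.
  - by case: (m) m_gt0.
  - by move=> j lej; rewrite ifF; lia.
  - by move=> j; rewrite ifT; [apply: noninc_le nu_ni _|]; lia.
rewrite negb_exists => /forallP not_tight.
have us : unsplit_shape al l nu.
  split=> // m /andP[m_gt0 ltm]; have := not_tight (Ordinal ltm).
  by rewrite m_gt0 /= => neq; have := dom m (ltnW ltm); rewrite leq_eqVlt eq_sym (negPf neq).
have nu0 : 0 < nu 0.
  by have := dom 1 l_gt0; have := al_ge2 0 l_gt0 => /=; lia.
have [L [nuL nuL1]] := noninc_last nu_ni nu0 nul.
exact: (unsplit_rchain al_ni al_ge2 l_gt0 us nuL nuL1).1.
Qed.

(** * Necessary conditions and the exchange of two blocks *)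

Section HorizontalStrip.
Variables (nu mu : nat -> nat) (a : nat).
Hypothesis st : hstrip nu mu.

Lemma hstrip_psum_le m n : m <= n -> psum nu m + psum mu n <= psum nu n + psum mu m.
Proof.
move/subnKC <-; elim: (n - m) => [|d IHd]; rewrite ?addn0 // addnS /=.
by have [] := st (m + d); lia.
Qed.

Lemma hstrip_psum_shift m n : m <= n ->
  psum nu n.+1 + psum mu m <= psum nu m.+1 + psum mu n.
Proof.
move/subnKC <-; elim: (n - m) => [|d IHd]; rewrite ?addn0 // addnS psumS (psumS mu).
by have [] := st (m + d); lia.
Qed.

Hypothesis wt : exists R, nu R = 0 /\ psum nu R = psum mu R + a.

Lemma hstrip_total : exists R, forall n, R <= n -> psum nu n = psum mu n + a.
Proof.
have [R [nuR0 psumR]] := wt; exists R => n leRn.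
have nu_ni : noninc nu by move=> j; have [] := st j; lia.
rewrite (psum_const0 nu_ni nuR0 leRn) psumR.
rewrite (psum_const0 (hstrip_noninc st) _ leRn) //.
by have [] := st R; lia.
Qed.

Lemma hstrip_psum_diff n : psum nu n <= psum mu n + a.
Proof.
have [R tot] := hstrip_total; have := tot (R + n) (leq_addr _ _).
by have := hstrip_psum_le (leq_addl R n); lia.
Qed.

(** The rows of [nu] from [m.+1] on have no more cells than the rows of [mu] from [m] on, and the
    totals differ by [a]. *)
Lemma hstrip_psum_succ m : psum mu m + a <= psum nu m.+1.
Proof.
have [R tot] := hstrip_total; have := tot (R + m).+1.
have := hstrip_psum_shift (leq_addl R m); have [] := st (R + m); rewrite [psum mu _.+1]/=; lia.
Qed.

Lemma hstrip_cell_above j k : j < k -> mu j < nu j -> nu k < mu k + a.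
Proof.
move=> ltjk ltj; have := hstrip_psum_diff k.+1; have := hstrip_psum_le ltjk.
by have := hstrip_psum_le (leq0n j) => /=; lia.
Qed.

Lemma hstrip_cell_below j k : k < j -> mu j < nu j -> nu k < mu k + a.
Proof.
move=> ltkj ltj; have := hstrip_psum_diff j.+1; have := hstrip_psum_le ltkj.
by have := hstrip_psum_le (leq0n k) => /=; lia.
Qed.

Lemma hstrip_cell_both i j k : i < k -> k < j -> mu i < nu i -> mu j < nu j ->
  nu k + 1 < mu k + a.
Proof.
move=> ltik ltkj lti ltj; have := hstrip_psum_diff j.+1; have := hstrip_psum_le ltkj.
by have := hstrip_psum_le ltik; have := hstrip_psum_le (leq0n i) => /=; lia.
Qed.

Lemma hstrip_row k : nu k <= mu k + a.
Proof.
by have := hstrip_psum_diff k.+1; have := hstrip_psum_le (leq0n k) => /=; lia.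
Qed.

End HorizontalStrip.

Lemma rchain_zero be nu i j : rchain be nu i -> size be <= j -> nu j = 0.
Proof.
elim: be nu i j => [|a be IHbe] nu i j /=; first by move=> ->.
move=> [mu [i' [ch_mu st _ _ _]]]; case: j => // j ltj.
by have := IHbe mu i' j ch_mu ltj; have [] := st j; lia.
Qed.

Lemma rchain_psum be nu i n : rchain be nu i -> size be <= n -> psum nu n = sumn be.
Proof.
move=> ch_nu len; rewrite (psum_const0 (rchain_noninc ch_nu) _ len); last exact: rchain_zero ch_nu _.
elim: be nu i ch_nu {len} => [|a be IHbe] //= nu i [mu [i' [ch_mu st wt _ _]]].
have nu0 : nu (size be).+1 = 0.
  by have [_] := st (size be); rewrite (rchain_zero ch_mu (leqnn _)); lia.
have mu0 := rchain_zero ch_mu (leqnn _).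
have nu_ni : noninc nu by move=> j; have [] := st j; lia.
have [R tot] := hstrip_total st wt; have := tot (R + (size be).+1) (leq_addr _ _).
rewrite (psum_const0 nu_ni nu0) ?(psum_const0 (rchain_noninc ch_mu) mu0) ?(IHbe _ _ ch_mu) /=; lia.
Qed.

(* Of two consecutive blocks, the former has a cell above row [k] or the latter has one below. *)
Lemma rchain_row_bound be nu i k : rchain be nu i -> k < size be ->
  nu k + (size be - k.+1) + (i <= k) <= sumn (take (size be - k) be).
Proof.
elim: be nu i k => // a be IHbe nu i k [mu [i' [ch_mu st wt [j [lej ltj]] [j' [ltj' lt']]]]].
rewrite [size _]/= ltnS leq_eqVlt => /predU1P[->|ltk].
  rewrite subnn subSn // subnn /= take0 /= !addn0.
  have := rchain_zero ch_mu (leqnn _) => mu0.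
  have rowS := hstrip_row st wt (size be); case: (leqP i (size be)) => /= lei; last by lia.
  by have := hstrip_cell_above st wt (j := j') (k := size be); lia.
have := IHbe mu i' k ch_mu ltk; rewrite (subSn (ltnW ltk)) /=.
have := hstrip_row st wt k.
case: (leqP i' k) => /= lei'; case: (leqP i k) => /= lei; try by lia.
- by have := hstrip_cell_above st wt (j := j') (k := k); lia.
- by have := hstrip_cell_both st wt (i := j') (j := j) (k := k); lia.
- by have := hstrip_cell_below st wt (j := j) (k := k); lia.
Qed.

(** A chosen block is paid for by one more row ([hstrip_psum_succ]); taking away a block that is not
    chosen only removes cells. *)
Lemma rchain_dominates be nu i s m : rchain be nu i -> subseq s be -> size s <= m ->
  sumn s <= psum nu m.
Proof.
elim: be nu i s m => [|a be IHbe] nu i [|x s] m //.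
move=> [mu [i' [ch_mu st wt _ _]]] /=; case: eqP => [->|_] sub_s; case: m => // m les.
  by have := IHbe mu i' s m ch_mu sub_s les; have := hstrip_psum_succ st wt m; lia.
apply: leq_trans (IHbe mu i' (x :: s) m.+1 ch_mu sub_s les) _.
by have := hstrip_psum_le st (leq0n m.+1); rewrite add0n addn0.
Qed.

Lemma rchain_rows al m : (forall i j, i <= j -> j < m -> al j <= al i) ->
  (forall j, j < m -> 0 < al j) ->
  rchain (blocks al m) (fun j => if j < m then al j else 0) m.
Proof.
elim: m => //= m IHm al_ni al_gt0.
exists (fun j => if j < m then al j else 0), m; split.
- by apply: IHm => [i j leij ltj|j ltj]; [apply: al_ni|apply: al_gt0]; lia.
- move=> j; have := al_ni j j.+1.
  by case: (ltnP j m.+1); case: (ltnP j.+1 m.+1); case: (ltnP j m); lia.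
- exists m.+1; rewrite ltnn; split=> //=; rewrite ltnn ltnSn addn0; congr (_ + _).
  by apply: eq_psum => j ltj; rewrite ltj ltnS (ltnW ltj).
- by exists m; rewrite ltnn ltnSn al_gt0.
- by exists m; rewrite ltnn ltnSn al_gt0.
Qed.

(** * Exchanging two adjacent parts *)

Definition dec (f : nat -> nat) (q c j : nat) : nat := f j - (if j == q then c else 0).

Lemma psum_dec f q c m : c <= f q ->
  psum (dec f q c) m + (if q < m then c else 0) = psum f m.
Proof.
move=> lec; elim: m => // m IHm; rewrite !psumS -IHm /dec ltnS.
by case: (ltngtP m q) => [ltm|ltm|eqm]; [| |subst m]; lia.
Qed.

Lemma psum_lower_exists f g m : psum f m < psum g m ->
  exists q, [/\ q < m, f q < g q & forall j, q < j < m -> g j <= f j].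
Proof.
elim: m => // m IHm; rewrite !psumS => lt.
case: (ltnP (f m) (g m)) => [ltm|lem]; first by exists m; split=> // j; lia.
have [|q [ltq ltfg leg]] := IHm; first by lia.
exists q; split=> //; first by lia.
by move=> j ltj; case: (ltngtP j m) => [ltjm||->] //; [apply: leg|]; lia.
Qed.

Lemma psum_eq_pointwise f g m : (forall j, j < m -> f j <= g j) -> psum g m = psum f m ->
  forall j, j < m -> g j = f j.
Proof.
elim: m => // m IHm lefg; rewrite !psumS => eqfg j.
have lem : psum f m <= psum g m.
  elim: m {IHm eqfg} lefg => // m IHm lefg; rewrite !psumS.
  by have := lefg m; have := IHm (fun j ltj => lefg j (ltnW ltj)); lia.
have := lefg m; rewrite ltnSn => /(_ isT) lefgm.
rewrite ltnS leq_eqVlt => /predU1P[->|]; first by lia.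
by apply: IHm; [move=> i lti; apply: lefg; lia|lia].
Qed.

Section Swap.
Variables (al : nat -> nat) (k n : nat).
Hypothesis al_ni : forall i j, i <= j -> j < n -> al j <= al i.
Hypothesis al_ge2 : forall j, j < n -> 2 <= al j.
Hypothesis k_gt0 : 0 < k.

Definition swap_rows (j : nat) : nat :=
  if j == k.-1 then al k else if j == k then al k.-1 else al j.

(** The block of size [al k] fills row [k.-1] only in part. The larger one then fills row [k] and
    puts its surplus [al k.-1 - al k] into row [k.-1], so that it reaches above row [k]. *)
Lemma swap_base nu : k < n -> al k < al k.-1 -> (forall j, k < j -> nu j = 0) ->
  (forall j, j <= k -> nu j = al j) -> rchain (blocks swap_rows k.+1) nu k.
Proof.
move=> ltkn ltal nu0 nuE; exists (fun j => if j < k then swap_rows j else 0), k; split.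
- apply: rchain_rows => [i j leij ltj|j ltj]; rewrite /swap_rows.
    have := @al_ni i j leij; have := @al_ni i k.
    by case: (eqVneq j k.-1); case: (eqVneq i k.-1); case: (eqVneq j k); case: (eqVneq i k); lia.
  have := @al_ge2 j; have := @al_ge2 k.
  by case: (eqVneq j k.-1); case: (eqVneq j k); lia.
- move=> j; rewrite /swap_rows.
  case: (ltngtP j k.-1) => [ltj|ltj|eqj].
  + have -> : j < k by lia. have -> : (j == k) = false by lia.
    by rewrite !nuE; [have := @al_ni j j.+1|..]; lia.
  + have -> : (j < k) = false by lia.
    by rewrite (nu0 j.+1); lia.
  + have -> : j < k by lia. have -> : j.+1 = k by lia.
    by rewrite !nuE ?eqj; lia.
- exists k.+1; split; first exact: nu0.
  rewrite /= ltnn addn0 nuE // /swap_rows (_ : k == k.-1 = false) ?eqxx; last by lia.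
  rewrite (eq_psum (f := fun j => if _ then _ else _) (g := dec al k.-1 (al k.-1 - al k))).
    rewrite (eq_psum (g := al)); last by move=> j ltj; apply: nuE; lia.
    by have := @psum_dec al k.-1 (al k.-1 - al k) k; rewrite prednK // leqnn; lia.
  move=> j ltj; rewrite ltj /dec; case: eqP => [->|_]; first by lia.
  by rewrite ifF; lia.
- by exists k; rewrite ltnn nuE // leqnn; have := @al_ge2 k; lia.
exists k.-1; rewrite /swap_rows eqxx nuE; last by lia.
by have -> : k.-1 < k by lia.
Qed.

(* Each of the last [d] blocks has one cell above row [k] and the others in row [k]. *)
Lemma swap_above d nu : k.+1 + d <= n -> al k < al k.-1 ->
  noninc nu -> (forall j, k < j -> nu j = 0) -> (forall j, j < k -> al j <= nu j) ->
  psum nu k = psum al k + d -> psum nu k.+1 = psum al (k.+1 + d) -> nu k < nu k.-1 ->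
  rchain (blocks swap_rows (k.+1 + d)) nu k.
Proof.
elim: d nu => [|d IHd] nu led ltal nu_ni nu0 le_al psk psk1 ltk.
  rewrite !addn0 in led psk psk1 *; apply: swap_base => //.
  move=> j; rewrite leq_eqVlt => /predU1P[->|ltj].
    by move: psk1; rewrite !psumS; lia.
  exact: (psum_eq_pointwise le_al psk).
have ltkn : k < n by lia.
pose a := al (k.+1 + d); have a_ge2 : 2 <= a by apply: al_ge2; lia.
(* [q] is the last row above [k] that exceeds its part. If the next row is still above [k], it has
   at most [al q.+1 <= al q < nu q] cells, so row [q] can lose one. *)
have [|q [ltq ltnuq leq]] := @psum_lower_exists al nu k; first by lia.
have psal : psum al k + d.+1 * 2 <= psum al (k.+1 + d).
  have -> : d.+1 = k.+1 + d - k by lia.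
  by apply: psum_ge_const => [|j ltj]; [lia|apply: al_ge2; lia].
have psa : psum al (k.+1 + d.+1) = psum al (k.+1 + d) + a by rewrite addnS psumS.
have nuk : nu k = psum al (k.+1 + d) + a - psum al k - d.+1.
  by move: psk1; rewrite psa psumS; lia.
pose mu := dec (dec nu q 1) k a.-1.
have muE j : mu j = nu j - (if j == q then 1 else 0) - (if j == k then a.-1 else 0) by [].
have ps_mu m : psum mu m + (if k < m then a.-1 else 0) + (if q < m then 1 else 0) = psum nu m.
  rewrite psum_dec; first by rewrite psum_dec; lia.
  by rewrite /dec ifF; lia.
have st : hstrip nu mu.
  move=> j; rewrite muE; split; first by lia.
  case: (eqVneq j k) => [->|neqk]; first by rewrite nu0.
  case: (eqVneq j q) => [eqj|neqq]; last by have := nu_ni j; lia.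
  subst j; case: (ltngtP q.+1 k) ltq => // [ltq1 _|eqq1 _].
    by have := leq q.+1; have := @al_ni q q.+1; lia.
  by rewrite eqq1; have -> : q = k.-1 by [lia]; lia.
have ch_mu : rchain (blocks swap_rows (k.+1 + d)) mu k.
  apply: IHd => //; first by lia.
  - exact: hstrip_noninc st.
  - by move=> j ltj; rewrite muE nu0.
  - move=> j ltj; rewrite muE; have -> : (j == k) = false by lia.
    by have := le_al j ltj; case: eqP => [->|]; lia.
  - by have := ps_mu k; rewrite ltnn ltq; lia.
  - by have := ps_mu k.+1; rewrite ltnSn (ltnW ltq : q < k.+1); lia.
  - rewrite !muE eqxx; have -> : (k == q) = false by lia. have -> : (k.-1 == k) = false by lia.
    by case: eqP; lia.
rewrite addnS; exists mu, k; split=> //.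
- exists k.+1; split; first exact: nu0.
  have := ps_mu k.+1; rewrite ltnSn (ltnW ltq : q < k.+1) /swap_rows.
  by rewrite !ifF -/a; lia.
- by exists k; split=> //; rewrite muE eqxx; have -> : (k == q) = false by [lia]; lia.
- by exists q; split=> //; rewrite muE eqxx; lia.
Qed.

(** The preceding block reaches above row [k], so this one may lie in row [k] entirely. It marks the
    passage from blocks with a cell above row [k] to blocks with a cell below it. *)
Lemma swap_level d nu : k.+2 + d <= n -> al k < al k.-1 ->
  noninc nu -> (forall j, k < j -> nu j = 0) -> (forall j, j < k -> al j <= nu j) ->
  psum nu k = psum al k + d -> psum nu k.+1 = psum al (k.+2 + d) ->
  rchain (blocks swap_rows (k.+2 + d)) nu k.+1.
Proof.
move=> led ltal nu_ni nu0 le_al psk psk1.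
pose a := al (k.+1 + d); have a_ge2 : 2 <= a by apply: al_ge2; lia.
have psa : psum al (k.+2 + d) = psum al (k.+1 + d) + a by [].
have psal : psum al k + d.+1 * 2 <= psum al (k.+1 + d).
  have -> : d.+1 = k.+1 + d - k by lia.
  by apply: psum_ge_const => [|j ltj]; [lia|apply: al_ge2; lia].
have nuk : nu k = psum al (k.+1 + d) + a - psum al k - d.
  by move: psk1; rewrite psa psumS; lia.
pose mu := dec nu k a.
have ps_mu m : psum mu m + (if k < m then a else 0) = psum nu m by apply: psum_dec; lia.
have st : hstrip nu mu.
  move=> j; rewrite /mu /dec; case: eqP => [->|_]; first by rewrite (nu0 k.+1) //; lia.
  by have := nu_ni j; lia.
have ch_mu : rchain (blocks swap_rows (k.+1 + d)) mu k.
  apply: swap_above => //; first by lia.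
  - exact: hstrip_noninc st.
  - by move=> j ltj; rewrite /mu /dec nu0.
  - by move=> j ltj; rewrite /mu /dec ifF; [have := le_al j ltj|]; lia.
  - by have := ps_mu k; rewrite ltnn; lia.
  - by have := ps_mu k.+1; rewrite ltnSn; lia.
  - rewrite /mu /dec eqxx; have -> : (k.-1 == k) = false by lia.
    by have := nu_ni k.-1; rewrite prednK //; lia.
have muk : mu k < nu k by rewrite /mu /dec eqxx; lia.
rewrite addSn; exists mu, k; split=> //.
- exists k.+1; split; first exact: nu0.
  have := ps_mu k.+1; rewrite ltnSn /swap_rows.
  by rewrite !ifF -/a; lia.
- by exists k.
- by exists k.
Qed.

(** Each of the last [c] blocks has one cell in row [k.+1], below a cell that the preceding block
    has in row [k], and its other cells in row [k]. *)
Lemma swap_below d c nu : k.+2 + d + c <= n -> al k < al k.-1 ->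
  noninc nu -> (forall j, k.+1 < j -> nu j = 0) -> (forall j, j < k -> al j <= nu j) ->
  nu k.+1 = c -> psum nu k = psum al k + d -> psum nu k.+2 = psum al (k.+2 + d + c) ->
  rchain (blocks swap_rows (k.+2 + d + c)) nu k.+1.
Proof.
elim: c nu => [|c IHc] nu led ltal nu_ni nu0 le_al nuk1 psk psk2.
  rewrite addn0 in led psk2 *; apply: swap_level => //.
    by move=> j ltj; case: (ltngtP j k.+1) => [|/nu0|->] //; lia.
  by rewrite -psk2 (psumS nu k.+1) nuk1 addn0.
pose a := al (k.+2 + d + c); have a_ge2 : 2 <= a by apply: al_ge2; lia.
have psa : psum al (k.+2 + d + c.+1) = psum al (k.+2 + d + c) + a by rewrite addnS.
have psal : psum al k + (d + c + 2) * 2 <= psum al (k.+2 + d + c).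
  have -> : d + c + 2 = k.+2 + d + c - k by lia.
  by apply: psum_ge_const => [|j ltj]; [lia|apply: al_ge2; lia].
have nuk : nu k = psum al (k.+2 + d + c) + a - psum al k - d - c.+1.
  by move: psk2; rewrite psa !psumS; lia.
pose mu := dec (dec nu k a.-1) k.+1 1.
have muE j : mu j = nu j - (if j == k then a.-1 else 0) - (if j == k.+1 then 1 else 0) by [].
have ps_mu m : psum mu m + (if k.+1 < m then 1 else 0) + (if k < m then a.-1 else 0) = psum nu m.
  rewrite psum_dec; first by rewrite psum_dec; lia.
  by rewrite /dec ifF; lia.
have st : hstrip nu mu.
  move=> j; rewrite muE; split; first by lia.
  case: (eqVneq j k) => [->|neqk]; first by rewrite nuk1 ifF; lia.
  case: (eqVneq j k.+1) => [->|neqk']; first by rewrite nu0.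
  by have := nu_ni j; lia.
have ch_mu : rchain (blocks swap_rows (k.+2 + d + c)) mu k.+1.
  apply: IHc => //; first by lia.
  - exact: hstrip_noninc st.
  - by move=> j ltj; rewrite muE nu0.
  - by move=> j ltj; rewrite muE; have := le_al j ltj; do 2! (rewrite ifF; last by lia); lia.
  - by rewrite muE eqxx ifF; lia.
  - by have := ps_mu k; rewrite ltnn ifF; lia.
  - by have := ps_mu k.+2; rewrite ltnSn ltnS leqnSn; lia.
rewrite addnS; exists mu, k.+1; split=> //.
- exists k.+2; split; first exact: nu0.
  have := ps_mu k.+2; rewrite ltnSn ltnS leqnSn /swap_rows.
  by rewrite !ifF -/a; lia.
- by exists k.+1; split=> //; rewrite muE eqxx; lia.
- by exists k; split=> //; rewrite muE eqxx; lia.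
Qed.

End Swap.

(** Of the [n - k - 1] blocks that follow the exchanged pair, [d] have one cell above row [k], [c]
    have one below, and one has none outside, so row [k] gets one cell more than (1) allows. *)
Theorem rchain_swap al n k nu : (forall i j, i <= j -> j < n -> al j <= al i) ->
  (forall j, j < n -> 2 <= al j) -> 0 < k < n ->
  noninc nu -> psum nu n = psum al n -> (forall m, m <= n -> psum al m <= psum nu m) ->
  psum al n < nu k + (n - k.+1) + psum al k ->
  exists nu' i, psum al n < nu' k + (n - k.+1) + psum al k /\
    rchain (blocks (swap_rows al k) n) nu' i.
Proof.
move=> al_ni al_ge2 /andP[k_gt0 ltkn] nu_ni tot dom big.
(* The least length of row [k] that violates (1). *)
pose v := (psum al n).+1 - (n - k.+1) - psum al k.
have psal : psum al k.+1 + (n - k.+1) * 2 <= psum al n.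
  by apply: psum_ge_const => // j ltj; apply: al_ge2; lia.
have alk := al_ge2 k ltkn.
rewrite psumS in psal.
have vE : v + (n - k.+1) + psum al k = (psum al n).+1 by rewrite /v; lia.
have le_v : v <= nu k by lia.
(* The rows above [k] must have length at least [v], and [g] enlarges the parts as little as
   possible. Its partial sums stay below those of [nu], whence [d <= n - k - 2]. *)
pose g j := maxn (al j) v; have gE j : g j = maxn (al j) v by [].
have ps_g m : m <= k -> psum g m <= psum nu m.
  elim: m => // m IHm ltmk; rewrite !psumS gE.
  case: (leqP v (al m)) => [lev|ltv].
    have := dom m.+1; rewrite !psumS (eq_psum (f := g) (g := al)); first by lia.
    by move=> j ltj; rewrite gE; have := @al_ni j m; lia.
  by have := IHm (ltnW ltmk); have := noninc_le nu_ni (ltnW ltmk); lia.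
have := ps_g k (leqnn k) => le_g.
have le_al_g : psum al k <= psum g k.
  elim: (k) => // m IHm; rewrite !psumS gE; lia.
have le_k : psum nu k + nu k <= psum nu n by apply: (leq_psum nu ltkn).
pose d := psum g k - psum al k; pose c := n - k.+2 - d.
have dE : psum g k = psum al k + d by rewrite /d; lia.
have nE : n = k.+2 + d + c by lia.
(* Otherwise row [k.-1] alone would have to grow by [v - al k >= n - k] cells, more than [d] can
   be. *)
have ltal : al k < al k.-1.
  rewrite ltnNge; apply/negP => leal.
  have : psum al k.-1 <= psum g k.-1.
    elim: (k.-1) => // m IHm; rewrite !psumS gE; lia.
  move: dE; rewrite -{1 2}(prednK k_gt0) !psumS gE; lia.
pose nu' j := if j < k then g j else if j == k then v else if j == k.+1 then c else 0.
have ps' : psum nu' k = psum g k by apply: eq_psum => j ltj; rewrite /nu' ltj.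
have nu'k : nu' k = v by rewrite /nu' ltnn eqxx.
have nu'k1 : nu' k.+1 = c.
  by rewrite /nu' eqxx; have -> : (k.+1 < k) = false by [lia]; have -> : (k.+1 == k) = false by lia.
have lecv : c <= v by lia.
exists nu', k.+1; split; first by rewrite nu'k; lia.
rewrite [n]nE; apply: (swap_below (n := n)) => //.
- by lia.
- move=> j; rewrite /nu' !gE; have := @al_ni j j.+1.
  case: (ltngtP j.+1 k) => [ltj1|ltj1|eqj].
  + by lia.
  + rewrite eqSS; case: (ltngtP j k) => [ltj|ltj|eqj]; [by lia|by []|].
    by move: lecv; lia.
  + by lia.
- by move=> j ltj; rewrite /nu' !ifF; lia.
- by move=> j ltj; rewrite /nu' ltj gE; lia.
- by rewrite ps' dE.
- by rewrite (psumS nu' k.+1) (psumS nu' k) ps' nu'k nu'k1 -nE; lia.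
Qed.

(** * Ribbons with at most four rows *)

Definition shape4 (x y z w j : nat) : nat := nth 0 [:: x; y; z; w] j.

Lemma rchain_shape4 a be i i' j j' m1 m2 m3 m4 n1 n2 n3 n4 :
  rchain be (shape4 m1 m2 m3 m4) i' ->
  [/\ n2 <= m1 <= n1, n3 <= m2 <= n2, n4 <= m3 <= n3 & m4 <= n4] ->
  n1 + n2 + n3 + n4 = m1 + m2 + m3 + m4 + a ->
  i' <= j -> shape4 m1 m2 m3 m4 j < shape4 n1 n2 n3 n4 j ->
  j' < i -> shape4 m1 m2 m3 m4 j' < shape4 n1 n2 n3 n4 j' ->
  rchain (a :: be) (shape4 n1 n2 n3 n4) i.
Proof.
move=> ch_m [s1 s2 s3 s4] tot lej ltj lej' ltj'.
exists (shape4 m1 m2 m3 m4), i'; split=> //.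
- by move=> [|[|[|[|q]]]]; rewrite /shape4 /= ?nth_nil; lia.
- by exists 4; rewrite /shape4 /=; lia.
- by exists j.
by exists j'.
Qed.

Lemma rchain1 b : 0 < b -> rchain [:: b] (shape4 b 0 0 0) 1.
Proof.
move=> b_gt0; have ch0 : rchain [::] (shape4 0 0 0 0) 0.
  by move=> [|[|[|[|q]]]] //; rewrite /shape4 /= nth_nil.
by apply: (rchain_shape4 (j := 0) (j' := 0) ch0) => //; lia.
Qed.

Lemma rchain2 b1 b2 m1 m2 : 0 < m2 -> m2 <= b1 -> m2 <= b2 -> m1 + m2 = b1 + b2 ->
  rchain [:: b2; b1] (shape4 m1 m2 0 0) 2 /\
  (m2 < b2 -> rchain [:: b2; b1] (shape4 m1 m2 0 0) 1).
Proof.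
move=> m2_gt0 le1 le2 tot; split=> [|lt].
  by apply: (@rchain_shape4 _ _ _ 1 1 1 b1 0 0 0) => //; [apply: rchain1|split|..]; lia.
by apply: (@rchain_shape4 _ _ _ 1 1 0 b1 0 0 0); rewrite /shape4 //=; [apply: rchain1|split|..]; lia.
Qed.

Section Three.
Variables b1 b2 b3 k1 k2 k3 : nat.
Hypotheses (b1_ge2 : 2 <= b1) (b2_ge2 : 2 <= b2) (b3_ge2 : 2 <= b3).
Hypotheses (le12 : k2 <= k1) (le23 : k3 <= k2) (tot : k1 + k2 + k3 = b1 + b2 + b3).
Hypotheses (gt1 : b1 <= k1) (gt2 : b2 <= k1) (gt3 : b3 <= k1).

Lemma rchain3_pos : 0 < k3 -> k3 <= b1 -> k3 <= b2 -> k3 <= b3 ->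
  rchain [:: b3; b2; b1] (shape4 k1 k2 k3 0) 3 /\
  (k3 < b3 -> rchain [:: b3; b2; b1] (shape4 k1 k2 k3 0) 2).
Proof.
move=> k3_gt0 le1 le2 le3.
(* The shortest second row that is not shorter than [k3] and keeps the first row within [k1]. *)
pose m2 := maxn k3 (b1 + b2 - k1); pose m1 := b1 + b2 - m2.
have [] := @rchain2 b1 b2 m1 m2; try by rewrite /m1 /m2; lia.
move=> ch2 _; have sp : [/\ k2 <= m1 <= k1, k3 <= m2 <= k2, 0 <= 0 <= k3 & 0 <= 0].
  by rewrite /m1 /m2; split; lia.
split=> [|lt].
  by apply: (rchain_shape4 (j := 2) (j' := 2) ch2 sp) => //; rewrite /m1 /m2; lia.
case: (ltnP m1 k1) => [lt1|le].
  by apply: (rchain_shape4 (j := 2) (j' := 0) ch2 sp) => //; rewrite /m1 /m2; lia.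
apply: (rchain_shape4 (j := 2) (j' := 1) ch2 sp) => //; rewrite ?/shape4 /=; move: le; rewrite /m1 /m2; lia.
Qed.

(** With two rows the last block must meet row 1 and the one before it row 0. The choice of [m2]
    leaves at most [b3] cells of row 1 to the last block, or at most [b3 - 1] if that block has to
    meet row 0 too. *)
Lemma rchain3_zero : k3 = 0 -> b1 < k1 -> b3 < k1 -> 2 <= k2 ->
  rchain [:: b3; b2; b1] (shape4 k1 k2 k3 0) 2 /\
  (b1.+1 < k1 -> b2 < k1 -> k2 < k1 -> rchain [:: b3; b2; b1] (shape4 k1 k2 k3 0) 1).
Proof.
move=> k30 lt1 lt3 k2_ge2; rewrite k30; split=> [|lt1' lt2 ltk].
  pose m2 := maxn 1 (k2 - b3); pose m1 := b1 + b2 - m2.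
  have [] := @rchain2 b1 b2 m1 m2; try by rewrite /m1 /m2; lia.
  move=> _ ch2; have sp : [/\ k2 <= m1 <= k1, 0 <= m2 <= k2, 0 <= 0 <= 0 & 0 <= 0].
    by rewrite /m1 /m2; split; lia.
  have {}ch2 : rchain [:: b2; b1] (shape4 m1 m2 0 0) 1 by apply: ch2; rewrite /m2; lia.
  by apply: (rchain_shape4 (j := 1) (j' := 1) ch2 sp) => //; rewrite ?/shape4 /= /m1 /m2; lia.
pose m2 := maxn 1 (k2.+1 - b3); pose m1 := b1 + b2 - m2.
have [] := @rchain2 b1 b2 m1 m2; try by rewrite /m1 /m2; lia.
move=> _ ch2; have sp : [/\ k2 <= m1 <= k1, 0 <= m2 <= k2, 0 <= 0 <= 0 & 0 <= 0].
  by rewrite /m1 /m2; split; lia.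
have {}ch2 : rchain [:: b2; b1] (shape4 m1 m2 0 0) 1 by apply: ch2; rewrite /m2; lia.
by apply: (rchain_shape4 (j := 1) (j' := 0) ch2 sp) => //; rewrite ?/shape4 /= /m1 /m2; lia.
Qed.

End Three.

Section Four.
Variables b1 b2 b3 b4 n1 n2 n3 n4 : nat.
Hypotheses (b1_ge2 : 2 <= b1) (b2_ge2 : 2 <= b2) (b3_ge2 : 2 <= b3) (b4_ge2 : 2 <= b4).
Hypotheses (le12 : n2 <= n1) (le23 : n3 <= n2) (le34 : n4 <= n3).
Hypothesis tot : n1 + n2 + n3 + n4 = b1 + b2 + b3 + b4.
Hypothesis dom1 : [/\ b1 <= n1, b2 <= n1, b3 <= n1 & b4 <= n1].
Hypothesis dom2 : [/\ b1 + b2 <= n1 + n2, b1 + b3 <= n1 + n2 & b1 + b4 <= n1 + n2] /\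
  [/\ b2 + b3 <= n1 + n2, b2 + b4 <= n1 + n2 & b3 + b4 <= n1 + n2].
Hypothesis dom3 : [/\ n4 <= b1, n4 <= b2, n4 <= b3 & n4 <= b4].

Lemma rchain4_pos : 0 < n4 -> exists i, rchain [:: b4; b3; b2; b1] (shape4 n1 n2 n3 n4) i.
Proof.
move: dom1 dom2 dom3 => [d1 d2 d3 d4] [[e12 e13 e14] [e23 e24 e34]] [f1 f2 f3 f4] n4_gt0.
suff [k1 [k2 [k3 [[le21 le32 t g1 g2] [g3 k3_gt0 h1 h2 h3] sp tot']]]] : exists k1 k2 k3,
    [/\ [/\ k2 <= k1, k3 <= k2, k1 + k2 + k3 = b1 + b2 + b3, b1 <= k1 & b2 <= k1],
      [/\ b3 <= k1, 0 < k3, k3 <= b1, k3 <= b2 & k3 <= b3],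
      [/\ n2 <= k1 <= n1, n3 <= k2 <= n2, n4 <= k3 <= n3 & 0 <= n4] &
      n1 + n2 + n3 + n4 = k1 + k2 + k3 + 0 + b4].
  have [ch3 _] := rchain3_pos b1_ge2 b2_ge2 b3_ge2 le21 le32 t g1 g2 g3 k3_gt0 h1 h2 h3.
  by exists 4; apply: (rchain_shape4 (j := 3) (j' := 3) ch3 sp).
(* Greedy removal: row 3 disappears, and the three cases are the rows 2, 1 and 0 in which the
   removal stops. *)
case: (leqP b4 n3) => [le_b4|lt_b4].
  by exists n1, n2, (n3 + n4 - b4); split; [split|split|split|]; lia.
case: (leqP b4 n2) => [le_b4'|lt_b4'].
  by exists n1, (n2 + n3 - b4), n4; split; [split|split|split|]; lia.
by exists (n1 + n2 - b4), n3, n4; split; [split|split|split|]; lia.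
Qed.

Hypothesis big : [/\ b1 + 3 <= b2 + b3 + b4, b2 + 3 <= b1 + b3 + b4,
  b3 + 3 <= b1 + b2 + b4 & b4 + 3 <= b1 + b2 + b3].
Hypothesis out_row1 : 3 <= n2 + n3 + n4.

Lemma rchain4_two_rows : n3 = 0 -> exists i, rchain [:: b4; b3; b2; b1] (shape4 n1 n2 n3 n4) i.
Proof.
move: dom1 dom2 dom3 big => [d1 d2 d3 d4] _ _ [g1 g2 g3 g4] n30.
have n40 : n4 = 0 by lia.
pose k2 := maxn 2 (n2 - b4); pose k1 := n1 + n2 - b4 - k2.
have [] := @rchain3_zero b1 b2 b3 k1 k2 0; try by rewrite /k1 /k2; lia.
move=> _ ch3; have {}ch3 : rchain [:: b3; b2; b1] (shape4 k1 k2 0 0) 1.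
  by apply: ch3; rewrite /k1 /k2; lia.
exists 2; have sp : [/\ n2 <= k1 <= n1, n3 <= k2 <= n2, n4 <= 0 <= n3 & 0 <= n4].
  by split; rewrite /k1 /k2; lia.
apply: (rchain_shape4 (j := 1) (j' := 1) ch3 sp) => //; rewrite ?/shape4 /= /k1 /k2; lia.
Qed.

Lemma rchain4_three_rows : 0 < n3 -> n4 = 0 ->
  [/\ minn b1 b2 < b3 + b4, minn b1 b4 < b2 + b3, minn b2 b4 < b1 + b3
    & minn b3 b4 < b1 + b2] ->
  exists i, rchain [:: b4; b3; b2; b1] (shape4 n1 n2 n3 n4) i.
Proof.
move: dom1 dom2 big => [d1 d2 d3 d4] [[e12 e13 e14] [e23 e24 e34]] [g1 g2 g3 g4].
move=> n3_gt0 n40 [p12 p14 p24 p34].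
have t0 := tot; rewrite n40 addn0 in t0; have o0 := out_row1; rewrite n40 addn0 in o0.
clear dom1 dom2 dom3 big tot out_row1.
rewrite n40.
(* In this case the last block takes some but not all of row 2; [k3 < b3] lets the block before it
   meet row 0 or 1. *)
have X1 : 2 <= n3 -> b4 < n1 -> b4 + b1 < n1 + n2 -> b4 + b2 < n1 + n2 ->
    b4 + b3 < n1 + n2 -> n3 < b3 + b4 ->
    exists i, rchain [:: b4; b3; b2; b1] (shape4 n1 n2 n3 0) i.
  clear p12 p14 p24 p34 g1 g2 g3 g4.
  move=> n3_ge2 lt1 lt2 lt3 lt4 lt5.
  have pick k1 k2 k3 : [/\ n2 <= k1 <= n1, n3 <= k2 <= n2, 0 < k3 < n3 & k3 < b3] ->
      [/\ b1 <= k1, b2 <= k1, b3 <= k1, k3 <= b1 & k3 <= b2] ->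
      n1 + n2 + n3 = k1 + k2 + k3 + b4 ->
      exists i, rchain [:: b4; b3; b2; b1] (shape4 n1 n2 n3 0) i.
    clear e12 e13 e14 e23 e24 e34 lt1 lt2 lt3 lt4 lt5.
    move=> [s1 s2 s3 s4] [h1 h2 h3 h4 h5] sum.
    have [] := @rchain3_pos b1 b2 b3 k1 k2 k3; try by lia.
    move=> _ /(_ s4) ch3; exists 3.
    apply: (rchain_shape4 (j := 2) (j' := 2) ch3) => //; rewrite ?/shape4 /=; try by lia.
    by split=> //; lia.
  case: (ltnP b4 n3) => [lt_b4|le_b4].
    by apply: (pick n1 n2 (n3 - b4)); [split|split|]; clear pick; lia.
  case: (ltnP b4 n2) => [lt_b4|le_b4'].
    by apply: (pick n1 (n2 + n3 - b4 - 1) 1); [split|split|]; clear pick; lia.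
  by apply: (pick (n1 + n2 - b4 - 1) n3 1); [split|split|]; clear pick; lia.
(* In this case the last block takes all of row 2 and leaves a shape with two rows. *)
have X0 : [/\ n3 <= b4, 2 <= n2, b4 + 2 <= n1 + n3, b1 < n1 & b3 < n1] ->
    [/\ b4 + b2 <= n1 + n2, b4 + b1 < n1 + n2 & b4 + b3 < n1 + n2] ->
    exists i, rchain [:: b4; b3; b2; b1] (shape4 n1 n2 n3 0) i.
  move=> [h1 h2 h3 h4 h5] [h6 h7 h8]; clear p12 p14 p24 p34 X1 e12 e13 e14 e23 e24 e34.
  pose k2 := maxn (maxn n3 2) (n2 + n3 - b4); pose k1 := n1 + n2 + n3 - b4 - k2.
  have [] := @rchain3_zero b1 b2 b3 k1 k2 0; try by rewrite /k1 /k2; lia.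
  move=> ch3 _; exists 3; have sp : [/\ n2 <= k1 <= n1, n3 <= k2 <= n2, 0 <= 0 <= n3 & 0 <= 0].
    by split; rewrite /k1 /k2; lia.
  apply: (rchain_shape4 (j := 2) (j' := 2) ch3 sp) => //; rewrite ?/shape4 /= /k1 /k2; lia.
(* If [n3 >= b3 + b4], then [e12] makes [n1 + n2 = b1 + b2], so [n2 <= minn b1 b2 < n3] by [p12].
   The next three inequalities are alike. *)
have lt5 : n3 < b3 + b4 by clear X1 X0 p14 p24 p34; lia.
have lt2 : b4 + b1 < n1 + n2 by clear X1 X0 p12 p24 p34; lia.
have lt3 : b4 + b2 < n1 + n2 by clear X1 X0 p12 p14 p34; lia.
have lt4 : b4 + b3 < n1 + n2 by clear X1 X0 p12 p24 p14; lia.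
case: (leqP 2 n3) => [n3_ge2|n3_lt2]; last first.
  by apply: X0; split; clear X1 p12 p14 p24 p34; lia.
case: (ltnP b4 n1) => [lt1|ge1]; first exact: X1.
by apply: X0; split; clear X1; lia.
Qed.

End Four.

(** * The Pieri rule *)

(** A common finite range for the sums over shapes, so that they can be exchanged. *)
Fixpoint box (r B : nat) : seq (seq nat) :=
  if r is r'.+1 then [seq a :: v | a <- iota 0 B, v <- box r' B] else [:: [::]].

Lemma mem_box r B v : (v \in box r B) = (size v == r) && all (gtn B) v.
Proof.
elim: r v => [|r IHr] [|a v] //=.
  by apply/negbTE/allpairsPdep => [[b [w []]]].
rewrite eqSS; apply/allpairsPdep/and3P => [[b [w [+ + [-> ->]]]]|[szv lta allv]].
  by rewrite mem_iota IHr => lta /andP[].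
by exists a, v; rewrite mem_iota IHr szv allv.
Qed.

Lemma box_uniq r B : uniq (box r B).
Proof.
elim: r => //= r IHr; apply: allpairs_uniq_dep => //; first exact: iota_uniq.
by move=> [a v] [b w] _ _ [-> ->].
Qed.

(** Horizontal strips between vectors of equal length, where zero entries stand for empty rows. *)
Fixpoint vstrip (la nu : seq nat) : bool :=
  match la, nu with
  | l :: la', n :: nu' => [&& n <= l, head 0 la' <= n & vstrip la' nu']
  | [::], [::] => true
  | _, _ => false
  end.

Lemma vstrip_size la nu : vstrip la nu -> size la = size nu.
Proof. by elim: la nu => [|l la IHla] [|n nu] //= /and3P[_ _ /IHla ->]. Qed.

Lemma vstrip_sumn la nu : vstrip la nu -> sumn nu <= sumn la.
Proof. by elim: la nu => [|l la IHla] [|n nu] //= /and3P[? _ /IHla]; lia. Qed.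

Lemma vstrip_last la nu : vstrip la nu -> last 0 nu <= last 0 la.
Proof.
case: la nu => [|l la] [|n nu] //= /and3P[+ _ +].
by elim: la l nu n => [|l' la IHla] l [|n' nu] n //= _ /and3P[le1 _ vs]; exact: IHla.
Qed.

Lemma all_gtn_sumn B v : sumn v < B -> all (gtn B) v.
Proof. by elim: v => //= a v IHv lt; rewrite IHv ?andbT; lia. Qed.

Lemma vstrip_all la nu B : vstrip la nu -> all (gtn B) la -> all (gtn B) nu.
Proof.
elim: la nu => [|l la IHla] [|n nu] //= /and3P[le _ vs] /andP[lt all_la].
by rewrite (IHla nu) ?andbT //; lia.
Qed.

Fixpoint downs (nu : seq nat) : seq (seq nat) :=
  if nu is n :: nu' then
    [seq m :: mu | m <- iota (head 0 nu') (n.+1 - head 0 nu'), mu <- downs nu']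
  else [:: [::]].

Lemma mem_downs nu mu : (mu \in downs nu) = vstrip nu mu.
Proof.
elim: nu mu => [|n nu IHnu] [|m mu] //=.
  by apply/negbTE/allpairsPdep => [[b [w []]]].
apply/allpairsPdep/and3P => [[b [w [+ + [-> ->]]]]|[lem leh vs]].
  by rewrite mem_iota IHnu => lem vs; split=> //; lia.
by exists m, mu; rewrite mem_iota IHnu vs; split=> //; lia.
Qed.

Lemma downs_uniq nu : uniq (downs nu).
Proof.
elim: nu => //= n nu IHnu; apply: allpairs_uniq_dep => //; first exact: iota_uniq.
by move=> [a v] [b w] _ _ [-> ->].
Qed.

Section Pieri.
Variable R : comNzRingType.
Implicit Types (x : nat -> R) (phi : nat -> R).
Local Open Scope ring_scope.

Lemma big_box (F : seq nat -> R) (P : pred (seq nat)) r B :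
  \sum_(v <- box r.+1 B | P v) F v =
  \sum_(0 <= a < B) \sum_(v <- box r B | P (a :: v)) F (a :: v).
Proof.
rewrite big_mkcond big_allpairs_dep /index_iota subn0.
by apply: eq_bigr => a _; rewrite -big_mkcond.
Qed.

Lemma big_box0 (F : seq nat -> R) (P : pred (seq nat)) B :
  \sum_(v <- box 0 B | P v) F v = if P [::] then F [::] else 0.
Proof. by rewrite big_mkcond big_seq1. Qed.

Lemma big_downs (F : seq nat -> R) nu B : all (gtn B) nu ->
  \sum_(mu <- downs nu) F mu = \sum_(mu <- box (size nu) B | vstrip nu mu) F mu.
Proof.
move=> all_nu; rewrite -[RHS]big_filter; apply: perm_big; apply: uniq_perm.
- exact: downs_uniq.
- by rewrite filter_uniq // box_uniq.
move=> mu; rewrite mem_filter mem_box mem_downs; case: (boolP (vstrip nu mu)) => //= vs.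
by rewrite (vstrip_all vs all_nu) (vstrip_size vs) eqxx.
Qed.

(* The Schur polynomial in x 0, ..., x (N - 1), as a sum over Gelfand-Tsetlin patterns. *)
Fixpoint gt x (N : nat) (nu : seq nat) : R :=
  if N is N'.+1 then \sum_(mu <- downs nu) x N' ^+ (sumn nu - sumn mu) * gt x N' mu
  else (all (pred1 0%N) nu)%:R.

(** Says max(nu_i, rho_i) <= la_i <= min(nu_(i-1), rho_(i-1)), with [c] as the first upper bound:
    the rows but the first of a shape lying a horizontal strip above two given ones. *)
Fixpoint between (c : nat) (nu rho la : seq nat) : bool :=
  match nu, rho, la with
  | n :: nu', m :: rho', l :: la' =>
      [&& l <= c, n <= l, m <= l & between (minn n m) nu' rho' la']%N
  | [::], [::], [::] => true
  | _, _, _ => false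
  end.

Lemma vstrip_between n nu m rho l la :
  vstrip (l :: la) (n :: nu) && vstrip (l :: la) (m :: rho) =
  [&& n <= l, m <= l & between (minn n m) nu rho la]%N.
Proof.
rewrite /=; elim: la l n nu m rho => [|l' la IHla] l n [|n' nu] m [|m' rho] /=;
  rewrite ?andbF ?andbT //.
have := IHla l' n' nu m' rho; rewrite leq_min.
by case: (n <= l)%N; case: (m <= l)%N; case: (l' <= n)%N; case: (l' <= m)%N => //=; rewrite ?andbF //= => ->.
Qed.

Lemma sum_reflect (F : nat -> R) M c B : (c < B)%N ->
  \sum_(0 <= l < B | (M <= l <= c)%N) F l = \sum_(0 <= l < B | (M <= l <= c)%N) F (M + c - l)%N.
Proof.
move=> ltcB.
have E G : \sum_(0 <= l < B | (M <= l <= c)%N) G l = \sum_(M <= l < c.+1) G l :> R.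
  rewrite (big_nat_widen _ _ _ _ _ ltcB) (big_nat_widenl M 0%N) //.
  by apply: eq_bigl => l; rewrite /= ltnS andbC.
by rewrite !E big_nat_rev; apply: eq_bigr => l _; rewrite addnS subSS.
Qed.

(** Reflecting every entry in its interval turns common upper neighbours, deprived of their first
    row, into common lower neighbours; this is why the sum of [la] becomes a constant minus the sum
    of [mu]. The last entry of [mu] is 0 because [last n nu] is. *)
Lemma sum_between phi n nu m rho B : size rho = size nu -> last n nu = 0%N ->
  (n < B)%N -> all (gtn B) nu -> all (gtn B) rho ->
  \sum_(la <- box (size nu) B | between (minn n m) nu rho la) phi (sumn la) =
  \sum_(mu <- box (size nu).+1 B | vstrip (n :: nu) mu && vstrip (m :: rho) mu)
    phi (minn n m + sumn nu + sumn rho - sumn mu)%N.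
Proof.
elim: nu n m rho phi => [|n1 nu IHnu] n m [|m1 rho] // phi.
  move=> _ n0 ltB _ _; rewrite [last _ _]/= in n0.
  rewrite [RHS]big_box n0 min0n [size _]/= big_box0.
  rewrite (eq_bigr (fun a => if a == 0%N then phi 0%N else 0)); last first.
    by move=> [|a] _; rewrite big_box0.
  rewrite -big_mkcond /= big_nat1_eq; case: ifP => //; lia.
move=> [szr] lst ltB /andP[ltn1 all_nu] /andP[ltm1 all_rho].
rewrite [size (n1 :: nu)]/= [sumn (n1 :: nu)]/= [sumn (m1 :: rho)]/=.
rewrite big_box [RHS]big_box.
pose M := maxn n1 m1; pose c := minn n m; pose c1 := minn n1 m1.
pose Q mu := vstrip (n1 :: nu) mu && vstrip (m1 :: rho) mu.
pose S := (c1 + sumn nu + sumn rho)%N.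
transitivity (\sum_(0 <= l < B | (M <= l <= c)%N)
    \sum_(mu <- box (size nu).+1 B | Q mu) phi (l + (S - sumn mu))%N).
  rewrite [RHS]big_mkcond; apply: eq_bigr => l _.
  have -> : (M <= l <= c)%N = [&& l <= c, n1 <= l & m1 <= l]%N by rewrite geq_max andbC.
  case: (boolP [&& _, _ & _]) => [/and3P[le1 le2 le3]|nle]; last first.
    rewrite big1 // => la /= /and4P[le1 le2 le3 _].
    by rewrite /c le1 le2 le3 in nle.
  rewrite (eq_bigl (between c1 nu rho)); last by move=> la; rewrite /= -/c le1 le2 le3.
  by rewrite (IHnu n1 m1 rho (fun s => phi (l + s)%N)).
transitivity (\sum_(0 <= l < B | (M <= l <= c)%N)
    \sum_(mu <- box (size nu).+1 B | Q mu) phi (M + c - l + (S - sumn mu))%N).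
  by rewrite (sum_reflect (fun l => \sum_(mu <- _ | Q mu) phi (l + (S - sumn mu))%N)) // /c; lia.
rewrite [LHS]big_mkcond; apply: eq_bigr => t _.
have -> : (M <= t <= c)%N = [&& t <= n, n1 <= t, t <= m & m1 <= t]%N.
  by rewrite geq_max leq_min; case: (n1 <= t)%N; case: (m1 <= t)%N; case: (t <= n)%N; case: (t <= m)%N.
case: (boolP [&& _, _, _ & _]) => [/and4P[le1 le2 le3 le4]|nle]; last first.
  rewrite big1 // => mu /= /andP[/and3P[le1 le2 _] /and3P[le3 le4 _]].
  by rewrite le1 le2 le3 le4 in nle.
rewrite [RHS](eq_bigl Q); last by move=> mu; rewrite /= le1 le2 le3 le4.
apply: eq_bigr => mu /andP[vs1 vs2]; congr phi.
have : (sumn mu <= S)%N.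
  case: mu vs1 vs2 => [|q mu] //= /and3P[leq1 _ vs1] /and3P[leq2 _ vs2].
  by have := vstrip_sumn vs1; rewrite /S /c1; lia.
by rewrite /= /S /M /c /c1; lia.
Qed.

(** The total of [la] determines its first row; that this row is at least the first rows of [nu] and
    [rho] becomes [sumn rho <= sumn mu + k]. *)
Lemma sum_pieri (z : R) nu rho k B : size rho = size nu -> nu <> [::] -> last 0 nu = 0 ->
  (sumn nu + k < B)%N -> all (gtn B) rho ->
  \sum_(la <- box (size nu) B | [&& vstrip la nu, vstrip la rho & sumn la == sumn nu + k]%N)
     z ^+ (sumn la - sumn rho) =
  \sum_(mu <- box (size nu) B | vstrip nu mu && vstrip rho mu)
     (if (sumn rho <= sumn mu + k)%N then z ^+ (sumn nu + k - sumn rho) else 0) :> R.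
Proof.
case: nu rho => [|n nu] [|m rho] // [szr] _ lst ltB /andP[ltm all_rho].
have [ltn all_nu] : (n < B)%N /\ all (gtn B) nu.
  have : all (gtn B) (n :: nu) by apply: all_gtn_sumn; lia.
  by case/andP.
pose T := (sumn (n :: nu) + k)%N; pose G := z ^+ (T - sumn (m :: rho)).
pose Q mu := vstrip (n :: nu) mu && vstrip (m :: rho) mu.
pose c0 mu := (minn n m + sumn nu + sumn rho - sumn mu)%N.
rewrite [size (n :: nu)]/= big_box.
transitivity (\sum_(0 <= l < B | (maxn n m <= l)%N) \sum_(mu <- box (size nu).+1 B | Q mu)
    if (l + c0 mu == T)%N then G else 0).
  rewrite [RHS]big_mkcond; apply: eq_bigr => l _; rewrite geq_max.
  rewrite (eq_bigl (fun la => [&& (n <= l) && (m <= l), between (minn n m) nu rho la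
      & l + sumn la == T])%N); last first.
    by move=> la; rewrite andbA vstrip_between -!andbA.
  case: andP => [[lenl leml]|] /=; last by rewrite big_pred0.
  rewrite -(@sum_between (fun s => if (l + s == T)%N then G else 0)) //; last first.
  rewrite big_mkcondr; apply: eq_bigr => la _.
  by case: eqP => // ->.
rewrite exchange_big /=; apply: eq_bigr => mu /andP[vs1 vs2].
have le_mu : (sumn mu <= minn n m + sumn nu + sumn rho)%N.
  case: mu vs1 vs2 => [|q mu] //= /and3P[leq1 _ vs1] /and3P[leq2 _ vs2].
  by have := vstrip_sumn vs1; lia.
have le_mu1 := vstrip_sumn vs1; have le_mu2 := vstrip_sumn vs2.
rewrite /= in le_mu1 le_mu2.
rewrite -big_mkcondr /=.
rewrite (eq_bigl (fun l => ((maxn n m <= l) && (c0 mu <= T)) && (l == T - c0 mu))%N); last first.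
  move=> l; case: (leqP (maxn n m) l) => //= lel; rewrite /c0 /T /=; apply/eqP/andP; lia.
rewrite big_nat1_cond_eq; congr (if _ then _ else _); move: ltB; rewrite /T /c0 /=; lia.
Qed.

Lemma all0_sumn v : all (pred1 0%N) v = (sumn v == 0)%N.
Proof. by elim: v => //= a v ->; rewrite addn_eq0. Qed.

Lemma gtS1 x N k : gt x N.+1 [:: k] = \sum_(0 <= m < k.+1) x N ^+ (k - m) * gt x N [:: m].
Proof.
rewrite -[LHS]/(\sum_(mu <- [seq m :: mu | m <- iota 0 (k.+1 - 0), mu <- [:: [::]]])
  x N ^+ (sumn [:: k] - sumn mu) * gt x N mu).
rewrite big_allpairs_dep /index_iota !subn0; apply: eq_bigr => m _.
by rewrite big_seq1 /= !addn0.
Qed.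

(** Both sides are branched on the last variable. For a fixed inner shape [rho] the left side runs
    over the [mu] below [nu] and [rho], the right side over the [la] above both, and [sum_pieri]
    compares them. *)
Theorem pieri x N nu k B : nu <> [::] -> last 0 nu = 0 -> (sumn nu + k < B)%N ->
  gt x N nu * gt x N [:: k] =
  \sum_(la <- box (size nu) B | vstrip la nu && (sumn la == sumn nu + k)%N) gt x N la.
Proof.
elim: N nu k => [|N IHN] nu k nu_nil lst ltB.
  rewrite /= andbT all0_sumn -natrM mulnb -addn_eq0.
  under eq_bigr do rewrite all0_sumn.
  case: eqP => [s0|nz]; last first.
    rewrite big1 // => la /andP[_ /eqP ->].
    by case: eqP.
  rewrite -big_filter (perm_big [:: nu]) ?big_seq1 //=; first by have -> : sumn nu = 0%N by lia.
  apply: uniq_perm => //; first by rewrite filter_uniq // box_uniq.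
  move=> la; rewrite mem_filter mem_box inE s0; have s0' : sumn nu = 0%N by lia.
  have := s0' => /eqP/natnseq0P nuE.
  apply/idP/eqP => [/and3P[/andP[_ /natnseq0P laE] /eqP szl _]|->]; first by rewrite laE szl -nuE.
  rewrite eqxx s0' eqxx all_gtn_sumn ?andbT; last by lia.
  by rewrite nuE; elim: (size nu) => //= r ->; case: r.
have all_nu : all (gtn B) nu by apply: all_gtn_sumn; lia.
rewrite {1}[gt x N.+1 nu]/= (big_downs _ all_nu) gtS1 mulr_suml.
set bx := box _ _.
transitivity (\sum_(mu <- bx | vstrip nu mu) \sum_(rho <- bx | vstrip rho mu)
   (if (sumn rho <= sumn mu + k)%N then x N ^+ (sumn nu + k - sumn rho) else 0) * gt x N rho).
  apply: eq_bigr => mu vs; have le_mu := vstrip_sumn vs.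
  have mu_nil : mu <> [::] by move=> mu0; move: vs nu_nil; rewrite mu0; case: (nu).
  have lst_mu : last 0%N mu = 0%N by have := vstrip_last vs; rewrite lst; lia.
  transitivity (\sum_(0 <= m < k.+1) \sum_(rho <- bx | vstrip rho mu)
     (if (sumn rho == sumn mu + m)%N then x N ^+ (sumn nu + k - sumn rho) * gt x N rho else 0)).
    rewrite mulr_sumr; apply: eq_big_nat => m /andP[_ ltm].
    rewrite mulrACA -exprD IHN //; last by lia.
    rewrite -(vstrip_size vs) -/bx big_mkcondr mulr_sumr; apply: eq_bigr => rho vs'.
    by case: eqP => [->|_]; rewrite ?mulr0 //; congr (_ ^+ _ * _); lia.
  rewrite exchange_big /=; apply: eq_bigr => rho vs'; have le_rho := vstrip_sumn vs'.
  rewrite -big_mkcond /= (eq_bigl (fun m => m == sumn rho - sumn mu)%N); last by move=> m; lia.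
  rewrite big_nat1_eq leq0n /= ltnS leq_subLR addnC; case: ifP => _; by rewrite ?mul0r.
transitivity (\sum_(la <- bx | vstrip la nu && (sumn la == sumn nu + k)%N)
    \sum_(rho <- bx | vstrip la rho) x N ^+ (sumn la - sumn rho) * gt x N rho); last first.
  apply: eq_bigr => la /andP[vs /eqP sum_la]; rewrite [RHS]/= (big_downs _ (B := B)).
    by rewrite (vstrip_size vs).
  by apply: all_gtn_sumn; lia.
rewrite (exchange_big_dep xpredT) //= [RHS](exchange_big_dep xpredT) //=.
rewrite big_seq [RHS]big_seq; apply: eq_bigr => rho.
rewrite mem_box => /andP[/eqP sz_rho all_rho].
rewrite -!mulr_suml; congr (_ * _).
rewrite -(@sum_pieri (x N) nu rho k B) //; apply: eq_bigl => la.
by rewrite -andbA [(_ == _) && _]andbC.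
Qed.

End Pieri.

(** * Tableaux as lists of rows *)

(** Weakly increasing words, listed by the number of copies of the largest letter, since the
    branching rule erases that letter. *)
Fixpoint swords (N n : nat) : seq (seq nat) :=
  if N is N'.+1 then [seq u ++ nseq (n - m) N' | m <- iota 0 n.+1, u <- swords N' m]
  else if n is 0 then [:: [::]] else [::].

Lemma swordsS N n : swords N.+1 n =
  [seq u ++ nseq (n - m) N | m <- iota 0 n.+1, u <- swords N m].
Proof. by []. Qed.

Lemma pairwise_leq_nseq k a : pairwise leq (nseq k a).
Proof. by elim: k => //= k ->; rewrite andbT all_nseq leqnn orbT. Qed.

Lemma pairwise_leq_split N u : all (gtn N.+1) u -> pairwise leq u ->
  u = [seq i <- u | i < N] ++ nseq (size u - size [seq i <- u | i < N]) N.
Proof.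
elim: u => //= a u IHu /andP[lta all_u] /andP[le_a pw].
case: (ltnP a N) => [ltaN|leNa] /=; first by rewrite subSS -IHu.
have aN : a = N by lia.
have uE : u = nseq (size u) N.
  apply/all_pred1P/allP => b ub /=; apply/eqP.
  by have := allP all_u b ub; have := allP le_a b ub => /=; lia.
have -> : [seq i <- u | i < N] = [::].
  by rewrite uE; elim: (size u) => //= k ->; rewrite ltnn.
by rewrite /= aN -uE.
Qed.

Lemma mem_swords N n u :
  (u \in swords N n) = [&& size u == n, all (gtn N) u & pairwise leq u].
Proof.
elim: N n u => [|N IHN] n u.
  by case: n u => [|n] [|a u] //=; rewrite andbF.
rewrite swordsS; apply/allpairsPdep/and3P => [[m [v [+ + ->]]]|[/eqP szu all_u pw]].
  rewrite mem_iota IHN => lem /and3P[/eqP szv all_v pwv].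
  have szu : size v + (n - m) = n by lia.
  rewrite size_cat size_nseq szu eqxx all_cat all_nseq pairwise_cat pwv pairwise_leq_nseq !andbT.
  split=> //=; first by rewrite ltnSn orbT andbT; apply: sub_all all_v => i /=; lia.
  apply/allrelP => i j vi; rewrite mem_nseq => /andP[_ /eqP ->].
  by have := allP all_v i vi => /=; lia.
exists (size [seq i <- u | i < N]), [seq i <- u | i < N]; split.
- by rewrite mem_iota /= add0n ltnS -szu size_filter count_size.
- rewrite IHN eqxx (subseq_pairwise (filter_subseq _ _) pw) andbT /=.
  by apply/allP => i; rewrite mem_filter => /andP[].
by rewrite -szu; apply: pairwise_leq_split.
Qed.

Lemma swords_uniq N n : uniq (swords N n).
Proof.
elim: N n => [|N IHN] n; first by case: n.
rewrite swordsS; apply: allpairs_uniq_dep => //; first exact: iota_uniq.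
move=> [m v] [m' v'] /allpairsPdep[m1 [v1 [_ + ->]]] /allpairsPdep[m2 [v2 [_ + ->]]] /=.
rewrite !mem_swords => /and3P[/eqP <- all1 _] /and3P[/eqP <- all2 _] eqv.
have filt k (w : seq nat) : all (gtn N) w -> [seq i <- w ++ nseq k N | i < N] = w.
  move=> all_w; rewrite filter_cat; have -> : [seq i <- nseq k N | i < N] = [::].
    by elim: k => //= k ->; rewrite ltnn.
  by rewrite cats0; apply/all_filterP; apply: sub_all all_w.
have := congr1 (filter (fun i => i < N)) eqv; rewrite !filt // => -> //.
Qed.

Section Rows.
Variable rel : seq nat -> seq nat -> bool.

Definition orel (p : option (seq nat)) (u : seq nat) : bool :=
  if p is Some v then rel v u else true.

Fixpoint rows (N : nat) (p : option (seq nat)) (ns : seq nat) : seq (seq (seq nat)) :=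
  if ns is n :: ns' then
    [seq u :: t | u <- [seq u <- swords N n | orel p u], t <- rows N (Some u) ns']
  else [:: [::]].

Lemma mem_rows N p ns t : (t \in rows N p ns) =
  [&& size t == size ns, all2 (fun u n => u \in swords N n) t ns
    & if p is Some v then path rel v t else sorted rel t].
Proof.
elim: ns p t => [|n ns IHns] p [|u t] //=.
- by case: p.
- by apply/negbTE/allpairsPdep => [[b [w []]]].
have -> : (if p is Some v then rel v u && path rel u t else path rel u t) =
  orel p u && path rel u t by case: p.
rewrite eqSS; apply/allpairsPdep/idP => [[v [s [+ + [-> ->]]]]|].
  by rewrite mem_filter IHns => /andP[-> ->] /and3P[-> -> ->].
move=> /and3P[szt /andP[u_in t_in] /andP[o_u pth]].
by exists u, t; rewrite mem_filter IHns o_u u_in szt t_in pth.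
Qed.

Lemma rows_uniq N p ns : uniq (rows N p ns).
Proof.
elim: ns p => //= n ns IHns p; apply: allpairs_uniq_dep => //.
  by rewrite filter_uniq // swords_uniq.
by move=> [a v] [b w] _ _ [-> ->].
Qed.

End Rows.

Section Link.
Variables (N : nat) (la mu : seq nat).
Hypothesis la_ni : forall i, nth 0 la i.+1 <= nth 0 la i.
Hypothesis mu_ni : forall i, nth 0 mu i.+1 <= nth 0 mu i.
Hypothesis le_mu : forall i, nth 0 mu i <= nth 0 la i.
Let D := skew_diagram la mu.
Let r := size la.

Lemma mem_skew i j : ((i, j) \in D) = (i < r) && (nth 0 mu i <= j < nth 0 la i).
Proof.
apply/allpairsPdep/andP => [[i' [j' [+ + [-> ->]]]]|[lti ltj]].
  by rewrite !mem_iota; have := le_mu i'; rewrite /r; lia.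
by exists i, j; rewrite !mem_iota; have := le_mu i; split=> //; rewrite /r in lti; lia.
Qed.

Lemma skew_uniq : uniq D.
Proof.
apply: allpairs_uniq_dep => [|i _|]; rewrite ?iota_uniq //.
by move=> [a v] [b w] _ _ [-> ->].
Qed.

Definition entry (T : {ffun seq_sub D -> 'I_N}) (c : nat * nat) : nat :=
  oapp (fun c' => nat_of_ord (T c')) 0 (insub c).

Lemma entryE T (c : seq_sub D) : entry T (val c) = T c.
Proof. by rewrite /entry valK. Qed.

Definition read_rows (T : {ffun seq_sub D -> 'I_N}) : seq (seq nat) :=
  [seq [seq entry T (i, j) | j <- iota (nth 0 mu i) (nth 0 la i - nth 0 mu i)]
     | i <- iota 0 r].

Let ns := [seq nth 0 la i - nth 0 mu i | i <- iota 0 r].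

Lemma nth_read_rows T i : i < r -> nth [::] (read_rows T) i =
  [seq entry T (i, j) | j <- iota (nth 0 mu i) (nth 0 la i - nth 0 mu i)].
Proof. by move=> lti; rewrite (nth_map 0) ?size_iota // nth_iota. Qed.

Lemma nth_nth_read_rows T i j : i < r -> nth 0 mu i <= j < nth 0 la i ->
  nth 0 (nth [::] (read_rows T) i) (j - nth 0 mu i) = entry T (i, j).
Proof.
move=> lti ltj; rewrite nth_read_rows // (nth_map 0) ?size_iota ?nth_iota; try lia.
by congr (entry T (_, _)); lia.
Qed.

(** The comparison of adjacent rows is left abstract, to serve both straight shapes ([col_lt]) and
    ribbons ([rib_lt]). *)
Variable rel : seq nat -> seq nat -> bool.
Hypothesis relP : forall i u v, i.+1 < r ->
  size u = nth 0 la i - nth 0 mu i -> size v = nth 0 la i.+1 - nth 0 mu i.+1 ->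
  reflect (forall j, nth 0 mu i <= j < nth 0 la i.+1 ->
             nth 0 u (j - nth 0 mu i) < nth 0 v (j - nth 0 mu i.+1)) (rel u v).

Lemma is_ssytP T : reflect
  ((forall i, i < r -> pairwise leq (nth [::] (read_rows T) i)) /\
   (forall i, i.+1 < r -> rel (nth [::] (read_rows T) i) (nth [::] (read_rows T) i.+1)))
  (is_ssyt T).
Proof.
have szr i : i < r -> size (nth [::] (read_rows T) i) = nth 0 la i - nth 0 mu i.
  by move=> lti; rewrite nth_read_rows // size_map size_iota.
apply: (iffP idP) => [/forallP ssyt|[row_ok col_ok]].
  have {}ssyt c d : c \in D -> d \in D ->
      (c.1 = d.1 -> c.2 <= d.2 -> entry T c <= entry T d) /\
      (c.2 = d.2 -> c.1 < d.1 -> entry T c < entry T d).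
    move=> cD dD; have /forallP/(_ (SeqSub dD))/andP[/implyP h1 /implyP h2] := ssyt (SeqSub cD).
    have := entryE T (SeqSub cD); have := entryE T (SeqSub dD); rewrite /= => -> ->.
    by split=> [e1 e2|e1 e2]; [apply: h1|apply: h2]; rewrite /= e1 eqxx.
  split=> [i lti|i lti].
    apply/(pairwiseP 0) => p q; rewrite !inE szr // => ltp ltq ltpq.
    rewrite nth_read_rows // !(nth_map 0) ?size_iota // !nth_iota //.
    apply: (ssyt _ _ _ _).1 => //; rewrite ?mem_skew ?lti //=; lia.
  apply/(relP lti); rewrite ?szr ?(ltnW lti) // => j ltj.
  have := la_ni i; have := mu_ni i => le1 le2.
  rewrite !nth_nth_read_rows ?(ltnW lti) //; try lia.
  apply: (ssyt _ _ _ _).2; rewrite ?mem_skew ?lti ?(ltnW lti) //=; lia.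
have row i j j' : (i, j) \in D -> (i, j') \in D -> j <= j' -> entry T (i, j) <= entry T (i, j').
  rewrite !mem_skew => /andP[lti ltj] /andP[_ ltj'].
  rewrite leq_eqVlt => /predU1P[-> //|ltjj'].
  have := row_ok i lti => /(pairwiseP 0)/(_ (j - nth 0 mu i) (j' - nth 0 mu i)).
  by rewrite !nth_nth_read_rows // !inE szr //; apply; lia.
(* The columns of a skew diagram have no gaps, so comparing adjacent rows is enough. *)
have col i i' j : (i, j) \in D -> (i', j) \in D -> i < i' -> entry T (i, j) < entry T (i', j).
  elim: i' => // i' IHi'; rewrite ltnS => ijD ij'D lei.
  have [lti' ltj'] : i'.+1 < r /\ nth 0 mu i'.+1 <= j < nth 0 la i'.+1.
    by move: ij'D; rewrite mem_skew => /andP[].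
  have le_mui : nth 0 mu i' <= nth 0 mu i.
    elim: (i') lei => [|q IHq]; first by rewrite leqn0 => /eqP ->.
    rewrite leq_eqVlt => /predU1P[-> //|]; rewrite ltnS => /IHq; have := mu_ni q; lia.
  have ltj : nth 0 mu i <= j by move: ijD; rewrite mem_skew => /andP[_ /andP[]].
  have i'jD : (i', j) \in D by rewrite mem_skew (ltnW lti') /=; have := la_ni i'; lia.
  have step : entry T (i', j) < entry T (i'.+1, j).
    have := la_ni i'; have := mu_ni i' => le1 le2.
    have /(relP lti') := col_ok i' lti'; rewrite !szr ?(ltnW lti') // => /(_ erefl erefl j).
    by rewrite !nth_nth_read_rows ?(ltnW lti') //; try lia; apply; lia.
  move: lei; rewrite leq_eqVlt => /predU1P[-> //|lti].
  exact: ltn_trans (IHi' ijD i'jD lti) step.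
apply/forallP => -[[i j] ijD]; apply/forallP => -[[i' j'] ij'D].
have := entryE T (SeqSub ijD); have := entryE T (SeqSub ij'D); rewrite /= => <- <-.
apply/andP; split; apply/implyP => /andP[/eqP eqc lt]; subst; [exact: row|exact: col].
Qed.

Lemma read_rows_inj : injective read_rows.
Proof.
move=> T T' eqT; apply/ffunP => -[[i j] ijD]; apply/val_inj => /=.
rewrite -!entryE /=; move: (ijD); rewrite mem_skew => /andP[lti ltj].
by rewrite -!nth_nth_read_rows // eqT.
Qed.

Lemma read_rowsP t : reflect
  (exists2 T, is_ssyt T & t = read_rows T) (t \in rows rel N None ns).
Proof.
have sz_ns : size ns = r by rewrite size_map size_iota.
have nth_ns i : i < r -> nth 0 ns i = nth 0 la i - nth 0 mu i.
  by move=> lti; rewrite (nth_map 0) ?size_iota // nth_iota.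
rewrite mem_rows sz_ns all2E sz_ns; apply: (iffP idP).
  move=> /and3P[/eqP szt /andP[_ allt] srt].
  have rowP i : i < r -> nth [::] t i \in swords N (nth 0 la i - nth 0 mu i).
    move=> lti; rewrite -nth_ns //; have /(all_nthP ([::], 0)) := allt.
    rewrite size_zip szt sz_ns minnn => /(_ i lti).
    by rewrite nth_zip ?szt ?sz_ns.
  pose f (c : nat * nat) := nth 0 (nth [::] t c.1) (c.2 - nth 0 mu c.1).
  have fN (c : seq_sub D) : f (val c) < N.
    case: c => -[i j] ijD /=; move: (ijD); rewrite mem_skew => /andP[lti ltj].
    have := rowP i lti; rewrite mem_swords => /and3P[/eqP szi /allP alli _].
    by apply: alli; apply: mem_nth; rewrite szi /=; lia.
  pose T := [ffun c => Ordinal (fN c)].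
  have entT c : c \in D -> entry T c = f c.
    by move=> cD; have := entryE T (SeqSub cD) => /= ->; rewrite ffunE.
  have tE : t = read_rows T.
    apply: (@eq_from_nth _ [::]); rewrite ?size_map ?size_iota // szt => i lti.
    have := rowP i lti; rewrite mem_swords => /and3P[/eqP szi _ _].
    rewrite nth_read_rows //; apply: (@eq_from_nth _ 0); rewrite ?size_map ?size_iota // szi => q ltq.
    rewrite (nth_map 0) ?size_iota // nth_iota // entT /f ?addKn //= mem_skew lti /=; lia.
  exists T => //; apply/is_ssytP; rewrite -tE; split=> i lti.
    by have := rowP i lti; rewrite mem_swords => /and3P[].
  by move/(sortedP [::]): srt => /(_ i); rewrite szt; apply.
move=> [T ssyt ->]; have /is_ssytP[row_ok col_ok] := ssyt.
have szT : size (read_rows T) = r by rewrite size_map size_iota.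
rewrite szT eqxx /=; apply/andP; split; last first.
  by apply/(sortedP [::]) => i; rewrite szT; apply: col_ok.
apply/(all_nthP ([::], 0)) => i; rewrite size_zip szT sz_ns minnn => lti.
rewrite nth_zip ?szT ?sz_ns //= nth_ns // mem_swords row_ok // andbT.
rewrite nth_read_rows // size_map size_iota eqxx /=.
apply/allP => _ /mapP[j + ->]; rewrite mem_iota => ltj.
have ijD : (i, j) \in D by rewrite mem_skew lti /=; have := le_mu i; lia.
by have := entryE T (SeqSub ijD) => /= ->; apply: ltn_ord.
Qed.

Lemma big_seq_sub (R : Type) (idx : R) (op : Monoid.com_law idx) (F : nat * nat -> R) :
  \big[op/idx]_(c : seq_sub D) F (val c) = \big[op/idx]_(c <- D) F c.
Proof.
rewrite -(big_map val xpredT F); apply: perm_big; apply: uniq_perm.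
- by rewrite map_inj_uniq ?index_enum_uniq //; apply: val_inj.
- exact: skew_uniq.
move=> c; apply/mapP/idP => [[c' _ ->]|cD]; first exact: valP.
by exists (SeqSub cD); rewrite ?mem_index_enum.
Qed.

Definition mvar (k : nat) : {mpoly int[N]} :=
  if insub k is Some i then ('X_(i : 'I_N))%R else 0%R.

Theorem schur_diagram_rows : schur_diagram N D =
  (\sum_(t <- rows rel N None ns) \prod_(u <- t) \prod_(k <- u) mvar k)%R.
Proof.
pose F (t : seq (seq nat)) := (\prod_(u <- t) \prod_(k <- u) mvar k)%R.
transitivity (\sum_(T <- enum (@is_ssyt N D)) F (read_rows T))%R.
  rewrite /schur_diagram big_enum /=; apply: eq_big => [T|T _] //.
  transitivity (\prod_(c : seq_sub D) mvar (entry T (val c)))%R.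
    by apply: eq_bigr => c _; rewrite entryE /mvar valK.
  rewrite (big_seq_sub _ (fun c => mvar (entry T c))) big_allpairs_dep /F /read_rows big_map.
  by apply: eq_bigr => i _; rewrite big_map.
rewrite -(big_map read_rows xpredT F); apply: perm_big; apply: uniq_perm.
- by rewrite map_inj_uniq ?enum_uniq //; apply: read_rows_inj.
- exact: rows_uniq.
move=> t; apply/mapP/read_rowsP => [[T + ->]|[T ssyt ->]]; first by rewrite mem_enum => ?; exists T.
by exists T => //; rewrite mem_enum.
Qed.

End Link.

(** * The branching rule and products of ribbons with a row *)

Definition col_lt (p u : seq nat) : bool :=
  (size u <= size p) && all (fun i => nth 0 p i < nth 0 u i) (iota 0 (size u)).

(** An entry under a letter [N] would have to exceed [N], so the whole lower row, including its
    letters [N], stands under smaller letters. *)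
Lemma col_lt_cat N k j p u : all (gtn N) p -> all (gtn N) u ->
  col_lt (p ++ nseq k N) (u ++ nseq j N) = (size u + j <= size p) && col_lt p u.
Proof.
move=> /allP all_p /allP all_u.
have nth_u i : i < size u + j -> nth 0 (u ++ nseq j N) i = if i < size u then nth 0 u i else N.
  by move=> lti; rewrite nth_cat; case: ltnP => // lei; rewrite nth_nseq ifT; lia.
rewrite /col_lt !size_cat !size_nseq; apply/andP/and3P => [[sz /allP lt_pu]|[sz sz' /allP lt_pu]].
  have le : size u + j <= size p.
    rewrite leqNgt; apply/negP => ltp.
    have h : size p \in iota 0 (size u + j) by rewrite mem_iota.
    have := lt_pu _ h; rewrite nth_u // nth_cat ltnn subnn nth_nseq.
    have -> : 0 < k by lia.
    case: (ltnP (size p) (size u)) => [ltpu|_]; last by lia.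
    by have := all_u _ (mem_nth 0 ltpu) => /=; lia.
  split=> //; first by lia.
  apply/allP => i; rewrite mem_iota => lti; have := lt_pu i; rewrite mem_iota nth_u ?nth_cat; try lia.
  by have -> : i < size u by [lia]; have -> : i < size p by [lia]; apply; lia.
split; first by lia.
apply/allP => i; rewrite mem_iota => lti; rewrite nth_u ?nth_cat; try lia.
have ltp : i < size p by lia.
rewrite ltp; case: (ltnP i (size u)) => [ltu|_]; first by apply: lt_pu; rewrite mem_iota.
exact: (all_p _ (mem_nth 0 ltp)).
Qed.

Section RowSums.
Variables (R : comNzRingType) (x : nat -> R).
Local Open Scope ring_scope.

Definition wt (u : seq nat) : R := \prod_(k <- u) x k.

Definition rowsum rel N p ns : R := \sum_(t <- rows rel N p ns) \prod_(u <- t) wt u.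

Lemma rowsum_nil rel N p : rowsum rel N p [::] = 1.
Proof. by rewrite /rowsum big_seq1 big_nil. Qed.

Lemma rowsum_cons rel N p n ns : rowsum rel N p (n :: ns) =
  \sum_(u <- swords N n | orel rel p u) wt u * rowsum rel N (Some u) ns.
Proof.
rewrite /rowsum /= big_allpairs_dep big_filter; apply: eq_bigr => u _.
by rewrite mulr_sumr; apply: eq_bigr => t _; rewrite big_cons.
Qed.

Lemma wt_cat u v : wt (u ++ v) = wt u * wt v.
Proof. exact: big_cat. Qed.

Lemma wt_nseq k a : wt (nseq k a) = x a ^+ k.
Proof. by rewrite /wt big_nseq; elim: k => //= k ->; rewrite exprS. Qed.

Lemma swords_all N n u : u \in swords N n -> size u = n /\ all (gtn N) u.
Proof. by rewrite mem_swords => /and3P[/eqP]. Qed.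

(** Erasing the largest letter leaves row lengths [mu] that interlace with [nu]. The induction on
    rows has to remember the row above, hence [q]. *)
Lemma rowsum_branch N q k nu : (if q is Some p then all (gtn N) p else true) ->
  rowsum col_lt N.+1 (omap (fun p => p ++ nseq k N) q) nu =
  \sum_(mu <- downs nu | if q is Some p then (head 0%N nu <= size p)%N else true)
     x N ^+ (sumn nu - sumn mu) * rowsum col_lt N q mu.
Proof.
elim: nu q k => [|n nu IHnu] q k all_q.
  rewrite rowsum_nil big_mkcond big_seq1 /= rowsum_nil mulr1.
  by case: (q).
pose ok := if q is Some p then (n <= size p)%N else true.
have orelE m u : (m <= n)%N -> u \in swords N m ->
    orel col_lt (omap (fun p => p ++ nseq k N) q) (u ++ nseq (n - m) N) = ok && orel col_lt q u.
  move=> lem /swords_all[szu all_u]; rewrite /ok; case: (q) all_q => //= p all_p.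
  by rewrite col_lt_cat // szu subnKC.
rewrite rowsum_cons swordsS big_mkcond big_allpairs_dep.
transitivity (\sum_(m <- iota 0 n.+1) \sum_(mu <- downs nu | (head 0%N nu <= m)%N && ok)
    x N ^+ (n + sumn nu - (m + sumn mu)) * rowsum col_lt N q (m :: mu)).
  apply: eq_big_seq => m; rewrite mem_iota => /andP[_ ltm].
  transitivity (\sum_(u <- swords N m | ok && orel col_lt q u)
     \sum_(mu <- downs nu | (head 0%N nu <= m)%N)
       x N ^+ (n + sumn nu - (m + sumn mu)) * (wt u * rowsum col_lt N (Some u) mu)).
    rewrite [RHS]big_mkcond; apply: eq_big_seq => u u_in.
    rewrite orelE //; case: ifP => // _; have [szu all_u] := swords_all u_in.
    have := IHnu (Some u) (n - m)%N all_u; rewrite /= szu => ->.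
    rewrite mulr_sumr big_seq_cond [RHS]big_seq_cond; apply: eq_bigr => mu.
    rewrite mem_downs => /andP[vs _]; have := vstrip_sumn vs => le_mu.
    rewrite wt_cat wt_nseq.
    have -> : (n + sumn nu - (m + sumn mu) = (n - m) + (sumn nu - sumn mu))%N by lia.
    by rewrite exprD; ring.
  rewrite exchange_big /=; case: (ok); last first.
    rewrite [RHS]big_pred0; last by move=> mu; rewrite andbF.
    by rewrite big1 // => mu _; rewrite big_pred0.
  apply: eq_big => [mu|mu _]; first by rewrite andbT.
  by rewrite rowsum_cons mulr_sumr.
rewrite [in RHS]/= [RHS]big_mkcond big_allpairs_dep.
rewrite -/ok; have -> : iota (head 0%N nu) (n.+1 - head 0%N nu) = [seq m <- iota 0 n.+1 | (head 0%N nu <= m)%N].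
  apply: (irr_sorted_eq ltn_trans ltnn); rewrite ?iota_ltn_sorted ?(sorted_filter ltn_trans) ?iota_ltn_sorted //.
  by move=> m; rewrite mem_filter !mem_iota; lia.
rewrite big_filter [RHS]big_mkcond; apply: eq_bigr => m _.
rewrite -[in RHS]big_mkcond /=; case: (head 0%N nu <= m)%N => //=; by rewrite big_pred0.
Qed.

Theorem rowsum_gt N nu : rowsum col_lt N None nu = gt x N nu.
Proof.
elim: N nu => [|N IHN] nu.
  have : forall p, rowsum col_lt 0 p nu = (all (pred1 0%N) nu)%:R.
    elim: nu => [|n nu IHnu] p; first by rewrite rowsum_nil.
    rewrite rowsum_cons; case: n => [|n] /=; last by rewrite big_nil.
    by rewrite big_mkcond big_seq1 /wt big_nil mul1r IHnu; case: p.
  exact.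
have := @rowsum_branch N None 0 nu isT => /= ->.
by apply: eq_bigr => mu _; rewrite IHN.
Qed.

Lemma gt_row N a : gt x N [:: a] = \sum_(u <- swords N a) wt u.
Proof.
by rewrite -rowsum_gt rowsum_cons; apply: eq_bigr => u _; rewrite rowsum_nil mulr1.
Qed.

(** In the only column shared by consecutive rows of a ribbon, the first cell of the upper row
    stands above the last cell of the lower one. *)
Definition rib_lt (u v : seq nat) : bool := (head 0 u < last 0 v)%N.

Definition rib N be : R := rowsum rib_lt N None be.

Lemma rowsum_rib_head N v w be : head 0%N v = head 0%N w ->
  rowsum rib_lt N (Some v) be = rowsum rib_lt N (Some w) be.
Proof.
move=> eq_hd; rewrite /rowsum; case: be => [|b be] //=; congr bigop.
by congr flatten; congr map; apply: eq_filter => u; rewrite /= /rib_lt eq_hd.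
Qed.

Lemma pairwise_leq_cat_last (v u : seq nat) : v <> [::] -> u <> [::] ->
  pairwise leq v -> pairwise leq u -> pairwise leq (v ++ u) = (last 0%N v <= head 0%N u)%N.
Proof.
move=> v_nil u_nil pv pu; rewrite pairwise_cat pv pu !andbT.
case: (lastP v) v_nil pv => // v' a _; rewrite last_rcons.
case: u u_nil pu => // b u _ /= /andP[le_b _]; rewrite -cats1 pairwise_cat => /and3P[le_a _ _].
apply/allrelP/idP => [h|leab i j]; first by apply: h; rewrite ?inE ?mem_cat ?inE eqxx ?orbT.
rewrite mem_cat !inE => hi hj.
have lei : (i <= a)%N.
  by case/orP: hi => [hi|/eqP -> //]; apply: (allrelP le_a); rewrite ?inE.
have lej : (b <= j)%N by case/orP: hj => [/eqP -> //|hj]; apply: (allP le_b).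
by lia.
Qed.

(** Either [u] may stand above [v] in a ribbon, or [v ++ u] is weakly increasing and forms a single
    row. *)
Lemma rib_left N a b be : (0 < a)%N -> (0 < b)%N ->
  rib N [:: a, b & be] + rib N ((a + b)%N :: be) = gt x N [:: a] * rib N (b :: be).
Proof.
move=> a_gt0 b_gt0; rewrite gt_row /rib mulr_suml !rowsum_cons.
pose F u v := wt u * (wt v * rowsum rib_lt N (Some v) be).
have cons u : rowsum rib_lt N (Some u) (b :: be) =
  \sum_(v <- swords N b | rib_lt u v) (wt v * rowsum rib_lt N (Some v) be) by rewrite rowsum_cons.
have -> : \sum_(u <- swords N a | orel rib_lt None u) wt u * rowsum rib_lt N (Some u) (b :: be) =
    \sum_(u <- swords N a) \sum_(v <- swords N b | rib_lt u v) F u v.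
  by apply: eq_bigr => u _; rewrite cons mulr_sumr.
have -> : \sum_(w <- swords N (a + b) | orel rib_lt None w) wt w * rowsum rib_lt N (Some w) be =
    \sum_(u <- swords N a) \sum_(v <- swords N b | ~~ rib_lt u v) F u v.
  transitivity (\sum_(w <- [seq v ++ u | u <- swords N a, v <- [seq v <- swords N b | ~~ rib_lt u v]])
      wt w * rowsum rib_lt N (Some w) be); last first.
    rewrite big_allpairs_dep; apply: eq_bigr => u _; rewrite big_filter.
    rewrite big_seq_cond [RHS]big_seq_cond; apply: eq_bigr => v /andP[/swords_all[szv _] _].
    rewrite wt_cat /F (@rowsum_rib_head N (v ++ u) v) //; first by ring.
    by case: v szv => //=; lia.
  apply: perm_big; apply: uniq_perm; first exact: swords_uniq.
    apply: allpairs_uniq_dep; first exact: swords_uniq.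
      by move=> u _; rewrite filter_uniq // swords_uniq.
    move=> [u v] [u' v'] /allpairsPdep[u1 [v1 [_ + ->]]] /allpairsPdep[u2 [v2 [_ + ->]]] /=.
    rewrite !mem_filter => /andP[_ /swords_all[sz1 _]] /andP[_ /swords_all[sz2 _]].
    move/eqP; rewrite eqseq_cat ?sz1 ?sz2 // => /andP[/eqP -> /eqP eq_u].
    by rewrite eq_u.
  move=> w; rewrite mem_swords; apply/idP/allpairsPdep => [/and3P[/eqP szw all_w pw]|].
    have szd : size (drop b w) = a by rewrite size_drop szw addnK.
    have szt : size (take b w) = b by rewrite size_take szw; case: ltnP => //; lia.
    move: all_w pw; rewrite -{1 2}(cat_take_drop b w) all_cat => /andP[all_t all_d] pw.
    have := pw; rewrite pairwise_cat => /and3P[_ pt pd].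
    exists (drop b w), (take b w); split; last by rewrite cat_take_drop.
      by rewrite mem_swords szd eqxx all_d pd.
    rewrite mem_filter mem_swords szt eqxx all_t pt !andbT /rib_lt -leqNgt.
    by rewrite -pairwise_leq_cat_last //; [move: szt; case: take|move: szd; case: drop]; move=> //=; lia.
  move=> [u [v [+ + ->]]]; rewrite mem_filter !mem_swords /rib_lt -leqNgt.
  move=> /and3P[/eqP szu all_u pu] /and4P[le /eqP szv all_v pv].
  rewrite size_cat szu szv addnC eqxx all_cat all_u all_v pairwise_leq_cat_last //.
    by move=> v0; move: szv; rewrite v0 /=; lia.
  by move=> u0; move: szu; rewrite u0 /=; lia.
rewrite -big_split /=; apply: eq_bigr => u _.
rewrite mulr_sumr [RHS](bigID (rib_lt u)) /=.
by congr (_ + _); apply: eq_bigl => v; rewrite /= andbT.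
Qed.

Lemma rib1 N a : rib N [:: a] = gt x N [:: a].
Proof. by rewrite gt_row /rib rowsum_cons; apply: eq_bigr => u _; rewrite rowsum_nil mulr1. Qed.

(** Expanding every term by [rib_left] at the top row leaves identities of the same kind for shorter
    ribbons. *)
Lemma rib_right N be b a : all (gtn^~ 0%N) be -> (0 < b)%N -> (0 < a)%N ->
  rib N (rcons (rcons be b) a) + rib N (rcons be (a + b)%N) = rib N (rcons be b) * gt x N [:: a].
Proof.
move: {2}(size be) (leqnn (size be)) => n.
elim: n be b => [|n IHn] [|c be] b //= szn pos b_gt0 a_gt0.
- by rewrite addnC rib_left // !rib1.
- by rewrite addnC rib_left // !rib1.
have /andP[c_gt0 pos'] := pos.
have left d s : (0 < d)%N -> rib N [:: c, d & s] = gt x N [:: c] * rib N (d :: s) - rib N ((c + d)%N :: s).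
  by move=> d_gt0; rewrite -rib_left // addrK.
case: be szn pos pos' => [|d be] /= szn pos pos'.
  have := IHn [::] b isT isT b_gt0 a_gt0; have := IHn [::] (c + b)%N isT isT (ltn_addl c b_gt0) a_gt0.
  rewrite /= !left ?addn_gt0 ?a_gt0 // => e1 e2.
  have -> : (c + (a + b) = a + (c + b))%N by lia.
  rewrite mulrBl -mulrA -e2 -e1; ring.
have /andP[d_gt0 pos2] := pos'.
have := IHn (d :: be) b szn pos' b_gt0 a_gt0.
have := IHn ((c + d)%N :: be) b szn _ b_gt0 a_gt0; rewrite /= addn_gt0 c_gt0 pos2 => /(_ isT).
by rewrite /= !left // => e1 e2; rewrite mulrBl -mulrA -e2 -e1; ring.
Qed.

End RowSums.

(** * The Schur expansion of a ribbon *)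

Lemma map_nth_iota (s : seq nat) : [seq nth 0 s i | i <- iota 0 (size s)] = s.
Proof. exact: mkseq_nth. Qed.

Theorem schur_gt N nu : sorted geq nu -> schur N nu = gt (mvar N) N nu.
Proof.
move=> srt; rewrite /schur (@schur_diagram_rows N nu [::] _ _ _ col_lt).
- rewrite -rowsum_gt /rowsum; congr bigop; congr (rows _ _ _ _).
  rewrite -[RHS]map_nth_iota; apply: eq_map => i.
  by rewrite nth_nil subn0.
- move=> i; case: (ltnP i.+1 (size nu)) => [lti|lei]; last by rewrite nth_default.
  by move/(sortedP 0): srt => /(_ i lti).
- by move=> i; rewrite !nth_nil.
- by move=> i; rewrite nth_nil.
move=> i u v lti; rewrite !nth_nil !subn0 => szu szv.
have le : size v <= size u by rewrite szu szv; move/(sortedP 0): srt => /(_ i lti).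
rewrite /col_lt le /=; apply: (iffP allP) => [lt_uv j ltj|lt_uv j].
  by rewrite !subn0; apply: lt_uv; rewrite mem_iota szv.
by rewrite mem_iota szv => ltj; have := lt_uv j; rewrite !subn0; apply.
Qed.

Lemma ribbon_size b : (size (ribbon_outer b) = size b) * (size (ribbon_inner b) = size b).
Proof. by elim: b => //= a b [-> ->]. Qed.

Lemma ribbon_inner_step b i : i.+1 < size b ->
  nth 0 (ribbon_inner b) i = nth 0 (ribbon_inner b) i.+1 + (nth 0 b i.+1).-1.
Proof.
elim: b i => //= a b IHb [|i] /=; last exact: IHb.
by case: b {IHb} => //= c b _; rewrite addnC.
Qed.

Theorem ribbon_rib N b : 0 \notin b ->
  schur_diagram N (ribbon b) = rib (mvar N) N b.
Proof.
move=> b_pos; have [szo szi] := ribbon_size b.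
have posi i : i < size b -> 0 < nth 0 b i.
  by move=> lti; rewrite lt0n; apply: contraNneq b_pos => <-; apply: mem_nth.
have inner_ni i : nth 0 (ribbon_inner b) i.+1 <= nth 0 (ribbon_inner b) i.
  case: (ltnP i.+1 (size b)) => [lti|lei]; last by rewrite nth_default ?szi.
  by rewrite (ribbon_inner_step lti) leq_addr.
have le_io i : nth 0 (ribbon_inner b) i <= nth 0 (ribbon_outer b) i.
  by rewrite ribbon_row_length leq_addr.
rewrite /ribbon (@schur_diagram_rows N _ _ _ _ _ rib_lt) //.
- rewrite /rib /rowsum; congr bigop; congr (rows _ _ _ _).
  rewrite szo -[RHS]map_nth_iota; apply: eq_map => i.
  by rewrite ribbon_row_length addKn.
- move=> i; case: (ltnP i.+1 (size b)) => [lti|lei]; last by rewrite nth_default ?szo.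
  rewrite (ribbon_overlap b_pos lti) ribbon_row_length.
  by have := posi i (ltnW lti); lia.
move=> i u v; rewrite szo => lti; rewrite !ribbon_row_length !addKn => szu szv.
rewrite -ribbon_row_length (ribbon_overlap b_pos lti).
rewrite /rib_lt -nth0 -nth_last szv.
apply: (iffP idP) => [lt j|].
  rewrite ltnS => /andP[le1 le2].
  have -> : j = nth 0 (ribbon_inner b) i by lia.
  by rewrite subnn (ribbon_inner_step lti) addKn.
move/(_ (nth 0 (ribbon_inner b) i)); rewrite leqnn ltnSn subnn => /(_ isT).
by rewrite (ribbon_inner_step lti) addKn.
Qed.

(** * Splitting horizontal strips and counting fillings *)

Fixpoint first_diff (nu la : seq nat) : nat :=
  match nu, la with
  | n :: nu', l :: la' => if n == l then (first_diff nu' la').+1 else 0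
  | _, _ => 0
  end.

(* The first [b] cells, counted from the bottom, of the strip [la / ka]. *)
Fixpoint lower_part (ka la : seq nat) (b : nat) : seq nat :=
  match ka, la with
  | k :: ka', l :: la' =>
      if b <= sumn la' - sumn ka' then k :: lower_part ka' la' b
      else (k + (b - (sumn la' - sumn ka'))) :: la'
  | _, _ => [::]
  end.

Lemma lower_part_head ka la b : vstrip la ka ->
  head 0 ka <= head 0 (lower_part ka la b) /\
  (b <= sumn la - sumn ka -> head 0 (lower_part ka la b) <= head 0 la).
Proof.
case: ka la => [|k ka] [|l la] //= /and3P[le _ vs]; have := vstrip_sumn vs.
by case: (leqP b (sumn la - sumn ka)) => /=; lia.
Qed.

Lemma vstrip_refl la ka : vstrip la ka -> vstrip la la.
Proof.
elim: la ka => [|l la IHla] [|k ka] //= /and3P[le1 le2 /IHla ->]; rewrite leqnn andbT /=; lia.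
Qed.

Lemma lower_partP ka la b : vstrip la ka -> 0 < b <= sumn la - sumn ka ->
  let nu := lower_part ka la b in
  [/\ vstrip nu ka, sumn nu = sumn ka + b, vstrip la nu
    & drop (first_diff ka nu).+1 la = drop (first_diff ka nu).+1 nu].
Proof.
elim: ka la => [|k ka IHka] [|l la] //=; first by case: b.
move=> /and3P[le_kl le_h vs] b_bnd.
have le_s := vstrip_sumn vs.
case: (leqP b (sumn la - sumn ka)) => [leb|ltb] /=.
  have b_bnd' : 0 < b <= sumn la - sumn ka by lia.
  have [vs1 sum1 vs2 dr] := IHka la vs b_bnd'.
  have [h1 h2] := lower_part_head b vs; rewrite eqxx /= dr sum1 vs1 vs2 !andbT.
  by split=> //; have := h2 leb; lia.
have neq : (k == k + (b - (sumn la - sumn ka))) = false by lia.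
rewrite neq /= !drop0 vs (vstrip_refl vs); split=> //; lia.
Qed.

Lemma lower_part_uniq ka nu la b : vstrip nu ka -> vstrip la nu -> 0 < b ->
  sumn nu = sumn ka + b -> drop (first_diff ka nu).+1 la = drop (first_diff ka nu).+1 nu ->
  vstrip la ka /\ nu = lower_part ka la b.
Proof.
elim: ka nu la => [|k ka IHka] [|n nu] [|l la] //=.
move=> /and3P[le_kn le_h vs1] /and3P[le_nl le_h' vs2] b_gt0.
have le1 := vstrip_sumn vs1; have le2 := vstrip_sumn vs2.
case: (eqVneq k n) => [eqk|neqk] /= sum_nu.
  move=> dr; have sum_nu' : sumn nu = sumn ka + b by lia.
  have [vs eqnu] := IHka nu la vs1 vs2 b_gt0 sum_nu' dr.
  rewrite vs ifT; last by lia.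
  by rewrite -eqnu eqk; split=> //; rewrite !andbT; lia.
rewrite !drop0 => eqla; subst la; rewrite vs1; split; first by rewrite !andbT; lia.
by rewrite ifF; [congr (_ :: _); lia|lia].
Qed.

Section Expansion.
Variables (r B : nat).

(** The last conjunct says that the strip has a cell in a row of index at least [i]. *)
Definition extends (ka : seq nat) (i a : nat) (la : seq nat) : bool :=
  [&& vstrip la ka, sumn la == sumn ka + a & drop i la != drop i ka].

(* Pairs of a shape and the successor of the highest row met by the last block. *)
Fixpoint fillings (be : seq nat) : seq (seq nat * nat) :=
  if be is a :: be' then
    [seq (la, (first_diff p.1 la).+1) | p <- fillings be',
       la <- [seq la <- box r B | extends p.1 p.2 a la]]
  else [:: (nseq r 0, 0)].

Lemma fillingsP be p : p \in fillings be ->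
  [/\ size p.1 = r, sumn p.1 = sumn be & vstrip p.1 p.1].
Proof.
elim: be p => [|a be IHbe] p.
  rewrite inE => /eqP -> /=; rewrite size_nseq sumn_nseq; split=> //.
  by elim: r => //= n ->; case: n.
move=> /allpairsPdep[q [la [q_in + ->]]]; rewrite mem_filter mem_box => /andP[/and3P[vs /eqP sum _] /andP[/eqP sz _]].
have [_ sumq _] := IHbe q q_in.
by rewrite /= sum sumq addnC sz (vstrip_refl vs).
Qed.

Lemma vstrip_last0 v : vstrip v v -> sumn v < size v -> last 0 v = 0.
Proof.
move=> vs lt; apply/eqP; rewrite -leqn0 leqNgt; apply/negP => lst.
suff : size v <= sumn v /\ 0 < head 0 v by lia.
elim: v vs lst {lt} => //= a v IHv /and3P[_ le_h vs].
case: v IHv le_h vs => [|b v] //= IHv le_h vs lst; first by lia.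
by have [] := IHv vs lst; lia.
Qed.

Variables (R : comNzRingType) (x : nat -> R) (N : nat).
Local Open Scope ring_scope.

(** If the second block has no cell below the highest row of the first, the two form one horizontal
    strip, and the first is recovered as its [b] lowest cells. The lowest row met is unchanged, so
    the condition at [i] carries over. *)
Lemma merge_blocks ka i a b (F : seq nat -> R) : (0 < a)%N -> (0 < b)%N ->
  size ka = r -> (sumn ka + a + b < B)%N ->
  \sum_(nu <- box r B | extends ka i b nu)
    \sum_(la <- box r B | [&& vstrip la nu, sumn la == sumn nu + a
         & drop (first_diff ka nu).+1 la == drop (first_diff ka nu).+1 nu]%N) F la =
  \sum_(la <- box r B | extends ka i (a + b) la) F la.
Proof.
move=> a_gt0 b_gt0 sz_ka ltB; rewrite (exchange_big_dep xpredT) //= [RHS]big_mkcond.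
apply: eq_bigr => la _.
set Q := BIG_P; have QP nu : Q nu = extends ka i (a + b) la && (nu == lower_part ka la b).
  rewrite /Q; apply/idP/andP => [/and4P[/and3P[vs1 /eqP sum1 dr1] vs2 /eqP sum2 /eqP dr2]|[/and3P[vs /eqP sum dr] /eqP ->]].
    have [vs eqnu] := lower_part_uniq vs1 vs2 b_gt0 sum1 dr2.
    split; last by apply/eqP.
    rewrite /extends vs sum2 sum1 -addnA [(b + a)%N]addnC eqxx /=.
    apply: contraNneq dr1 => dr; move: vs1 vs2 dr.
    elim: ka nu la i {sz_ka ltB sum1 sum2 dr2 vs eqnu Q} => [|k ka IH] [|n nu] [|l la] i //=.
    move=> /and3P[? ? vs1] /and3P[? ? vs2]; case: i => [|i] /=; last exact: IH.
    move=> [eql eqla]; have := IH nu la 0%N vs1 vs2; rewrite !drop0 => /(_ eqla) /eqP ->.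
    by apply/eqP; congr (_ :: _); lia.
  have bnd : (0 < b <= sumn la - sumn ka)%N by lia.
  have [vs1 sum1 vs2 dr2] := lower_partP vs bnd.
  rewrite /extends vs1 sum1 eqxx vs2 dr2 eqxx sum !andbT /=; apply/andP; split; last by apply/eqP; lia.
  apply: contraNneq dr => dr1.
  move: dr2 dr1; move: (lower_part ka la b) vs1 vs2 sum1 => nu0.
  elim: ka nu0 la i {nu sz_ka ltB vs sum bnd Q} => [|k ka IH] [|n nu] [|l la] i //=.
  move=> /and3P[? ? vs1] /and3P[? ? vs2] sum1.
  case: (eqVneq k n) => [eqk|neqk]; case: i => [|i] /= dr2.
  - rewrite ?drop0 => -[_ eqnu]; move: sum1; rewrite eqk eqnu; lia.
  - by move=> dr1; apply: IH vs1 vs2 _ dr2 dr1; lia.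
  - by move=> [eqk]; rewrite eqk eqxx in neqk.
  - by rewrite !drop0 in dr2; rewrite dr2 => ->.
rewrite (eq_bigl _ _ QP); case: (boolP (extends ka i (a + b) la)) => [ext|_] /=; last by rewrite big_pred0_eq.
have /and3P[vs /eqP sum _] := ext.
have bnd : (0 < b <= sumn la - sumn ka)%N by lia.
have [vs1 sum1 _ _] := lower_partP vs bnd.
rewrite -big_filter filter_pred1_uniq ?box_uniq ?big_seq1 //.
rewrite mem_box (vstrip_size vs1) sz_ka eqxx /=; apply: all_gtn_sumn; lia.
Qed.

Lemma gt_zeros n : gt x n (nseq r 0%N) = 1.
Proof.
have dz : downs (nseq r 0%N) = [:: nseq r 0%N].
  by elim: (r) => [|m IHm] //=; rewrite IHm; case: m {IHm}.
elim: n => [|n IHn] /=; first by rewrite all_nseq orbT.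
by rewrite dz big_seq1 subnn expr0 mul1r IHn.
Qed.

(** [rib_right] makes a ribbon a product minus the ribbon with its last two rows merged. In the
    Pieri expansion of the product, the strips that break the condition on consecutive blocks cancel
    against the merged ribbon. [sumn be < r] keeps the last row empty, as [pieri] requires. *)
Theorem rib_expansion be : be <> [::] -> (0%N \notin be) -> (sumn be < r)%N -> (sumn be < B)%N ->
  rib x N (rev be) = \sum_(p <- fillings be) gt x N p.1.
Proof.
move: {2}(size be) (leqnn (size be)) => n; elim: n be => [|n IHn] [|a [|b be]] // szn _.
  rewrite inE eq_sym -lt0n /= addn0 => a_gt0 ltr ltB.
  have r_gt0 : (0 < r)%N by lia.
  rewrite /rev /= rib1 -[LHS]mul1r -(gt_zeros N) (@pieri _ _ _ _ _ B); last 3 first.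
  - by case: (r) r_gt0.
  - by elim: (r).
  - by rewrite sumn_nseq.
  rewrite cats0 big_map big_filter size_nseq; apply: eq_bigl => la.
  rewrite /extends !drop0 /=; case: (boolP (vstrip la _)) => //= vs; rewrite sumn_nseq add0n.
  case: eqP => //= sum; apply/esym/eqP => laE; move: sum; rewrite laE sumn_nseq; lia.
rewrite !inE !negb_or => /and3P[a_neq0 b_neq0 be_pos] ltr ltB.
have a_gt0 : (0 < a)%N by rewrite lt0n eq_sym.
have b_gt0 : (0 < b)%N by rewrite lt0n eq_sym.
rewrite /= in ltr ltB.
have posr : all (gtn^~ 0%N) (rev be).
  rewrite all_rev; apply/allP => c c_in /=; rewrite lt0n; apply: contraNneq be_pos => <-; exact: c_in.
have := rib_right x N posr b_gt0 a_gt0; rewrite -!rev_cons => /(canRL (addrK _)) ->.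
rewrite (IHn (b :: be)) //; last 3 first.
- by rewrite inE negb_or b_neq0.
- by rewrite /=; lia.
- by rewrite /=; lia.
rewrite (IHn ((a + b)%N :: be)) //; last 3 first.
- by rewrite inE negb_or be_pos andbT; lia.
- by rewrite /=; lia.
- by rewrite /=; lia.
apply/eqP; rewrite subr_eq; apply/eqP.
rewrite mulr_suml.
transitivity (\sum_(p <- fillings (b :: be)) \sum_(la <- box r B | vstrip la p.1 && (sumn la == sumn p.1 + a)%N) gt x N la).
  apply: eq_big_seq => p /fillingsP[szp sump vsp].
  rewrite (@pieri _ _ _ _ _ B) ?szp //.
  - by move=> p0; move: szp; rewrite p0 /=; lia.
  - by apply: vstrip_last0 => //; rewrite szp sump /=; lia.
  - by rewrite sump /=; lia.
transitivity (\sum_(p <- fillings (b :: be)) \sum_(la <- box r B | extends p.1 p.2 a la) gt x N la +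
   \sum_(p <- fillings (b :: be)) \sum_(la <- box r B |
      [&& vstrip la p.1, sumn la == sumn p.1 + a & drop p.2 la == drop p.2 p.1]%N) gt x N la).
  rewrite -big_split; apply: eq_bigr => p _ /=.
  rewrite (bigID (fun la => drop p.2 la != drop p.2 p.1)) /=.
  by congr (_ + _); apply: eq_bigl => la; rewrite /extends ?negbK -!andbA.
congr (_ + _); first by rewrite [RHS]big_allpairs_dep; apply: eq_bigr => p _; rewrite big_filter.
rewrite [LHS]big_allpairs_dep [RHS]big_allpairs_dep; apply: eq_big_seq => p /fillingsP[szp sump _].
rewrite !big_filter /= -(@merge_blocks p.1 p.2 a b (gt x N)) //; by rewrite sump; lia.
Qed.

End Expansion.

(** * Linear independence of Schur polynomials *)

Lemma gt_morph (R S : comNzRingType) (f : {rmorphism R -> S}) (x : nat -> R) (y : nat -> S) N nu :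
  (forall i, i < N -> f (x i) = y i) -> f (gt x N nu) = gt y N nu.
Proof.
elim: N nu => [|N IHN] nu fx /=; first by rewrite rmorph_nat.
rewrite rmorph_sum; apply: eq_bigr => mu _; rewrite rmorphM rmorphXn /= fx // IHN // => i lti.
by apply: fx; lia.
Qed.

(** Hence the last variable occurs with exponent at most [n], and with exponent [n] only for the
    shape deprived of its first row. *)
Lemma vstrip_shift n nu mu : vstrip (n :: nu) mu ->
  sumn nu <= sumn mu /\ (sumn mu = sumn nu -> mu = rcons nu 0).
Proof.
elim: nu n mu => [|n1 nu IHnu] n [|m mu] //=.
  by case: mu => [|q mu] /=; rewrite ?andbF // => _; split=> //; rewrite addn0 => ->.
move=> /and3P[_ le1 vs]; have [le2 eq2] := IHnu n1 mu vs; split; first by lia.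
by move=> eqs; rewrite -eq2; [congr (_ :: _); lia|lia].
Qed.

Lemma vstrip_rcons0 n nu : vstrip (n :: nu) (n :: nu) ->
  vstrip (n :: nu) (rcons nu 0) /\ vstrip (rcons nu 0) (rcons nu 0).
Proof.
have consE l la q mu : vstrip (l :: la) (q :: mu) = [&& q <= l, head 0 la <= q & vstrip la mu] by [].
elim: nu n => [|m nu IHnu] n //; rewrite consE => /and3P[_ le vs].
have [vs1 vs2] := IHnu m vs; rewrite rcons_cons !consE vs1 vs2 /= leqnn !andbT; split=> //.
by case: nu vs {IHnu le vs1 vs2} => [|q nu] //= /and3P[].
Qed.

Section Independence.
Variable r : nat.
Local Open Scope ring_scope.

Lemma coef_gt (S : comNzRingType) (y : nat -> S) N n nu a : vstrip (n :: nu) (n :: nu) ->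
  (n <= a)%N ->
  (gt (fun i => if (i < N)%N then (y i)%:P else 'X) N.+1 (n :: nu))`_a =
  if n == a then gt y N (rcons nu 0%N) else 0.
Proof.
move=> vs lena.
transitivity (\sum_(mu <- downs (n :: nu) | a == (sumn (n :: nu) - sumn mu)%N) gt y N mu).
  rewrite -[gt _ N.+1 _]/(\sum_(mu <- downs (n :: nu)) _ ^+ _ * gt _ N mu) coef_sum ltnn.
  rewrite [RHS]big_mkcond; apply: eq_bigr => mu _.
  rewrite -(gt_morph (f := polyC) (x := y)); last by move=> i ->.
  by rewrite coefMC coefXn; case: eqP; rewrite ?mul1r ?mul0r.
case: eqP => [<-|neq].
  rewrite -big_filter; have -> : [seq mu <- downs (n :: nu) | n == (sumn (n :: nu) - sumn mu)%N] =
      [seq mu <- downs (n :: nu) | mu == rcons nu 0%N].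
    apply: eq_in_filter => mu; rewrite mem_downs => vs'; have [le1 eq1] := vstrip_shift vs'.
    have le2 := vstrip_sumn vs'; rewrite /= in le2 *.
    apply/eqP/eqP => [e|->]; last by rewrite sumn_rcons; lia.
    by apply: eq1; lia.
  rewrite filter_pred1_uniq ?downs_uniq ?big_seq1 // mem_downs.
  exact: (vstrip_rcons0 vs).1.
rewrite big_seq_cond big_pred0 // => mu; apply/negP => /andP[]; rewrite mem_downs => vs' /eqP e.
by have [le1 _] := vstrip_shift vs'; rewrite /= in e; lia.
Qed.

(** [S] is an iterated polynomial ring. Let [a] be the longest first row among the shapes with
    nonzero coefficient: the coefficient of ['X^a] is a relation between the shapes of first row [a]
    with that row deleted. The condition at index [N] restricts to at most [N] rows. *)
Lemma gt_free N : exists (S : comNzRingType) (y : nat -> S),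
  forall (s : seq (seq nat)) (d : seq nat -> int), uniq s ->
    (forall nu, nu \in s -> [/\ vstrip nu nu, size nu = r.+1 & nth 0%N nu N = 0%N]) ->
    \sum_(nu <- s) (d nu)%:~R * gt y N nu = 0 -> forall nu, nu \in s -> d nu = 0.
Proof.
elim: N => [|N [S [y free]]].
  exists int, (fun=> 0) => s d s_uniq s_vec sum0 nu nu_s.
  have vec mu : mu \in s -> mu = nseq r.+1 0%N.
    move=> /s_vec[vs <- hd]; elim: mu vs hd => //= m mu IHmu /and3P[_ le vs] m0.
    by rewrite m0 -IHmu //; case: (mu) le => //= q ? ; lia.
  move: sum0; rewrite (bigD1_seq nu) //= big1_seq => [|mu /andP[neq mu_s]].
    by rewrite addr0 (vec nu nu_s) all_nseq orbT mulr1 intz.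
  by rewrite (vec mu mu_s) -(vec nu nu_s) eqxx in neq.
exists {poly S}, (fun i => if (i < N)%N then (y i)%:P else 'X) => s d s_uniq s_vec sum0 nu nu_s.
apply/eqP; apply/negPn/negP => dnu.
pose s1 := [seq mu <- s | d mu != 0].
have [mu1 mu1_s max1] : exists2 mu1, mu1 \in s1 & forall mu, mu \in s1 -> (head 0 mu <= head 0 mu1)%N.
  have : nu \in s1 by rewrite mem_filter dnu.
  elim: (s1) nu {nu_s dnu} => // q s2 IHs nu _.
  case: s2 IHs => [_|q2 s2 /(_ q2 (mem_head _ _))[m m_in mmax]].
    by exists q; rewrite ?mem_head // => mu; rewrite inE => /eqP ->.
  case: (leqP (head 0 q) (head 0 m))%N => [leq|ltq].
    by exists m; [rewrite inE m_in orbT|move=> mu; rewrite inE => /predU1P[->|/mmax]].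
  exists q; first exact: mem_head.
  by move=> mu; rewrite inE => /predU1P[-> //|/mmax]; lia.
pose a := head 0%N mu1; pose s2 := [seq mu <- s1 | head 0%N mu == a].
have s2P mu : mu \in s2 -> exists mu', [/\ mu = a :: mu', vstrip mu mu, size mu' = r & nth 0%N mu' N = 0%N].
  rewrite !mem_filter => /and3P[/eqP hd _ /s_vec[vs sz nt]].
  by case: mu hd vs sz nt => // m mu /= -> vs [sz] nt; exists mu.
(* Deleting the first row appends a zero to keep the length [r.+1]; [take r] drops this zero
   again. *)
pose d' (mu : seq nat) := d (a :: take r mu).
have takeK mu' : size mu' = r -> take r (rcons mu' 0%N) = mu'.
  by move=> <-; rewrite -cats1 take_size_cat.
have shiftK mu : mu \in s2 -> d' (rcons (behead mu) 0%N) = d mu.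
  by move=> /s2P[mu' [-> _ sz _]]; rewrite /d' /= takeK.
suff : d' (rcons (behead mu1) 0%N) = 0.
  have mu1_s2 : mu1 \in s2 by rewrite mem_filter eqxx.
  by rewrite shiftK // => d0; move: mu1_s; rewrite mem_filter d0 eqxx.
apply: (free [seq rcons (behead mu) 0%N | mu <- s2]).
- rewrite map_inj_in_uniq ?filter_uniq // => mu nu' /s2P[mu' [-> _ sz _]] /s2P[nu2 [-> _ sz' _]] /=.
  by move/(congr1 (take r)); rewrite !takeK // => ->.
- move=> _ /mapP[mu /s2P[mu' [-> vs sz nt]] ->] /=; split.
  + exact: (vstrip_rcons0 vs).2.
  + by rewrite size_rcons sz.
  + by rewrite nth_rcons; case: ltngtP.
- rewrite big_map; have := congr1 (fun p : {poly S} => p`_a) sum0.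
  rewrite coef0 coef_sum => e; rewrite -[RHS]e {e}.
  rewrite big_seq (eq_bigr (fun mu => (d mu)%:~R * gt y N (rcons (behead mu) 0%N))); last first.
    by move=> mu mu_s; rewrite shiftK.
  rewrite -big_seq /s2 /s1 big_filter big_filter_cond [LHS]big_mkcond; apply: eq_big_seq => mu mu_s /=.
  rewrite [in RHS]mulrzl coefMrz -[in RHS]mulrzl; case: (eqVneq (d mu) 0) => [->|dn] /=; first by rewrite mul0r.
  have mu_s1 : mu \in s1 by rewrite mem_filter dn.
  have [vs sz _] := s_vec mu mu_s; have := max1 mu mu_s1; rewrite -/a.
  case: mu vs sz {mu_s mu_s1 dn} => // m mu vs _ lem; rewrite coef_gt //=.
  by case: ifP; rewrite ?mulr0.
by apply/mapP; exists mu1; rewrite ?mem_filter ?eqxx //=; move: mu1_s; rewrite mem_filter.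
Qed.

End Independence.

(** * Passing between partitions and vectors of fixed length; the support in terms of fillings *)

Definition pad (r : nat) (nu : seq nat) : seq nat := nu ++ nseq (r - size nu) 0.

Definition unpad (la : seq nat) : seq nat := [seq i <- la | 0 < i].

Lemma gt_pad (R : comNzRingType) (x : nat -> R) N r nu : gt x N (pad r nu) = gt x N nu.
Proof.
rewrite -!rowsum_gt /pad; move: (r - size nu) => k.
have sw0 : swords N 0 = [:: [::]] by elim: (N) => // n IHn; rewrite swordsS /= IHn.
have : forall p, rowsum x col_lt N p (nu ++ nseq k 0) = rowsum x col_lt N p nu.
  elim: nu => [|n nu IHnu] p /=; last first.
    by rewrite !rowsum_cons; apply: eq_bigr => u _; rewrite IHnu.
  elim: k p => // k IHk p; rewrite rowsum_cons sw0 big_mkcond big_seq1 IHk !rowsum_nil.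
  by rewrite /wt big_nil mulr1; case: p.
exact.
Qed.

Lemma size_pad r nu : size nu <= r -> size (pad r nu) = r.
Proof. by move=> le; rewrite size_cat size_nseq subnKC. Qed.

Lemma padK r nu : is_partition nu -> unpad (pad r nu) = nu.
Proof.
move=> /andP[_ pos]; rewrite /unpad filter_cat.
have -> : [seq i <- nseq (r - size nu) 0 | 0 < i] = [::] by elim: (r - size nu).
rewrite cats0; apply/all_filterP/allP => i i_nu; rewrite lt0n.
by apply: contraNneq pos => <-.
Qed.

Lemma geq_trans : transitive geq.
Proof. by move=> a b c /=; lia. Qed.

Lemma vstrip_sorted la : vstrip la la = sorted geq la.
Proof.
elim: la => //= l la ->; rewrite leqnn /=.
by case: la => //= m la; rewrite leq0n.
Qed.

Lemma unpadK r la : vstrip la la -> size la = r -> pad r (unpad la) = la.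
Proof.
move=> vs <-; rewrite /pad /unpad; elim: la vs => //= a la IHla /and3P[_ le vs].
case: (posnP a) => [a0|a_gt0] /=; last by rewrite subSS IHla.
have la0 : la = nseq (size la) 0.
  apply/all_pred1P/allP => i i_la /=; rewrite vstrip_sorted in vs.
  case: la le vs i_la {IHla} => //= b la le; rewrite (path_sortedE geq_trans) => /andP[/allP h _].
  by rewrite inE => /predU1P[->|/h /=]; lia.
have -> : [seq i <- la | 0 < i] = [::] by rewrite la0; elim: (size la).
by rewrite a0 /= -la0.
Qed.

Lemma unpad_partition la : vstrip la la -> is_partition (unpad la).
Proof.
rewrite vstrip_sorted => srt; rewrite /is_partition (sorted_filter geq_trans) //=.
by rewrite mem_filter.
Qed.

Lemma pad_sorted r nu : is_partition nu -> vstrip (pad r nu) (pad r nu).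
Proof.
move=> /andP[srt _]; rewrite vstrip_sorted /pad (sorted_pairwise geq_trans) pairwise_cat.
rewrite -(sorted_pairwise geq_trans) srt /=; apply/andP; split.
  by apply/allrelP => i j _; rewrite mem_nseq => /andP[_ /eqP ->].
by elim: (r - size nu) => //= k ->; rewrite andbT all_nseq orbT.
Qed.

Lemma big_finsupp (V : lmodType int) (c : {fsfun seq nat -> int with 0%R}) (F : seq nat -> V) s :
  uniq s -> {subset finsupp c <= s} ->
  (\sum_(nu <- finsupp c) c nu *: F nu = \sum_(nu <- s) c nu *: F nu)%R.
Proof.
move=> s_uniq sub; rewrite [RHS](bigID (fun nu => nu \in finsupp c)) /=.
rewrite [X in (_ + X)%R]big1 ?addr0; last first.
  by move=> nu nu_c; rewrite fsfun_dflt // scale0r.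
rewrite -[RHS]big_filter; apply: perm_big; apply: uniq_perm; rewrite ?filter_uniq ?fset_uniq //.
by move=> nu; rewrite mem_filter; apply/idP/andP => [nu_c|[]//]; split=> //; apply: sub.
Qed.

(** The multiplicities [cf] of the fillings form one expansion. The support allows any expansion
    [c], so linear independence has to identify [c] with [cf] at [nu]. *)
Theorem schur_supportP al r nu : al <> [::] -> 0 \notin al -> sumn al < r ->
  schur_support (ribbon al) nu <->
  is_partition nu /\ exists2 p, p \in fillings r r (rev al) & p.1 = pad r nu /\ size nu <= r.
Proof.
move=> al_nil al_pos ltr.
pose FL := fillings r r (rev al); pose L := [seq unpad p.1 | p <- FL].
have FLP p : p \in FL -> vstrip p.1 p.1 /\ size p.1 = r by move=> /fillingsP[].
have LP mu : mu \in L -> is_partition mu.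
  by move=> /mapP[p /FLP[vs _] ->]; apply: unpad_partition.
have expL N : schur_diagram N (ribbon al) = (\sum_(mu <- L) schur N mu)%R.
  rewrite ribbon_rib // -{1}[al]revK (@rib_expansion r r) ?sumn_rev ?mem_rev //; last 1 first.
  - by move=> /(congr1 rev); rewrite revK.
  rewrite big_map; apply: eq_big_seq => p p_in; have [vs sz] := FLP p p_in.
  rewrite schur_gt; last by have /andP[] := unpad_partition vs.
  by rewrite -[RHS](gt_pad _ _ r) unpadK.
pose cf := [fsfun mu in [fset mu in L]%fset => (count_mem mu L)%:R%R | 0%R : int].
have cfE mu : cf mu = (count_mem mu L)%:R%R.
  rewrite fsfunE inE; case: (boolP (mu \in L)) => // /count_memPn ->.
  by rewrite mulr0n.
have cf_sub : {subset finsupp cf <= undup L}.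
  move=> mu; rewrite mem_finsupp cfE mem_undup -has_pred1 has_count lt0n.
  by apply: contraNneq => ->.
have cf_exp : schur_expansion (ribbon al) cf.
  split=> [mu /cf_sub|N]; first by rewrite mem_undup; apply: LP.
  rewrite (big_finsupp _ (undup_uniq L) cf_sub) expL -big_undup_iterop_count.
  by apply: eq_bigr => mu _; rewrite cfE scaler_nat.
split; last first.
  move=> [nu_part [p p_in [pE sz]]]; exists cf; split=> //; rewrite cfE ltr0n -has_count has_pred1.
  by apply/mapP; exists p; rewrite // pE padK.
move=> [c [[c_part c_exp] c_gt0]].
pose s := undup (L ++ finsupp c); pose d mu : int := (c mu - cf mu)%R.
have s_part mu : mu \in s -> is_partition mu.
  by rewrite mem_undup mem_cat => /orP[/LP|/c_part].
(* With [r'.+1] variables there are at least as many variables as rows in every shape of either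
   expansion. *)
pose r' := \max_(mu <- s) size mu.
have [S [y free]] := gt_free r' r'.+1.
have sum0 : (\sum_(mu <- s) (d mu)%:~R * gt y r'.+1 (pad r'.+1 mu) = 0)%R.
  have h0 : (\sum_(mu <- s) d mu *: schur r'.+1 mu = 0)%R.
    rewrite (eq_bigr (fun mu => c mu *: schur r'.+1 mu - cf mu *: schur r'.+1 mu)%R); last first.
      by move=> mu _; rewrite scalerBl.
    rewrite sumrB -!big_finsupp ?undup_uniq //.
    - by rewrite -c_exp (cf_exp.2 r'.+1) subrr.
    - by move=> mu /cf_sub; rewrite !mem_undup mem_cat => ->.
    - by move=> mu mu_c; rewrite mem_undup mem_cat mu_c orbT.
  pose f := mmap (intmul (1%R : S)) (fun i : 'I_r'.+1 => y i).
  have := congr1 f h0; rewrite /f raddf_sum raddf0 => e; rewrite -[RHS]e {e}.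
  apply: eq_big_seq => mu mu_s; transitivity (f (d mu *: schur r'.+1 mu)%R); last by [].
  rewrite /f mmapZ gt_pad schur_gt; last by have /andP[] := s_part mu mu_s.
  congr (_ * _)%R; apply/esym; apply: gt_morph => i lti.
  by rewrite /mvar insubT /= mmapX mmap1U.
have nu_s : nu \in s.
  by rewrite mem_undup mem_cat mem_finsupp orbC; apply/orP; left; apply: contraTneq c_gt0 => ->.
have le_r' mu : mu \in s -> size mu <= r'.+1.
  by move=> mu_s; rewrite ltnW // ltnS; apply: (leq_bigmax_seq (P := xpredT) _ mu_s).
have pad_inj : {in s &, injective (pad r'.+1)}.
  by move=> mu mu' /s_part p1 /s_part p2 eqp; rewrite -(padK r'.+1 p1) eqp padK.
pose d' v := d (unpad v).
have : d' (pad r'.+1 nu) = 0%R.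
  apply: (free [seq pad r'.+1 mu | mu <- s]); last exact: map_f.
  - by rewrite map_inj_in_uniq ?undup_uniq.
  - move=> _ /mapP[mu mu_s ->]; rewrite pad_sorted ?s_part // size_pad ?le_r' //; split=> //.
    by rewrite nth_default // size_pad ?le_r'.
  - rewrite big_map -[RHS]sum0; apply: eq_big_seq => mu mu_s.
    by rewrite /d' padK ?s_part.
have nu_part := s_part nu nu_s.
rewrite /d' padK // /d => /eqP; rewrite subr_eq0 => /eqP ccf; split=> //.
move: c_gt0; rewrite ccf cfE ltr0n -has_count has_pred1 => /mapP[p p_in nuE].
have [vs sz] := FLP p p_in; exists p => //; rewrite nuE unpadK //; split=> //.
by rewrite -sz size_filter count_size.
Qed.

(** * The support of a ribbon *)

Lemma psum_cons a s k : psum (nth 0 (a :: s)) k.+1 = a + psum (nth 0 s) k.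
Proof.
elim: k => [|k IHk]; first by rewrite /= addn0.
by rewrite (psumS _ k.+1) IHk (psumS (nth 0 s) k) addnA.
Qed.

Lemma sumn_take_psum s k : sumn (take k s) = psum (nth 0 s) k.
Proof.
elim: s k => [|a s IHs] [|k] //; last by rewrite psum_cons /= IHs.
by rewrite [LHS]/=; elim: k.+1 => // n IHn; rewrite psumS -IHn nth_nil.
Qed.

Lemma sumn_psum s n : size s <= n -> sumn s = psum (nth 0 s) n.
Proof. by move=> le; rewrite -sumn_take_psum take_oversize. Qed.

Lemma blocks_rev f n : blocks f n = rev (mkseq f n).
Proof. by elim: n => // n IHn; rewrite mkseqS rev_rcons /= IHn. Qed.

Lemma blocks_nth al : blocks (nth 0 al) (size al) = rev al.
Proof. by rewrite blocks_rev mkseq_nth. Qed.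

Lemma vstripP la nu : reflect (size la = size nu /\ hstrip (nth 0 la) (nth 0 nu)) (vstrip la nu).
Proof.
elim: la nu => [|l la IHla] [|n nu] /=; try by [constructor; case].
  by constructor; split=> // j; rewrite !nth_nil.
apply: (iffP and3P) => [[le1 le2 /IHla[sz st]]|[[sz] st]].
  split; first by rewrite sz.
  by case=> [|j] /=; [rewrite nth0|exact: st].
have [/= h1 h2] := st 0; rewrite nth0 in h2; split=> //.
by apply/IHla; split=> // j; exact: st j.+1.
Qed.

Lemma first_diffP nu la : size nu = size la -> nu != la ->
  nth 0 nu (first_diff nu la) <> nth 0 la (first_diff nu la).
Proof.
elim: nu la => [|n nu IHnu] [|l la] //= [sz]; rewrite eqseq_cons.
by case: (eqVneq n l) => [->|neq] /= h; [exact: IHnu|apply/eqP].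
Qed.

Lemma first_diff_le nu la j : nth 0 nu j <> nth 0 la j -> first_diff nu la <= j.
Proof.
elim: nu la j => [|n nu IHnu] [|l la] [|j] //=; first by case: eqP.
by case: (eqVneq n l) => //= _ /IHnu.
Qed.

Lemma drop_neq i (v w : seq nat) : size v = size w -> drop i v != drop i w ->
  exists2 j, i <= j & nth 0 v j <> nth 0 w j.
Proof.
move=> sz neq; have szd : size (drop i w) = size (drop i v) by rewrite !size_drop sz.
have := first_diffP (esym szd) neq; rewrite !nth_drop => neqj.
by exists (i + first_diff (drop i v) (drop i w)); first exact: leq_addr.
Qed.

Lemma fillings_rchain r B be p : p \in fillings r B be -> rchain be (nth 0 p.1) p.2.
Proof.
elim: be p => [|a be IHbe] p.
  by rewrite inE => /eqP -> j /=; rewrite nth_nseq if_same.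
move=> /allpairsPdep[q [la [q_in + ->]]]; rewrite mem_filter mem_box.
move=> /andP[/and3P[vs /eqP sum neq] /andP[/eqP sz _]].
have [sz' st] := vstripP _ _ vs.
have cell j : nth 0 q.1 j <> nth 0 la j -> nth 0 q.1 j < nth 0 la j.
  by move=> neqj; have [le _] := st j; rewrite ltn_neqAle le andbT; apply/eqP.
exists (nth 0 q.1), q.2; split=> //; first exact: IHbe.
- exists (size la); rewrite nth_default // -!sumn_psum ?sum //.
  by rewrite -sz'.
- by have [j lej neqj] := drop_neq sz' neq; exists j; split=> //; apply: cell => /esym.
- exists (first_diff q.1 la); split; first exact: ltnSn.
  by apply: cell; apply: first_diffP => //; apply: contraNneq neq => ->.
Qed.

Lemma nth_mkseq0 f r : (forall j, r <= j -> f j = 0) -> nth 0 (mkseq f r) =1 f.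
Proof.
move=> f0 j; case: (ltnP j r) => [ltj|lej]; first by rewrite nth_mkseq.
by rewrite nth_default ?size_mkseq // f0.
Qed.

(** A filling records the least admissible bound, [rchain] any bound, hence [p.2 <= i]; a smaller
    bound only eases the condition on the next block. *)
Lemma rchain_fillings r B be nu i : 0 \notin be -> sumn be < r -> sumn be < B ->
  rchain be nu i -> exists2 p, p \in fillings r B be & p.1 = mkseq nu r /\ p.2 <= i.
Proof.
move=> pos ltr ltB.
have size_sumn (s : seq nat) : 0 \notin s -> size s <= sumn s.
  by elim: s => //= a s IHs; rewrite inE negb_or => /andP[? /IHs]; lia.
elim: be nu i pos ltr ltB => [|a be IHbe] nu i pos ltr ltB ch_nu.
  exists (nseq r 0, 0); first by rewrite inE.
  split=> //=; apply: (@eq_from_nth _ 0); rewrite size_nseq ?size_mkseq // => j ltj.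
  by rewrite nth_nseq ltj nth_mkseq // ch_nu.
have sz_be := size_sumn _ pos; have ch_nu' := ch_nu.
move: ch_nu' pos => [mu [i' [ch_mu st wt [j [lej ltj]] [j' [ltj' lt']]]]]; rewrite inE negb_or => /andP[a0 pos].
rewrite /= in ltr ltB sz_be.
have [||q q_in [qE leq]] := IHbe mu i' pos _ _ ch_mu; try by lia.
have nu0 q' : r <= q' -> nu q' = 0 by move=> ?; apply: rchain_zero ch_nu _ => /=; lia.
have mu0 q' : r <= q' -> mu q' = 0 by move=> ?; have [] := st q'; have := nu0 q'; lia.
have nthn := nth_mkseq0 nu0; have nthm := nth_mkseq0 mu0.
have sum_nu : sumn (mkseq nu r) = a + sumn be.
  rewrite (@sumn_psum _ r) ?size_mkseq // (eq_psum (fun j _ => nthn j)).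
  by rewrite (rchain_psum ch_nu) //=; lia.
have sum_mu : sumn (mkseq mu r) = sumn be.
  rewrite (@sumn_psum _ r) ?size_mkseq // (eq_psum (fun j _ => nthm j)).
  by rewrite (rchain_psum ch_mu) //=; lia.
exists (mkseq nu r, (first_diff q.1 (mkseq nu r)).+1).
  apply/allpairsPdep; exists q, (mkseq nu r); split=> //.
  rewrite mem_filter mem_box size_mkseq eqxx /= all_gtn_sumn ?sum_nu // andbT.
  rewrite /extends qE sum_nu sum_mu addnC eqxx /=; apply/andP; split.
    by apply/vstripP; rewrite !size_mkseq; split=> // k; rewrite !nthn nthm.
  apply/eqP => /(congr1 (fun s => nth 0 s (j - q.2))); rewrite !nth_drop nthn nthm.
  by have -> : q.2 + (j - q.2) = j by [lia]; lia.
split=> //=; apply: leq_ltn_trans ltj'; apply: first_diff_le.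
by rewrite qE nthn nthm; lia.
Qed.

Lemma nth_pad r nu : nth 0 (pad r nu) =1 nth 0 nu.
Proof.
move=> j; rewrite nth_cat; case: ltnP => // le.
by rewrite nth_nseq if_same nth_default.
Qed.

Lemma partition_size nu n : is_partition nu -> nth 0 nu n = 0 -> size nu <= n.
Proof.
move=> /andP[_ pos] nun; rewrite leqNgt; apply/negP => ltn.
by have := mem_nth 0 ltn; rewrite nun (negPf pos).
Qed.

Theorem ribbon_supportP al nu : al <> [::] -> 0 \notin al ->
  schur_support (ribbon al) nu <->
  is_partition nu /\ exists i, rchain (rev al) (nth 0 nu) i.
Proof.
move=> al_nil al_pos; rewrite (schur_supportP _ al_nil al_pos (ltnSn _)).
split=> -[nu_part].
  move=> [p p_in [pE _]]; split=> //; exists p.2.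
  apply: (@rchain_ext _ (nth 0 p.1)); last exact: fillings_rchain p_in.
  by rewrite pE; apply: nth_pad.
move=> [i ch_nu]; split=> //.
have sz_al (s : seq nat) : 0 \notin s -> size s <= sumn s.
  by elim: s => //= a s IHs; rewrite inE negb_or => /andP[? /IHs]; lia.
have sz : size nu <= (sumn al).+1.
  apply: leq_trans (partition_size nu_part (rchain_zero ch_nu (leqnn _))) _.
  by rewrite size_rev; have := sz_al _ al_pos; lia.
have [||||p p_in [pE _]] := @rchain_fillings (sumn al).+1 (sumn al).+1 (rev al) (nth 0 nu) i.
- by rewrite mem_rev.
- by rewrite sumn_rev.
- by rewrite sumn_rev.
- exact: ch_nu.
exists p => //; split=> //; rewrite pE; apply: (@eq_from_nth _ 0); rewrite size_mkseq ?size_pad //.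
by move=> j ltj; rewrite nth_mkseq // nth_pad.
Qed.

Lemma partition_noninc nu : is_partition nu -> noninc (nth 0 nu).
Proof.
move=> /andP[srt _] j; case: (ltnP j.+1 (size nu)) => [lt|le]; last by rewrite nth_default.
by move/(sortedP 0): srt => /(_ j lt).
Qed.

Lemma partition_of_noninc f n : noninc f -> f n = 0 ->
  exists nu, is_partition nu /\ nth 0 nu =1 f.
Proof.
move=> f_ni fn; exists (unpad (mkseq f n)).
have f0 j : n <= j -> f j = 0 by apply: noninc_eq0.
have vs : vstrip (mkseq f n) (mkseq f n).
  by apply/vstripP; split=> // j; rewrite !nth_mkseq0.
split; first exact: unpad_partition.
by move=> j; rewrite -(nth_pad n) unpadK ?size_mkseq // nth_mkseq0.
Qed.

Section Alpha.
Variable al : seq nat.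
Hypotheses (al_part : is_partition al) (al_nil : al <> [::]).
Hypothesis al_ge2 : forall a, a \in al -> 2 <= a.
Let l := size al.
Let f := nth 0 al.

Lemma l_pos : 0 < l.
Proof. by rewrite /l; case: (al) al_nil. Qed.

Lemma alf_ge2 j : j < l -> 2 <= f j.
Proof. by move=> ltj; apply: al_ge2; apply: mem_nth. Qed.

Lemma alf_noninc i j : i <= j -> j < l -> f j <= f i.
Proof. by move=> le _; apply: noninc_le (partition_noninc al_part) le. Qed.

(** Once the totals agree, dominance by a shape with two rows is only a bound on the first row: the
    last conjunct. *)
Definition in_interval (nu : seq nat) : Prop :=
  [/\ is_partition nu, nth 0 nu l = 0 & psum (nth 0 nu) l = psum f l] /\
  (forall m, m <= l -> psum f m <= psum (nth 0 nu) m) /\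
  nth 0 nu 0 + l.-1 <= psum f l.

Lemma psum_f : psum f l = sumn al.
Proof. by rewrite -sumn_psum. Qed.

Lemma l_le_sumn : 2 * l <= sumn al.
Proof.
have := @psum_ge_const f 2 0 l (leq0n l); rewrite psum_f subn0 add0n mulnC; apply.
by move=> j ltj; apply: alf_ge2; lia.
Qed.

Lemma intervalP nu :
  dominance_interval al [:: sumn al - size al + 1; size al - 1] nu <-> in_interval nu.
Proof.
have l_gt0 := l_pos; have le_l := l_le_sumn; rewrite -/l; split.
  move=> [nu_part [sum_al dom] [sum_nu dom']].
  have dm m : psum f m <= psum (nth 0 nu) m by rewrite -!sumn_take_psum.
  have sz : sumn nu = psum f l by rewrite psum_f.
  have tot : psum (nth 0 nu) l = psum f l.
    apply/eqP; rewrite eqn_leq dm andbT -sz -sumn_take_psum -{2}(cat_take_drop l nu) sumn_cat.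
    exact: leq_addr.
  split; last first.
    split; first by move=> m _; apply: dm.
    have := dom' 1; rewrite !sumn_take_psum /= psum_f; lia.
  split=> //; have := sumn_psum (leq_maxl (size nu) l.+1); rewrite sz.
  by have := leq_psum (nth 0 nu) (leq_maxr (size nu) l.+1); rewrite psumS tot; lia.
move=> [[nu_part nul tot] [dom out]].
have sz := partition_size nu_part nul.
have sum_nu : sumn nu = sumn al by rewrite (sumn_psum sz) tot psum_f.
split=> //.
  split; first by rewrite sum_nu.
  move=> k; rewrite !sumn_take_psum; case: (leqP k l) => [|ltk]; first exact: dom.
  by rewrite -/f -(@sumn_psum al) -?(@sumn_psum nu) ?sum_nu //; rewrite -?/l; lia.
split; first by rewrite sum_nu /=; lia.
move=> [|[|k]]; rewrite ?take0 //.
  by rewrite sumn_take_psum /=; move: out; rewrite psum_f; lia.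
have -> : take k.+2 [:: sumn al - l + 1; l - 1] = [:: sumn al - l + 1; l - 1] by case: k.
have : sumn (take k.+2 nu) <= sumn nu by rewrite -{2}(cat_take_drop k.+2 nu) sumn_cat leq_addr.
by rewrite sum_nu /=; lia.
Qed.

Definition row_bounded (nu : nat -> nat) : Prop :=
  forall k, k < l -> nu k + (l - k.+1) + psum f k <= psum f l.

Lemma al_pos0 : 0 \notin al.
Proof. by case/andP: al_part. Qed.

Lemma support_row_bounded nu : schur_support (ribbon al) nu -> row_bounded (nth 0 nu).
Proof.
move=> /(ribbon_supportP _ al_nil al_pos0)[_ [i ch_nu]] k ltk.
have := rchain_row_bound (k := k) ch_nu; rewrite size_rev -/l => /(_ ltk).
rewrite take_rev sumn_rev -/l subKn ?(ltnW ltk) //.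
have : sumn (take k al) + sumn (drop k al) = sumn al by rewrite -sumn_cat cat_take_drop.
by rewrite sumn_take_psum -/f psum_f; lia.
Qed.

Lemma interval_support nu : in_interval nu -> row_bounded (nth 0 nu) ->
  schur_support (ribbon al) nu.
Proof.
move=> [[nu_part nul tot] [dom _]] rb; apply/(ribbon_supportP _ al_nil al_pos0); split=> //.
rewrite -blocks_nth; apply: rchain_sufficient => //.
- exact: alf_noninc.
- exact: alf_ge2.
- exact: l_pos.
- exact: partition_noninc.
Qed.

Variable be : seq nat.
Hypothesis be_al : perm_eq be al.

Lemma be_facts : [/\ be <> [::], 0 \notin be, size be = l & sumn be = sumn al].
Proof.
split; last exact: perm_sumn.
- by move=> be0; move: be_al; rewrite be0 perm_sym => /perm_nilP.
- by rewrite (perm_mem be_al) al_pos0.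
- exact: perm_size.
Qed.

Lemma subseq_perm_rev s : subseq s be -> exists2 s', subseq s' (rev al) & perm_eq s s'.
Proof.
move=> sub; apply/count_subseqP => x; rewrite count_rev -(permP be_al).
exact: leq_count_subseq.
Qed.

Lemma take_subseq_perm m : exists2 s', subseq s' (rev be) & perm_eq (take m al) s'.
Proof.
apply/count_subseqP => x; rewrite count_rev (permP be_al).
by apply: leq_count_subseq; apply: take_subseq.
Qed.

Lemma support_interval nu : schur_support (ribbon be) nu -> in_interval nu.
Proof.
have [be_nil be_pos sz_be sum_be] := be_facts.
move=> /(ribbon_supportP _ be_nil be_pos)[nu_part [i ch_nu]].
have l_gt0 := l_pos; split; last split.
- split=> //; first by apply: rchain_zero ch_nu _; rewrite size_rev sz_be.
  by rewrite (rchain_psum ch_nu) ?size_rev ?sz_be // sumn_rev sum_be psum_f.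
- move=> m lem; have [s' sub ps] := take_subseq_perm m.
  have -> : psum f m = sumn (take m al) by rewrite sumn_take_psum.
  rewrite (perm_sumn ps); apply: rchain_dominates ch_nu sub _.
  by rewrite -(perm_size ps) size_take_min geq_minl.
have := rchain_row_bound (k := 0) ch_nu; rewrite size_rev sz_be => /(_ l_gt0).
rewrite subn0 take_oversize ?size_rev ?sz_be // sumn_rev sum_be psum_f; lia.
Qed.

(** The shape [al] has a filling with each block in its own row, so [rchain_dominates] bounds the
    sum of any parts by the sum of as many first rows of [al]. *)
Lemma interval_dominates nu s : in_interval nu -> subseq s be -> size s <= l ->
  sumn s <= psum (nth 0 nu) (size s).
Proof.
move=> [_ [dom _]] sub szs; apply: leq_trans (dom _ szs).
have [s' sub' ps] := subseq_perm_rev sub; rewrite (perm_sumn ps) (perm_size ps).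
have ch := @rchain_rows f l alf_noninc (fun j ltj => ltnW (alf_ge2 ltj)).
rewrite /f blocks_nth in ch; apply: leq_trans (rchain_dominates ch sub' (leqnn _)) _.
rewrite (eq_psum (g := f)) // => j ltj; rewrite ifT //.
by move: szs; rewrite (perm_size ps) -/l; lia.
Qed.

End Alpha.

(** * Full equivalence class and full support *)

Lemma perm_swap_rows al k : 0 < k < size al ->
  perm_eq (mkseq (swap_rows (nth 0 al) k) (size al)) al.
Proof.
move=> ltk; pose sg j := if j == k.-1 then k else if j == k then k.-1 else j.
have sgK : involutive sg.
  move=> j; rewrite /sg; case: (eqVneq j k.-1) => [->|n1].
    by have -> : (k == k.-1) = false by [lia]; rewrite eqxx.
  case: (eqVneq j k) => [->|n2]; first by rewrite eqxx.
  by rewrite (negPf n1) (negPf n2).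
have -> : mkseq (swap_rows (nth 0 al) k) (size al) =
    [seq nth 0 al j | j <- [seq sg j | j <- iota 0 (size al)]].
  rewrite -map_comp; apply: eq_map => j; rewrite /swap_rows /sg /=.
  by case: (j == k.-1); case: (j == k).
rewrite -{3}(mkseq_nth 0 al); apply: perm_map; apply: uniq_perm; rewrite ?iota_uniq //.
  by rewrite map_inj_uniq ?iota_uniq //; apply: inv_inj.
move=> j; rewrite mem_iota; apply/mapP/idP => [[i + ->]|ltj].
  by rewrite mem_iota /sg; case: (eqVneq i k.-1); case: (eqVneq i k); lia.
exists (sg j); rewrite ?sgK // mem_iota /sg.
by case: (eqVneq j k.-1); case: (eqVneq j k); lia.
Qed.

Lemma full_class_full_support al : is_partition al -> al <> [::] ->
  (forall a, a \in al -> 2 <= a) -> full_equivalence_class al -> full_schur_support al.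
Proof.
move=> al_part al_nil al_ge2 fec nu; rewrite intervalP //.
split; first by apply: support_interval; rewrite ?perm_refl.
move=> itv; have [[nu_part nul tot] [dom out]] := itv.
have [/forallP rb|] := boolP [forall k : 'I_(size al), nth 0 nu k + (size al - k.+1) +
    psum (nth 0 al) k <= psum (nth 0 al) (size al)].
  by apply: interval_support => // k ltk; apply: rb (Ordinal ltk).
rewrite negb_forall => /existsP[[k ltk] /=]; rewrite -ltnNge => big; exfalso.
have k_gt0 : 0 < k < size al.
  (* At row 0, (1) is the upper end of the interval, so it can fail only further down. *)
  by rewrite ltk andbT lt0n; apply/eqP => k0; move: big out; rewrite k0 /=; lia.
have [nu' [i [big' ch']]] := rchain_swap (alf_noninc al_part) (alf_ge2 al_ge2) k_gt0
  (partition_noninc nu_part) tot dom big.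
have nu'0 : nu' (size al) = 0.
  by apply: rchain_zero ch' _; rewrite blocks_rev size_rev size_mkseq.
have [nu2 [nu2_part nu2E]] := partition_of_noninc (rchain_noninc ch') nu'0.
have be_al := perm_swap_rows k_gt0; set be := mkseq _ _ in be_al.
have [be_nil be_pos _ _] := be_facts al_part al_nil be_al.
have : schur_support (ribbon be) nu2.
  apply/(ribbon_supportP _ be_nil be_pos); split=> //; exists i.
  by rewrite -blocks_rev; apply: rchain_ext ch' => j; rewrite nu2E.
move/(fec be be_al nu2)/(support_row_bounded al_part al_nil) => /(_ k ltk).
by rewrite nu2E; lia.
Qed.

(** [full] is applied to particular shapes that break (1); that these cannot lie in the interval
    gives the inequalities between parts on which the explicit fillings rely. *)
Lemma small_rchain al be nu : is_partition al -> al <> [::] ->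
  (forall a, a \in al -> 2 <= a) -> size al <= 4 -> perm_eq be al ->
  (forall nu, in_interval al nu -> row_bounded al (nth 0 nu)) ->
  in_interval al nu -> exists i, rchain (rev be) (nth 0 nu) i.
Proof.
move=> al_part al_nil al_ge2 le4 be_al full itv.
have domS s := interval_dominates al_part al_ge2 be_al itv (s := s).
have [_ _ sz_be sum_be] := be_facts al_part al_nil be_al.
have cnt P := permP be_al P.
have be_ge2 b : b \in be -> 2 <= b by rewrite (perm_mem be_al); apply: al_ge2.
have [[nu_part nul tot] [_ out]] := itv; have nu_ni := partition_noninc nu_part.
have nu4 : nth 0 nu 4 = 0 by apply: noninc_eq0 nul _.
have nuE : shape4 (nth 0 nu 0) (nth 0 nu 1) (nth 0 nu 2) (nth 0 nu 3) =1 nth 0 nu.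
  move=> [|[|[|[|j]]]] //; rewrite /shape4 /= nth_nil.
  by rewrite (noninc_eq0 nu_ni nu4).
have sub (m : seq bool) : subseq (mask m be) be by apply: mask_subseq.
have ni0 := nu_ni 0; have ni1 := nu_ni 1; have ni2 := nu_ni 2.
suff [i ch] : exists i, rchain (rev be) (shape4 (nth 0 nu 0) (nth 0 nu 1) (nth 0 nu 2) (nth 0 nu 3)) i.
  by exists i; apply: rchain_ext ch.
clear nuE be_al nu_ni; have /andP[srt _] := al_part.
case: al srt le4 al_part al_nil al_ge2 cnt itv nul tot out domS sz_be sum_be full
  => [|x [|y [|z [|w [|? ?]]]]] // srt _ al_part _ al_ge2 cnt itv nul tot out domS;
case: be cnt domS be_ge2 sub => [|b1 [|b2 [|b3 [|b4 [|? ?]]]]] // cnt domS be_ge2 sub _ sum_be full;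
rewrite /= in srt nul tot out sum_be.
- have b1_ge2 := be_ge2 b1 (mem_head _ _).
  have -> : nth 0 nu 0 = b1 by lia.
  have -> : nth 0 nu 1 = 0 by lia.
  have -> : nth 0 nu 2 = 0 by lia.
  have -> : nth 0 nu 3 = 0 by lia.
  by exists 1; apply: rchain1; lia.
- have d1 := domS _ (sub [:: true; false]) isT; have d2 := domS _ (sub [:: false; true]) isT.
  rewrite /= in d1 d2.
  have -> : nth 0 nu 2 = 0 by lia.
  have -> : nth 0 nu 3 = 0 by lia.
  have [||||ch _] := @rchain2 b1 b2 (nth 0 nu 0) (nth 0 nu 1); try by lia.
  by exists 2.
- have d1 := domS _ (sub [:: true; false; false]) isT.
  have d2 := domS _ (sub [:: false; true; false]) isT.
  have d3 := domS _ (sub [:: false; false; true]) isT.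
  have d12 := domS _ (sub [:: true; true; false]) isT.
  have d13 := domS _ (sub [:: true; false; true]) isT.
  have d23 := domS _ (sub [:: false; true; true]) isT.
  rewrite /= in d1 d2 d3 d12 d13 d23.
  have [g1 g2 g3] : [/\ 2 <= b1, 2 <= b2 & 2 <= b3].
    by split; apply: be_ge2; rewrite !inE eqxx ?orbT.
  have xP := al_ge2 x (mem_head _ _).
  have [yP zP] : 2 <= y /\ 2 <= z by split; apply: al_ge2; rewrite !inE eqxx ?orbT.
  have -> : nth 0 nu 3 = 0 by lia.
  have [n2_0|n2_gt0] := posnP (nth 0 nu 2); last first.
    have [] := @rchain3_pos b1 b2 b3 (nth 0 nu 0) (nth 0 nu 1) (nth 0 nu 2); try by lia.
    by move=> ch _; exists 3.
  have tri : x < y + z.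
    rewrite ltnNge; apply/negP => le.
    (* At row 1, (1) allows [y + z - 1] cells. *)
    suff /full/(_ 1 isT) : in_interval [:: x; y; z] [:: x; y + z] by rewrite /=; lia.
    split; last split; rewrite /=; [split=> //=|case=> [|[|[|[|m]]]] //= _|]; try lia.
    by rewrite /is_partition /= ?inE ?leqnn /=; lia.
  have := cnt (ltn x); rewrite /= => cx.
  have [] := @rchain3_zero b1 b2 b3 (nth 0 nu 0) (nth 0 nu 1) (nth 0 nu 2); try by lia.
  by move=> ch _; exists 2.
have d1 := domS _ (sub [:: true; false; false; false]) isT.
have d2 := domS _ (sub [:: false; true; false; false]) isT.
have d3 := domS _ (sub [:: false; false; true; false]) isT.
have d4 := domS _ (sub [:: false; false; false; true]) isT.
have d12 := domS _ (sub [:: true; true; false; false]) isT.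
have d13 := domS _ (sub [:: true; false; true; false]) isT.
have d14 := domS _ (sub [:: true; false; false; true]) isT.
have d23 := domS _ (sub [:: false; true; true; false]) isT.
have d24 := domS _ (sub [:: false; true; false; true]) isT.
have d34 := domS _ (sub [:: false; false; true; true]) isT.
have d123 := domS _ (sub [:: true; true; true; false]) isT.
have d124 := domS _ (sub [:: true; true; false; true]) isT.
have d134 := domS _ (sub [:: true; false; true; true]) isT.
have d234 := domS _ (sub [:: false; true; true; true]) isT.
rewrite /= in d1 d2 d3 d4 d12 d13 d14 d23 d24 d34 d123 d124 d134 d234.
have [g1 g2 g3 g4] : [/\ 2 <= b1, 2 <= b2, 2 <= b3 & 2 <= b4].
  by split; apply: be_ge2; rewrite !inE eqxx ?orbT.
have [xP yP zP wP] : [/\ 2 <= x, 2 <= y, 2 <= z & 2 <= w].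
  by split; apply: al_ge2; rewrite !inE eqxx ?orbT.
have big : x + 3 <= y + z + w.
  clear - full srt xP yP zP wP; rewrite leqNgt; apply/negP => lt.
  (* At row 1, (1) allows [y + z + w - 2] cells, and both test shapes have one more; in the second
     case [x = y + z + w - 2]. *)
  case: (leqP (y + z + w - 1) x) => [le|gt].
    suff /full/(_ 1 isT) : in_interval [:: x; y; z; w] [:: x; y + z + w - 1; 1] by rewrite /=; lia.
    split; last split; rewrite /=; [split=> //=|case=> [|[|[|[|[|m]]]]] //= _|]; try lia.
    by rewrite /is_partition /= ?inE ?leqnn /=; lia.
  suff /full/(_ 1 isT) : in_interval [:: x; y; z; w] [:: x.+1; x.+1] by rewrite /=; lia.
  split; last split; rewrite /=; [split=> //=|case=> [|[|[|[|[|m]]]]] //= _|]; try lia.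
  by rewrite /is_partition /= ?inE ?leqnn /=; lia.
have pr : y < z + w.
  clear - full srt xP yP zP wP; rewrite ltnNge; apply/negP => le.
  (* At row 2, (1) allows [z + w - 1] cells. *)
  suff /full/(_ 2 isT) : in_interval [:: x; y; z; w] [:: x; y; z + w] by rewrite /=; lia.
  split; last split; rewrite /=; [split=> //=|case=> [|[|[|[|[|m]]]]] //= _|]; try lia.
  by rewrite /is_partition /= ?inE ?leqnn /=; lia.
(* No entry of the rearrangement exceeds [x] and at most one exceeds [y], so of any two entries the
   smaller is at most [y]. *)
have := cnt (ltn x); have := cnt (ltn y); rewrite /= => cy cx.
have bx : [/\ b1 <= x, b2 <= x, b3 <= x & b4 <= x] by clear - cx srt; split; lia.
have mins : [/\ minn b1 b2 <= y, minn b1 b4 <= y, minn b2 b4 <= y & minn b3 b4 <= y].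
  by clear - cy srt; split; lia.
have pairs2 : [/\ b1 + b2 <= x + y, b1 + b4 <= x + y, b2 + b4 <= x + y & b3 + b4 <= x + y].
  by clear - bx mins; case: bx => ? ? ? ?; case: mins => ? ? ? ?; split; lia.
have big4 : [/\ b1 + 3 <= b2 + b3 + b4, b2 + 3 <= b1 + b3 + b4,
    b3 + 3 <= b1 + b2 + b4 & b4 + 3 <= b1 + b2 + b3].
  by clear - bx big sum_be; case: bx => ? ? ? ?; split; lia.
have pr4 : [/\ minn b1 b2 < b3 + b4, minn b1 b4 < b2 + b3, minn b2 b4 < b1 + b3
    & minn b3 b4 < b1 + b2].
  by clear - mins pairs2 pr sum_be; case: mins => ? ? ? ?; case: pairs2 => ? ? ? ?; split; lia.
have t4 : nth 0 nu 0 + nth 0 nu 1 + nth 0 nu 2 + nth 0 nu 3 = b1 + b2 + b3 + b4 by lia.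
have dom1 : [/\ b1 <= nth 0 nu 0, b2 <= nth 0 nu 0, b3 <= nth 0 nu 0 & b4 <= nth 0 nu 0].
  by split; lia.
have dom2 : [/\ b1 + b2 <= nth 0 nu 0 + nth 0 nu 1, b1 + b3 <= nth 0 nu 0 + nth 0 nu 1
      & b1 + b4 <= nth 0 nu 0 + nth 0 nu 1] /\
    [/\ b2 + b3 <= nth 0 nu 0 + nth 0 nu 1, b2 + b4 <= nth 0 nu 0 + nth 0 nu 1
      & b3 + b4 <= nth 0 nu 0 + nth 0 nu 1] by split; split; lia.
have dom3 : [/\ nth 0 nu 3 <= b1, nth 0 nu 3 <= b2, nth 0 nu 3 <= b3 & nth 0 nu 3 <= b4].
  by split; lia.
have out3 : 3 <= nth 0 nu 1 + nth 0 nu 2 + nth 0 nu 3 by lia.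
clear d1 d2 d3 d4 d12 d13 d14 d23 d24 d34 d123 d124 d134 d234 bx mins pairs2 big pr cx cy.
have [n3_0|n3_gt0] := posnP (nth 0 nu 3); last by apply: rchain4_pos.
have [n2_0|n2_gt0] := posnP (nth 0 nu 2); first by apply: rchain4_two_rows.
by apply: rchain4_three_rows.
Qed.

Theorem theorem1p12 (alpha : seq nat)
    (alpha_partition : is_partition alpha)
    (alpha_nonempty : alpha <> [::])
    (alpha_parts_ge2 : forall a : nat, a \in alpha -> 2 <= a) :
  (full_equivalence_class alpha -> full_schur_support alpha) /\
  (size alpha <= 4 -> (full_equivalence_class alpha <-> full_schur_support alpha)).
Proof.
have part1 := full_class_full_support alpha_partition alpha_nonempty alpha_parts_ge2.
split=> // le4; split=> // full be be_al nu.
have supp_itv ga : schur_support (ribbon alpha) ga <-> in_interval alpha ga.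
  by rewrite (full ga) intervalP.
(* The support of every rearrangement lies in the interval; the converse inclusion calls for the
   fillings. *)
rewrite supp_itv; split; last exact: support_interval.
move=> itv; have [be_nil be_pos _ _] := be_facts alpha_partition alpha_nonempty be_al.
apply/(ribbon_supportP _ be_nil be_pos); split; first by case: itv => [[]].
apply: (small_rchain alpha_partition _ _ le4 be_al _ itv) => // ga /supp_itv.
exact: (support_row_bounded alpha_partition alpha_nonempty).
Qed.
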